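(* For all odd integers $n \geqslant 3$ and all small $\varepsilon > 0$, $$\sum_{\substack{m=1 \\ (m,n)=1}}^n \left| S_2(n,m) - \tfrac14 n^2 \varphi(n) \right|^2 = \frac{5 C_n}{144} \bigl( n \varphi(n) \bigr)^3 + O\left( n^{5+\varepsilon} \right),$$ where the implied constant depends at most on $\varepsilon$. In particular, there is an absolute constant $c>0$ such that for all sufficiently large odd $n$, there exists an integer $m \in \{1,\dots,n\}$ with $(m,n)=1$ and $$\left| S_2(n,m) - \tfrac14 n^2 \varphi(n) \right| \geqslant c\, n^{3/2} \varphi(n).$$
   Context: $(a,b)$ denotes the greatest common divisor and $\varphi$ is Euler's totient function. For integers $n \geqslant 2$, $m \geqslant 1$ with $(m,n)=1$, $$S_2(n,m) := \sum_{\substack{1 \leqslant a,b \leqslant n \\ ab \equiv m \ (\mathrm{mod}\ n)}} ab ,$$ with the convention that only pairs with $(a,n)=(b,n)=1$ contribute (this is automatic because $(m,n)=1$). For odd $n \geqslant 3$, $$C_n := \prod_{p^\alpha \| n} \left( 1 + \frac{2p^3+p^2-1}{(p^2+1)(p^2+p+1)} - \frac{1}{p^{3(\alpha-1)}(p^2+p+1)} \right),$$ the product being over all primes $p$ dividing $n$, with $\alpha \geqslant 1$ the exact exponent of $p$ in $n$. *)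

(* Defs.v *)
From mathcomp Require Import all_boot all_order all_algebra.
From mathcomp Require Import reals exp.

Set Implicit Arguments.
Unset Strict Implicit.
Unset Printing Implicit Defensive.

Import Order.TTheory GRing.Theory Num.Theory.

Local Open Scope ring_scope.

(* The residues 1, ..., n represent the classes mod n.  When m is coprime to n,
   the coprimality conditions on a and b follow from a * b = m mod n. *)
Definition S2 (n m : nat) : nat :=
  (\sum_(1 <= a < n.+1 | coprime a n)
     \sum_(1 <= b < n.+1 | coprime b n && (a * b == m %[mod n])) a * b)%N.

(* The exponent 3 (alpha - 1) is a natural number since logn p n >= 1 for every
   p in primes n, so the truncated predecessor is exact. *)
Definition Cfactor (R : realType) (p alpha : nat) : R :=
  1 + (2 * p%:R ^+ 3 + p%:R ^+ 2 - 1)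
        / ((p%:R ^+ 2 + 1) * (p%:R ^+ 2 + p%:R + 1))
    - 1 / (p%:R ^+ (3 * alpha.-1) * (p%:R ^+ 2 + p%:R + 1)).

Definition C (R : realType) (n : nat) : R :=
  \prod_(p <- primes n) Cfactor R p (logn p n).

Definition deviation (R : realType) (n m : nat) : R :=
  `| (S2 n m)%:R - 1 / 4 * n%:R ^+ 2 * (totient n)%:R |.

(* Main.v *)
Require Import Defs.
From mathcomp Require Import all_boot all_order all_algebra.
From mathcomp Require Import zify ring lra.
From mathcomp Require Import reals topology normedtype sequences derive exp trigo.

(**
Why the theorem holds.  Put psi(a) = a - n/2 for a prime to n.  As a and b = m/a both
run over the units, S_2(n,m) - n^2 phi(n)/4 is the sum of psi(a) psi(b) over ab = m
(S2_unit_conv), so the second moment in m is the sum of psi(a) psi(b) psi(c) psi(d)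
over units with ab = cd.  Reading this condition as a/d = c/b = h shows that it is
also the second moment, over the units h, of the Dedekind sum
D(h) = sum of psi(d) psi(hd) over the units d (deviation_second_moment).  The gain is
that D(h) has an explicit finite Fourier expansion (unit_dedekind_cot):
D(h) = (n/4) sum over j mod n of w(j) cot(pi j/n) cot(pi hj/n), where
w(j) = prod of (1 - p) over the primes p dividing both n and j.

Since cot(pi j/n) is n/(pi j) up to a bounded error, the sum of D(h)^2 is essentially
a sum of w(a) w(c)/(abcd) over 1 <= a, b, c, d <= n/2 and units h with ha = b or -b
and hc = d or -d modulo n.  Such an h forces ad = bc or -bc modulo n (and more, when
a and c share a factor with n).  Quadruples for which ad = bc fails as integers, or
for which the two signs differ, are rare: by the divisor bound they contribute
O(n^(5+eps)) (offdiag_bound, unit_dedekind_second_moment).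

On the diagonal, (a, b) = t(x, y) and (c, d) = u(x, y) with x, y coprime, and the sum
becomes a sum over (x, y) and h of the square of one sum over t
(sum4_diag_primitive).  For fixed (x, y) and h, t runs over the multiples of
r = n/gcd(n, hx - y), and the sum over t is (pi^2/6) r^-2 times a finite product over
the primes dividing n (sieved_sum_asymp).  The value pi^2/6 comes out of the exact
formula for the sum of cot^2, which is Parseval for psi; its square cancels the pi^4
of the cotangents, so that only rational constants are left.

It remains to sum a product over the primes of n over all h and all coprime (x, y).
The number of units h with hx = y modulo a divisor e of n is phi(n)/phi(e) when e is
prime to xy and 0 otherwise (count_units_cong).  The sum of 1/(xy)^2 over coprime
pairs is 5/2, by a telescoping identity of Zagier along x -> x + y
(coprime_sq_sum_asymp), and excluding the pairs with p dividing xy multiplies it by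
(p^2-1)/(p^2+1) (sieved_sq_sum_step).  Hence the sum factors over the primes of n
(layer_sum_asymp), and the factor at p, with a the exponent of p in n, is exactly
(1 - 1/p)^2/p^a times the factor of C_n (local_factorE).  All the error terms are at
most n^5 times a power of a quantity T that bounds the number of divisors of the
integers up to n^2 and a harmonic sum (second_moment_bound); T is smaller than any
power of n.

For the lower bound, C_n >= 1 and n/phi(n) is at most the number of divisors of n, so
the main term exceeds the error term for large n, and some m must reach the mean.
*)

Set Implicit Arguments.
Unset Strict Implicit.
Unset Printing Implicit Defensive.

Import Order.TTheory GRing.Theory Num.Theory.
Import numFieldNormedType.Exports.

Local Open Scope ring_scope.

(** * The divisor bound and harmonic sums *)

(** The form in which most counting arguments below are used: an injection of the summation
range into a larger one can only increase a sum of nonnegative terms. *)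
Lemma sum_inj_le (R : numDomainType) (I J : eqType) (s : seq I) (t : seq J)
    (P : pred I) (f : I -> J) (F : J -> R) :
  uniq s -> uniq t ->
  (forall x, x \in s -> P x -> f x \in t) ->
  (forall x y, x \in s -> y \in s -> P x -> P y -> f x = f y -> x = y) ->
  (forall k, k \in t -> 0 <= F k) ->
  \sum_(x <- s | P x) F (f x) <= \sum_(k <- t) F k.
Proof.
move=> us ut st inj F0.
rewrite -big_filter -(big_map f predT) /=.
set r := map f _.
have ur : uniq r.
  rewrite map_inj_in_uniq ?filter_uniq// => x y.
  by rewrite !mem_filter => /andP[Px xs] /andP[Py ys]; apply: inj.
have rt : {subset r <= t}.
  by move=> _ /mapP[x + ->]; rewrite mem_filter => /andP[Px xs]; apply: st.
rewrite [leRHS](bigID (mem r))/= -[\sum_(k <- t | k \in r) _]big_filter.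
have pr : perm_eq [seq k <- t | k \in r] r.
  apply: uniq_perm => //; first exact: filter_uniq.
  move=> k; rewrite mem_filter; case kr: (k \in r) => //=.
  exact: rt.
rewrite (perm_big _ pr)/= lerDl; rewrite big_seq_cond.
by apply: sumr_ge0 => k /andP[kt _]; apply: F0.
Qed.

(** Induction on the prime factorisation: one full prime power is split off at a time, so that
arithmetic functions can be compared multiplicatively. *)
Lemma nat_prime_ind (P : nat -> Prop) :
  P 1%N ->
  (forall p a m, prime p -> (0 < a)%N -> (0 < m)%N -> ~~ (p %| m)%N ->
     P m -> P (p ^ a * m)%N) ->
  forall n, (0 < n)%N -> P n.
Proof.
move=> P1 PS; elim/ltn_ind => n IH n0.
have [n1|n1] := leqP n 1; first by have -> : n = 1%N by lia.
have pp := pdiv_prime n1; set p := pdiv n in pp.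
have pn : (p %| n)%N := pdiv_dvd n.
have [m pm nE] := pfactor_coprime pp n0.
have a0 : (0 < logn p n)%N by rewrite logn_gt0 mem_primes pp n0.
have m0 : (0 < m)%N by move: n0; rewrite nE muln_gt0 => /andP[].
have pm' : ~~ (p %| m)%N by rewrite -prime_coprime.
rewrite nE mulnC; apply: PS => //; apply: IH => //.
by rewrite [ltnRHS]nE -{1}[m]muln1 ltn_pmul2l// -{1}(expn0 p) ltn_exp2l// prime_gt1.
Qed.

Lemma primesX_perm p a m : prime p -> (0 < a)%N -> (0 < m)%N -> ~~ (p %| m)%N ->
  perm_eq (primes (p ^ a * m)%N) (p :: primes m).
Proof.
move=> pp a0 m0 pm; apply: uniq_perm; first exact: primes_uniq.
  by rewrite /= primes_uniq andbT mem_primes pp m0.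
move=> q; rewrite primesM// ?expn_gt0 ?(prime_gt0 pp)// primesX// (primes_prime pp).
by rewrite !inE.
Qed.

Lemma logn_pmul p a m : prime p -> (0 < m)%N -> ~~ (p %| m)%N ->
  logn p (p ^ a * m)%N = a.
Proof.
move=> pp m0 pm; rewrite lognM ?expn_gt0 ?(prime_gt0 pp)// pfactorK//.
have /eqP-> : logn p m == 0%N by rewrite -leqn0 leqNgt logn_gt0 mem_primes pp m0 pm.
by rewrite addn0.
Qed.

Lemma size_divisorsX p a m : prime p -> (0 < m)%N -> ~~ (p %| m)%N ->
  (size (divisors (p ^ a * m)%N) <= a.+1 * size (divisors m))%N.
Proof.
move=> pp m0 pm.
have pam0 : (0 < p ^ a * m)%N by rewrite muln_gt0 expn_gt0 (prime_gt0 pp).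
have -> : (a.+1 * size (divisors m))%N =
   size [seq (p ^ i * d)%N | i <- iota 0 a.+1, d <- divisors m].
  by rewrite size_allpairs size_iota.
apply: uniq_leq_size; first exact: divisors_uniq.
move=> d; rewrite -dvdn_divisors// => dd.
have d0 : (0 < d)%N := dvdn_gt0 pam0 dd.
have [e pe dE] := pfactor_coprime pp d0.
apply/allpairsP; exists (logn p d, e); split=> /=; last by rewrite mulnC.
  rewrite -[_ \in _]/(_ \in iota 0 a.+1) mem_iota add0n ltnS -(logn_pmul a pp m0 pm).
  exact: dvdn_leq_log.
rewrite -dvdn_divisors//.
have : (e %| p ^ a * m)%N by apply: dvdn_trans dd; rewrite dE dvdn_mulr.
by rewrite Gauss_dvdr// coprime_sym coprimeXl.
Qed.

(** Each prime of n at least doubles the set of divisors. This makes every constant to the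
power of the number of primes a harmless factor. *)
Lemma exp2_omega n : (0 < n)%N -> (2 ^ size (primes n) <= size (divisors n))%N.
Proof.
elim/nat_prime_ind => // p a m pp a0 m0 pm IH.
rewrite (perm_size (primesX_perm pp a0 m0 pm)) /= expnS mul2n -addnn.
have pam0 : (0 < p ^ a * m)%N by rewrite muln_gt0 expn_gt0 (prime_gt0 pp).
apply: (@leq_trans (size (divisors m ++ map (muln p) (divisors m)))).
  by rewrite size_cat size_map leq_add.
apply: uniq_leq_size.
  rewrite cat_uniq divisors_uniq map_inj_uniq ?divisors_uniq; last first.
    by move=> x y /eqP; rewrite eqn_pmul2l ?prime_gt0// => /eqP.
  rewrite andbT; apply/hasPn => _ /mapP[d + ->]; rewrite -!dvdn_divisors// => dm.
  by apply/negP => H; move/negP: pm; apply; apply: dvdn_trans H; rewrite dvdn_mulr.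
move=> d; rewrite mem_cat -!dvdn_divisors// => /orP[dm|/mapP[e + ->]].
  by rewrite dvdn_mull.
rewrite -dvdn_divisors// => em; apply: dvdn_mul => //.
by rewrite -{1}(expn1 p) dvdn_exp2l.
Qed.

Section Asymptotics.
Variable R : realType.
Implicit Types (e x : R).

Definition harm (X : nat) : R := \sum_(1 <= k < X.+1) k%:R^-1.

Lemma exp2_size (I : Type) (s : seq I) : (2 ^ size s)%:R = \prod_(i <- s) 2 :> R.
Proof.
elim: s => [|i s IH]; first by rewrite big_nil.
by rewrite big_cons /= expnS natrM IH.
Qed.

Lemma harm_ge0 X : 0 <= harm X.
Proof. by apply: sumr_ge0 => k _; rewrite invr_ge0. Qed.

Lemma harm_mono X Y : (X <= Y)%N -> harm X <= harm Y.
Proof.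
move=> XY; rewrite /harm (@big_cat_nat _ _ _ X.+1 1 Y.+1)//= lerDl.
by apply: sumr_ge0 => k _; rewrite invr_ge0.
Qed.

Lemma harm_le_ln X : (0 < X)%N -> harm X <= 1 + ln X%:R.
Proof.
elim: X => // X IH _; rewrite /harm big_nat_recr//= -/(harm X).
have [->|X0] := posnP X.
  by rewrite /harm big_nil add0r invr1 ln1 addr0.
have X0' : (0 : R) < X%:R by rewrite ltr0n.
have X1' : (0 : R) < X.+1%:R by rewrite ltr0n.
have := @le_ln1Dx R (- X.+1%:R^-1).
have -> : 1 - X.+1%:R^-1 = X%:R / X.+1%:R :> R.
  by rewrite -[in RHS]natr1 in X1' *; rewrite -natr1; field; rewrite natr1 gt_eqF.
rewrite ln_div ?posrE// ltrNl opprK; move=> h.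
have {}h : ln (X%:R : R) - ln X.+1%:R <= - X.+1%:R^-1.
  by apply: h; rewrite invf_lt1// ltr1n.
move: (IH X0) h; move: (harm X) (ln _) (ln _) (_^-1) => *; lra.
Qed.

(** From ln y < y at y = x^e. *)
Lemma ln_le_powR e x : 0 < e -> 1 <= x -> ln x <= e^-1 * x `^ e.
Proof.
move=> e0 x1; have x0 : 0 < x by apply: lt_le_trans x1.
have := ltW (@ln_sublinear R _ (powR_gt0 e x0)); rewrite ln_powR => h.
by rewrite -(ler_pM2l e0) mulrA divff ?gt_eqF// mul1r.
Qed.

Lemma powR_ge1 e x : 0 <= e -> 1 <= x -> 1 <= x `^ e.
Proof. by move=> e0 x1; rewrite -[leLHS](powRr0 x) ler_powR. Qed.

Lemma harm_le_powR e : 0 < e ->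
  exists2 K : R, 1 <= K & forall X, (0 < X)%N -> harm X <= K * X%:R `^ e.
Proof.
move=> e0; exists (1 + e^-1); first by rewrite lerDl invr_ge0 ltW.
move=> X X0; apply: le_trans (harm_le_ln X0) _; rewrite mulrDl mul1r lerD//.
  by rewrite powR_ge1 ?ler1n// ltW.
by rewrite ln_le_powR// ler1n.
Qed.

(** The base 2 is the worst case: a + 1 is compared with exp(a e ln 2) through exp(t) >= 1 + t. *)
Lemma prime_power_bound e : 0 < e ->
  exists2 B : R, 1 <= B & forall (p a : nat), (1 < p)%N ->
    (a.+1)%:R <= B * (p ^ a)%:R `^ e.
Proof.
move=> e0; pose L : R := e * ln 2.
have L0 : 0 < L by rewrite mulr_gt0// ln_gt0// ltr1n.
exists (1 + L^-1); first by rewrite lerDl invr_ge0 ltW.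
move=> p a p1.
have p0 : (0 : R) < p%:R by rewrite ltr0n; lia.
have -> : (p ^ a)%:R `^ e = expR (e * ln p%:R * a%:R).
  by rewrite /powR gt_eqF ?ltr0n ?expn_gt0; [congr expR; rewrite natrX lnXn// -(mulr_natr (ln
    _)) mulrA|lia].
have : expR (L * a%:R) <= expR (e * ln p%:R * a%:R).
  rewrite ler_expR ler_wpM2r// /L ler_pM2l// ler_ln ?posrE// ?ltr0n// ler_nat; lia.
have h := expR_ge1Dx (L * a%:R).
move=> /(le_trans h) {}h.
have LV : 0 < 1 + L^-1 by rewrite addr_gt0// invr_gt0.
apply: le_trans (ler_wpM2l (ltW LV) h).
rewrite mulrDl mul1r mulrDr mulr1 mulrA mulVf ?gt_eqF// mul1r -natr1.
have : 0 <= L * a%:R by rewrite mulr_ge0// ltW.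
have : 0 < L^-1 by rewrite invr_gt0.
lra.
Qed.

(** Beyond exp(1/e) the constant can be dropped, because then e ln p >= 1. *)
Lemma large_prime_bound e : 0 < e ->
  exists P0 : nat, forall (p a : nat), (P0 <= p)%N -> (1 < p)%N ->
    (a.+1)%:R <= (p ^ a)%:R `^ e.
Proof.
move=> e0; pose P0 := (Num.bound (expR (e^-1 * 1))).+1.
exists P0 => p a Pp p1.
have p0 : (0 : R) < p%:R by rewrite ltr0n; lia.
have -> : (p ^ a)%:R `^ e = expR (e * ln p%:R * a%:R).
  by rewrite /powR gt_eqF ?ltr0n ?expn_gt0; [congr expR; rewrite natrX lnXn// -(mulr_natr (ln
    _)) mulrA|lia].
have h1 : 1 <= e * ln p%:R.
  rewrite -ler_pdivrMl// -ler_expR lnK ?posrE//.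
  apply: le_trans (ltW (archi_boundP (expR_ge0 _))) _.
  by rewrite ler_nat (leq_trans _ Pp)// leqnSn.
apply: le_trans (expR_ge1Dx _); rewrite -natr1 addrC lerD2l.
by rewrite ler_peMl.
Qed.

(** The number of divisors of u is at most the product of (a+1)/p^(a e) over the prime powers
p^a exactly dividing u, times u^e. Only the finitely many small primes contribute a factor
above 1, and each of them contributes at most the constant of prime_power_bound. *)
Lemma divisor_bound e : 0 < e ->
  exists2 K : R, 1 <= K & forall u, (0 < u)%N ->
    (size (divisors u))%:R <= K * u%:R `^ e.
Proof.
move=> e0; have [B B1 hB] := prime_power_bound e0.
have [P0 hP] := large_prime_bound e0.
exists (B ^+ P0); first by rewrite exprn_ege1.
have key u : (0 < u)%N -> (size (divisors u))%:R <=
   B ^+ size [seq p <- primes u | (p < P0)%N] * u%:R `^ e.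
  elim/nat_prime_ind => [|p a m pp a0 m0 pm IH].
    by rewrite /= expr0 mul1r powR1.
  have pa0 : (0 < p ^ a)%N by rewrite expn_gt0 prime_gt0.
  apply: (@le_trans _ _ ((a.+1)%:R * (size (divisors m))%:R)).
    by rewrite -natrM ler_nat size_divisorsX.
  have /(perm_filter (fun p => p < P0)%N)/perm_size-> := primesX_perm pp a0 m0 pm.
  rewrite natrM powRM ?ler0n//=.
  have [pP|pP] := ltnP p P0.
    rewrite /= exprS mulrACA.
    by apply: ler_pM; rewrite ?ler0n// hB// prime_gt1.
  rewrite mulrCA.
  by apply: ler_pM; rewrite ?ler0n// hP// prime_gt1.
move=> u u0; apply: le_trans (key u u0) _.
rewrite ler_wpM2r ?powR_ge0// ler_weXn2l//.
rewrite -[leqRHS](size_iota 0).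
apply: uniq_leq_size; first by rewrite filter_uniq// primes_uniq.
by move=> p; rewrite mem_filter mem_iota => /andP[].
Qed.

End Asymptotics.

(** * Sums over integers with prescribed products *)

Section Sums.
Variable R : realType.
Implicit Types (F : nat -> R) (N X m : nat).

Lemma sum_bool_le1 (I : eqType) (s : seq I) (P : pred I) : uniq s ->
  (forall x y, x \in s -> y \in s -> P x -> P y -> x = y) ->
  \sum_(x <- s) (P x)%:R <= 1 :> R.
Proof.
move=> us inj.
have := @sum_inj_le R _ _ s [:: tt] P (fun=> tt) (fun=> 1) us isT
  (fun _ _ _ => isT) (fun x y xs ys Px Py _ => inj x y xs ys Px Py) (fun _ _ => ler01).
rewrite big_seq1; apply: le_trans; rewrite [leRHS]big_mkcond /=.
by apply: ler_sum => x _; case: (P x).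
Qed.

(** A sum against an indicator that singles out one point. Congruence conditions are kept as
0-1 factors throughout, so that sums can be exchanged freely. *)
Lemma sum_bool_dirac (I : eqType) (s : seq I) (P : pred I) x0 (F : I -> R) : uniq s ->
  x0 \in s -> (forall x, x \in s -> P x = (x == x0)) ->
  \sum_(x <- s) (P x)%:R * F x = F x0.
Proof.
move=> us xs h.
rewrite (bigD1_seq x0)//= h// eqxx mul1r big_seq_cond big1 ?addr0// => x /andP[xs' xx].
by rewrite h// (negPf xx) mul0r.
Qed.

Lemma sum_multiples X m F : (0 < m)%N ->
  \sum_(1 <= k < X.+1) (m %| k)%:R * F k =
  \sum_(1 <= k < (X %/ m).+1) F (m * k)%N.
Proof.
move=> m0.
rewrite (eq_bigr (fun k => if (m %| k)%N then F k else 0)); last first.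
  by move=> k _; case: ifP; rewrite ?mul1r ?mul0r.
rewrite -big_mkcond -big_filter -(big_map (muln m) predT).
apply: perm_big; apply: uniq_perm.
- by rewrite filter_uniq// iota_uniq.
- rewrite map_inj_uniq ?iota_uniq// => x y /eqP.
  by rewrite eqn_pmul2l// => /eqP.
move=> k; rewrite mem_filter mem_index_iota; apply/idP/mapP => [/andP[mk]|[j + ->]].
  rewrite ltnS => /andP[k1 kX]; exists (k %/ m)%N; last by rewrite mulnC divnK.
  by rewrite mem_index_iota divn_gt0// dvdn_leq//= ltnS leq_div2r.
rewrite mem_index_iota ltnS => /andP[j1 jX].
by rewrite dvdn_mulr//= muln_gt0 m0 j1 ltnS/= mulnC -leq_divRL.
Qed.

Lemma sum_le_size1 X Y F : (X <= Y)%N -> (forall k, (0 < k)%N -> 0 <= F k) ->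
  \sum_(1 <= k < X.+1) F k <= \sum_(1 <= k < Y.+1) F k.
Proof.
move=> XY F0; rewrite (@big_cat_nat _ _ _ X.+1 1 Y.+1)//= lerDl.
rewrite big_seq_cond sumr_ge0// => k; rewrite mem_index_iota andbT => /andP[k1 _].
by apply: F0; lia.
Qed.

Lemma sum_dvd_inv X m : (0 < m)%N ->
  \sum_(1 <= k < X.+1) (m %| k)%:R / k%:R <= harm R X / m%:R.
Proof.
move=> m0; rewrite sum_multiples// /harm mulr_suml.
apply: le_trans (sum_le_size1 (leq_div X m) _); last first.
  by move=> k _; rewrite mulr_ge0// invr_ge0.
by apply: ler_sum => k _; rewrite natrM invfM mulrC.
Qed.

Lemma ler_sum1 N F G : (forall k, (0 < k <= N)%N -> F k <= G k) ->
  \sum_(1 <= k < N.+1) F k <= \sum_(1 <= k < N.+1) G k.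
Proof.
move=> h; rewrite big_seq [leRHS]big_seq; apply: ler_sum => k.
by rewrite mem_index_iota ltnS; apply: h.
Qed.

Lemma eq_sum1 N F G : (forall k, (0 < k <= N)%N -> F k = G k) ->
  \sum_(1 <= k < N.+1) F k = \sum_(1 <= k < N.+1) G k.
Proof.
move=> h; rewrite big_seq [RHS]big_seq; apply: eq_bigr => k.
by rewrite mem_index_iota ltnS; apply: h.
Qed.

(** Since v >= v - u, the term 1/(uv) is at most 1/(u(v-u)), and the difference runs over
multiples of m. *)
Lemma offdiag_sub X m : (0 < m)%N ->
  \sum_(1 <= u < X.+1) \sum_(1 <= v < X.+1)
     ((u < v)%N && (m %| v - u)%N)%:R / (u%:R * v%:R) <= harm R X ^+ 2 / m%:R.
Proof.
move=> m0; rewrite expr2 {1}/harm -mulrA mulr_suml; apply: ler_sum1 => u /andP[u0 uX].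
apply: (@le_trans _ _ (u%:R^-1 * \sum_(1 <= k < X.+1) (m %| k)%:R / k%:R)); last first.
  by rewrite ler_wpM2l ?invr_ge0// sum_dvd_inv.
have h : \sum_(1 <= v < X.+1 | (u < v)%N) ((m %| v - u)%:R / (v - u)%:R) <=
     \sum_(1 <= k < X.+1) (m %| k)%:R / k%:R :> R.
  apply: (@sum_inj_le R _ _ _ _ (fun v => u < v)%N (fun v => v - u)%N
    (fun k => (m %| k)%:R / k%:R) (iota_uniq _ _) (iota_uniq _ _)).
  - by move=> v; rewrite !mem_index_iota => *; lia.
  - by move=> v w; rewrite !mem_index_iota => *; lia.
  - by move=> k _; rewrite mulr_ge0// invr_ge0.
apply: le_trans (ler_wpM2l _ h); last by rewrite invr_ge0.
rewrite [in leRHS]big_mkcond mulr_sumr; apply: ler_sum1 => v /andP[v0 vX].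
case: ltnP => uv /=; last by rewrite mul0r mulr0.
rewrite invfM mulrCA; rewrite ler_wpM2l ?invr_ge0//.
rewrite ler_wpM2l// lef_pV2 ?posrE ?ltr0n ?ler_nat//; lia.
Qed.

(** Here 1/(uv) = (1/u + 1/v)/(u+v), and u + v runs over multiples of m. *)
Lemma offdiag_add X m : (0 < m)%N ->
  \sum_(1 <= u < X.+1) \sum_(1 <= v < X.+1)
     (m %| u + v)%:R / (u%:R * v%:R) <= 2 * (harm R X * harm R X.*2) / m%:R.
Proof.
move=> m0.
have key : \sum_(1 <= u < X.+1) \sum_(1 <= v < X.+1)
     (m %| u + v)%:R / (u%:R * (u + v)%:R) <= harm R X * harm R X.*2 / m%:R.
  rewrite {1}/harm -mulrA mulr_suml; apply: ler_sum1 => u /andP[u0 uX].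
  apply: (@le_trans _ _ (u%:R^-1 * \sum_(1 <= k < X.*2.+1) (m %| k)%:R / k%:R)); last first.
    by rewrite ler_wpM2l ?invr_ge0// sum_dvd_inv.
  have h : \sum_(1 <= v < X.+1) ((m %| u + v)%:R / (u + v)%:R) <=
     \sum_(1 <= k < X.*2.+1) (m %| k)%:R / k%:R :> R.
    apply: (@sum_inj_le R _ _ _ _ predT (fun v => u + v)%N
      (fun k => (m %| k)%:R / k%:R) (iota_uniq _ _) (iota_uniq _ _)).
    - by move=> v; rewrite !mem_index_iota => *; lia.
    - by move=> v w; rewrite !mem_index_iota => *; lia.
    - by move=> k _; rewrite mulr_ge0// invr_ge0.
  apply: le_trans (ler_wpM2l _ h); last by rewrite invr_ge0.
  rewrite mulr_sumr; apply: ler_sum1 => v /andP[v0 vX].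
  by rewrite invfM mulrCA.
have key2 : \sum_(1 <= u < X.+1) \sum_(1 <= v < X.+1)
     (m %| u + v)%:R / (v%:R * (u + v)%:R) <= harm R X * harm R X.*2 / m%:R.
  apply: le_trans key; rewrite exchange_big /=.
  by apply: ler_sum => u _; apply: ler_sum => v _; rewrite addnC.
rewrite -mulrA [leRHS]mulr_natl mulr2n; apply: le_trans (lerD key key2).
rewrite -big_split; apply: ler_sum1 => u /andP[u0 uX].
rewrite -big_split; apply: ler_sum1 => v /andP[v0 vX].
rewrite /= -mulrDr ler_wpM2l// natrD.
have u0' : (0 : R) < u%:R by rewrite ltr0n.
have v0' : (0 : R) < v%:R by rewrite ltr0n.
move: u0' v0'; move: (u%:R : R) (v%:R : R) => x y x0 y0.
rewrite le_eqVlt; apply/orP; left; apply/eqP; field; rewrite !gt_eqF// addr_gt0//.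
Qed.

Section Fiber.
Variables (N X : nat) (T : R).
Hypotheses (NX : (N * N <= X)%N)
  (hT : forall u, (0 < u <= X)%N -> (size (divisors u))%:R <= T).

Lemma count_factorizations u : (0 < u <= X)%N ->
  \sum_(1 <= a < N.+1) \sum_(1 <= d < N.+1) ((a * d)%N == u)%:R <= T.
Proof.
move=> uX; apply: le_trans (hT uX); move/andP: uX => [u0 uX].
rewrite -sum1_size natr_sum.
have := @sum_inj_le R _ _ (index_iota 1 N.+1) (divisors u)
  (fun a => a %| u)%N id (fun=> 1) (iota_uniq _ _) (divisors_uniq u).
move=> /(_ _ _ _) h; apply: (le_trans _ (h _ _ _)) => //.
- rewrite [leRHS]big_mkcond; apply: ler_sum1 => a /andP[a0 aN].
  case: ifPn => au.
    apply: sum_bool_le1; first exact: iota_uniq.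
    by move=> x y _ _ /eqP <- /eqP/esym/eqP; rewrite eqn_pmul2l// => /eqP.
  rewrite big1// => d _; case: eqP => // e; move: au; rewrite -e dvdn_mulr//.
- by move=> a _ au; rewrite -dvdn_divisors.
Qed.

(** A sum over pairs (a, d) depends on the product only, and each product has at most T
factorisations. *)
Lemma sum_prod_le F : (forall k, 0 <= F k) ->
  \sum_(1 <= a < N.+1) \sum_(1 <= d < N.+1) F (a * d)%N <=
    T * \sum_(1 <= u < X.+1) F u.
Proof.
move=> F0.
have -> : \sum_(1 <= a < N.+1) \sum_(1 <= d < N.+1) F (a * d)%N =
   \sum_(1 <= u < X.+1) F u * \sum_(1 <= a < N.+1) \sum_(1 <= d < N.+1) ((a * d)%N == u)%:R.
  under [RHS]eq_bigr do rewrite mulr_sumr.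
  rewrite [RHS]exchange_big; apply: eq_sum1 => a /andP[a0 aN].
  under [RHS]eq_bigr do rewrite mulr_sumr.
  rewrite [RHS]exchange_big; apply: eq_sum1 => d /andP[d0 dN].
  under [RHS]eq_bigr do rewrite mulrC.
  rewrite (@sum_bool_dirac _ _ _ (a * d)%N)//; first exact: iota_uniq.
  by rewrite mem_index_iota muln_gt0 a0 d0 ltnS/= (leq_trans _ NX)// leq_mul.
rewrite mulr_sumr; apply: ler_sum1 => u uX.
by rewrite mulrC ler_wpM2r// count_factorizations.
Qed.

Lemma sum4_prod_le (F : nat -> nat -> R) : (forall u v, 0 <= F u v) ->
  \sum_(1 <= a < N.+1) \sum_(1 <= b < N.+1) \sum_(1 <= c < N.+1) \sum_(1 <= d < N.+1)
    F (a * d)%N (b * c)%N <= T ^+ 2 * \sum_(1 <= u < X.+1) \sum_(1 <= v < X.+1) F u v.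
Proof.
move=> F0.
have -> : \sum_(1 <= a < N.+1) \sum_(1 <= b < N.+1) \sum_(1 <= c < N.+1) \sum_(1 <= d < N.+1)
    F (a * d)%N (b * c)%N = \sum_(1 <= b < N.+1) \sum_(1 <= c < N.+1)
     \sum_(1 <= a < N.+1) \sum_(1 <= d < N.+1) F (a * d)%N (b * c)%N.
  by rewrite exchange_big; apply: eq_bigr => b _; rewrite exchange_big.
apply: (@le_trans _ _ (\sum_(1 <= b < N.+1) \sum_(1 <= c < N.+1)
   T * \sum_(1 <= u < X.+1) F u (b * c)%N)).
  by apply: ler_sum => b _; apply: ler_sum => c _; apply: sum_prod_le.
under eq_bigr do rewrite -mulr_sumr; rewrite -mulr_sumr expr2 -mulrA.
have [->|N0] := posnP N.
  rewrite big_geq// mulr0.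
  have [->|X0] := posnP X; first by rewrite big_geq// !mulr0.
  have T0 : 0 <= T by apply: le_trans (hT (u := 1) _); rewrite ?ler0n// X0.
  by rewrite !mulr_ge0// sumr_ge0// => u _; rewrite sumr_ge0.
have T0 : 0 <= T by apply: le_trans (hT (u := 1) _); rewrite ?ler0n//=; nia.
rewrite ler_wpM2l//.
have := @sum_prod_le (fun v => \sum_(1 <= u < X.+1) F u v).
rewrite [in X in _ -> _ <= X]exchange_big; apply => k.
by rewrite sumr_ge0.
Qed.

(** On the hyperbola ad = bc, the pair (a, d) leaves at most T choices for (b, c). *)
Lemma sum4_diag_le (G : nat -> nat -> R) : (forall a d, 0 <= G a d) ->
  \sum_(1 <= a < N.+1) \sum_(1 <= b < N.+1) \sum_(1 <= c < N.+1) \sum_(1 <= d < N.+1)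
    ((a * d)%N == (b * c)%N)%:R * G a d <=
     T * \sum_(1 <= a < N.+1) \sum_(1 <= d < N.+1) G a d.
Proof.
move=> G0; rewrite mulr_sumr; apply: ler_sum1 => a /andP[a0 aN].
rewrite mulr_sumr.
have -> : \sum_(1 <= b < N.+1) \sum_(1 <= c < N.+1) \sum_(1 <= d < N.+1)
    ((a * d)%N == (b * c)%N)%:R * G a d =
  \sum_(1 <= d < N.+1) \sum_(1 <= b < N.+1) \sum_(1 <= c < N.+1)
    ((a * d)%N == (b * c)%N)%:R * G a d.
  rewrite [RHS]exchange_big; apply: eq_bigr => b _.
  by rewrite exchange_big.
apply: ler_sum1 => d /andP[d0 dN].
under eq_bigr do rewrite -mulr_suml; rewrite -mulr_suml ler_wpM2r//.
under eq_bigr do under eq_bigr do rewrite eq_sym.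
by apply: count_factorizations; nia.
Qed.
End Fiber.

(** Telescoping: 1/k^2 <= 1/(k-1) - 1/k. *)
Lemma tail_sq Y N : (0 < Y)%N -> (Y <= N)%N ->
  \sum_(Y.+1 <= k < N.+1) (k%:R ^+ 2)^-1 <= (Y%:R)^-1 - N%:R^-1 :> R.
Proof.
move=> Y0; elim: N => [|N IH]; first by rewrite leqn0 => /eqP Y0'; lia.
rewrite leq_eqVlt ltnS => /orP[/eqP->|YN].
  by rewrite big_geq// subrr.
rewrite big_nat_recr//=; apply: le_trans (lerD (IH YN) (lexx _)) _.
have N0 : (0 : R) < N%:R by rewrite ltr0n; lia.
rewrite -addrA lerD2l -lerBrDl -subr_ge0 -natr1.
move: (N%:R : R) N0 => x x0.
have -> : - (x + 1)^-1 - (- x^-1) - (x + 1) ^- 2 = (x * (x + 1) ^+ 2)^-1.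
  by field; rewrite !gt_eqF// addr_gt0.
by rewrite invr_ge0 mulr_ge0 ?sqr_ge0// ltW.
Qed.

Definition harm2 (X : nat) : R := \sum_(1 <= k < X.+1) (k%:R ^+ 2)^-1.

Lemma harm2_ge0 X : 0 <= harm2 X.
Proof. by apply: sumr_ge0 => k _; rewrite invr_ge0 sqr_ge0. Qed.

Lemma harm2_le2 X : harm2 X <= 2.
Proof.
case: X => [|X]; first by rewrite /harm2 big_geq.
rewrite /harm2 big_ltn//= expr1n invr1.
have := @tail_sq 1 X.+1 isT isT; rewrite invr1.
have : (0 : R) <= X.+1%:R^-1 by rewrite invr_ge0.
move: (_^-1) (\sum_(_ <= _ < _) _) => *; lra.
Qed.

End Sums.

(** * The finite Fourier expansion of the sawtooth *)

Section Cot.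
Variable R : realType.

Lemma sin_mulrn_eq0 (t : R) (j : nat) : sin t = 0 -> sin (t *+ j) = 0.
Proof.
move=> s0; elim: j => [|j IH]; first by rewrite mulr0n sin0.
by rewrite mulrS sinD s0 IH mul0r mulr0 addr0.
Qed.

Lemma cos_double_sin (t : R) : cos (t *+ 2) = 1 - 2 * sin t ^+ 2.
Proof. by rewrite cos_mulr2n cos2sin2; ring. Qed.

(** Multiplying by sin t makes the sum telescope; the hypothesis says that 2t is a multiple of
2 pi/n. *)
Lemma sum_cos_orthogonal (n : nat) (t : R) : sin (t *+ n) = 0 ->
  \sum_(0 <= j < n) cos (t *+ 2 *+ j) = n%:R * (sin t == 0)%:R.
Proof.
move=> sn0; have [s0|s0] := eqVneq (sin t) 0.
  rewrite mulr1 (eq_bigr (fun=> 1)); first by rewrite sumr_const_nat subn0.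
  by move=> j _; rewrite mulrnAC cos_double_sin sin_mulrn_eq0// expr0n mulr0 subr0.
rewrite mulr0; apply: (mulfI s0); rewrite mulr0.
have tele m : 2 * (sin t * \sum_(0 <= j < m) cos (t *+ 2 *+ j)) =
    sin (t *+ 2 *+ m - t) + sin t.
  elim: m => [|m IH]; first by rewrite big_geq// mulr0n sub0r sinN addNr !mulr0.
  have -> : t *+ 2 *+ m.+1 - t = t *+ 2 *+ m + t by rewrite (mulrSr _ m); ring.
  rewrite big_nat_recr//= mulrDr mulrDr IH.
  set a := _ *+ m; rewrite sinB sinD; ring.
have := tele n; rewrite mulrnAC sinB cos_double_sin sn0.
rewrite sin_mulr2n sn0 mulr0 mul0rn mul0r expr0n/= mulr0 subr0 mul1r sub0r addNr.
by move/eqP; rewrite mulf_eq0 pnatr_eq0 => /orP[//|/eqP].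
Qed.

Definition angle (n x : nat) : R := pi * x%:R / n%:R.
(** Division by zero makes cotn n x vanish when n divides x, which is the value that the odd
n-periodic extension needs. *)
Definition cotn (n x : nat) : R := cos (angle n x) / sin (angle n x).

Lemma angleD n x y : angle n (x + y) = angle n x + angle n y.
Proof. by rewrite /angle natrD mulrDr mulrDl. Qed.

Lemma angle_muln n q : (0 < n)%N -> angle n (q * n) = pi *+ q.
Proof. by move=> n0; rewrite /angle natrM mulrA mulfK ?pnatr_eq0 -?lt0n// mulr_natr. Qed.

Lemma sin_pin q : sin (pi *+ q : R) = 0.
Proof. by rewrite sin_mulrn_eq0// sinpi. Qed.

Lemma sin_angle_eq0 n x : (0 < n)%N -> (sin (angle n x) == 0) = (n %| x)%N.
Proof.
move=> n0; rewrite {1}(divn_eq x n) addnC angleD angle_muln//.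
rewrite (alternatingn (@sinDpi R)) mulf_eq0 signr_eq0/=.
rewrite /dvdn; have [->|r0] := posnP (x %% n).
  by rewrite /angle mulr0 mul0r sin0 !eqxx.
have := ltn_pmod x n0; move: (x %% n)%N r0 => r r0 rn.
apply/gt_eqF/sin_gt0_pi.
have n0' : (0 : R) < n%:R by rewrite ltr0n.
rewrite /angle ltr_pdivrMr// ltr_pM2l ?pi_gt0// ltr_nat rn andbT.
by rewrite !mulr_gt0 ?pi_gt0 ?ltr0n// invr_gt0.
Qed.

Lemma cotn_modD n x q : (0 < n)%N -> cotn n (x + q * n) = cotn n x.
Proof.
move=> n0; rewrite /cotn angleD angle_muln// (alternatingn (@sinDpi R)) (alternatingn (@cosDpi R)).
by rewrite invfM mulrACA divff ?signr_eq0// mul1r.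
Qed.

Lemma cotn_mod n x y : (0 < n)%N -> x = y %[mod n] -> cotn n x = cotn n y.
Proof.
move=> n0 xy; rewrite (divn_eq x n) (divn_eq y n) ![(_ * n + _)%N]addnC !cotn_modD//.
by rewrite xy.
Qed.

Lemma cotn_dvd n x : (n %| x)%N -> cotn n x = 0.
Proof.
have [->|n0] := posnP n; first by rewrite /cotn /angle invr0 mulr0 sin0 invr0 mulr0.
by rewrite -sin_angle_eq0// /cotn => /eqP->; rewrite invr0 mulr0.
Qed.

Lemma cotn_opp n x y : (0 < n)%N -> (n %| x + y)%N -> cotn n x = - cotn n y.
Proof.
move=> n0 /dvdnP[q e]; have := congr1 (angle n) e; rewrite angleD angle_muln//.
move=> /(canRL (addrK _)) xE; rewrite /cotn xE addrC.
rewrite (alternatingn (@sinDpi R)) (alternatingn (@cosDpi R)) cosN sinN.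
by rewrite invfM mulrACA divff ?signr_eq0// mul1r invrN mulrN.
Qed.

Lemma cotn_scale n e x : (0 < e)%N -> cotn (e * n) (e * x) = cotn n x.
Proof.
move=> e0; have e0' : (e%:R : R) != 0 by rewrite pnatr_eq0 -lt0n.
have -> : cotn (e * n) (e * x) = cos (angle (e * n) (e * x)) / sin (angle (e * n) (e * x)) by [].
have -> // : angle (e * n) (e * x) = angle n x.
by rewrite /angle !natrM mulrCA -mulf_div divff// mul1r.
Qed.

(** The function n ((a/n)) of the theory of Dedekind sums. *)
Definition sawtooth (n a : nat) : R := if (n %| a)%N then 0 else (a %% n)%:R - n%:R / 2.

Lemma sawtooth_mod n x y : x = y %[mod n] -> sawtooth n x = sawtooth n y.
Proof. by move=> xy; rewrite /sawtooth /dvdn xy. Qed.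

Lemma sawtooth_scale n e x : (0 < e)%N -> sawtooth (e * n) (e * x) = e%:R * sawtooth n x.
Proof.
move=> e0; rewrite /sawtooth dvdn_pmul2l//; case: ifP => _; first by rewrite mulr0.
by rewrite -muln_modr !natrM; ring.
Qed.

Lemma sum_cos_angle n m : (0 < n)%N ->
  \sum_(0 <= j < n) cos (angle n m *+ 2 *+ j) = n%:R * (n %| m)%:R.
Proof.
move=> n0; rewrite sum_cos_orthogonal ?sin_angle_eq0//.
by rewrite -(mulr_natr (angle n m)) mulfVK ?pnatr_eq0 -?lt0n// mulr_natr sin_pin.
Qed.

Lemma mul_cot_sin n j t : (0 < n)%N -> (0 < j < n)%N ->
  cotn n j * (sin (t + angle n j) - sin (t - angle n j)) = 2 * cos (angle n j) * cos t.
Proof.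
move=> n0 /andP[j0 jn]; have : sin (angle n j) != 0.
  by rewrite sin_angle_eq0// gtnNdvd.
by move=> s0; rewrite /cotn sinD sinB; field.
Qed.

Lemma angle_mulrn n j a : angle n j *+ a = angle n (a * j).
Proof. by rewrite /angle natrM -mulr_natl; ring. Qed.

(** The difference of consecutive values in a is, after multiplying cot by the sine of the half
angle, a sum of cosines. By orthogonality it is constant except at the jump, and so both sides
are linear in a on each period. *)
Lemma fourier_sawtooth n a : (0 < n)%N ->
  \sum_(0 <= j < n) cotn n j * sin (angle n (a * j) *+ 2) = - 2 * sawtooth n a.
Proof.
move=> n0.
wlog an : a / (a < n)%N => [hw|].
  rewrite -(sawtooth_mod (modn_mod a n)) -hw ?ltn_pmod//; apply: eq_bigr => j _; congr (_ * _).
  rewrite {1}(divn_eq a n) mulnDl angleD mulrnDl mulnAC angle_muln//.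
  rewrite -mulrnA mulnC mulrnA addrC; exact: (periodicn (@sinD2pi R)).
have tele b : (b < n)%N -> \sum_(0 <= j < n) cotn n j * sin (angle n (b * j) *+ 2) =
   n%:R * (0 < b)%:R - 2 * b%:R.
  elim: b => [_|b IH bn].
    rewrite mulr0 sub0r mulr0 oppr0 big1// => j _.
    by rewrite mul0n /angle mulr0 mul0r mul0rn sin0 mulr0.
  have bn' : (b < n)%N by lia.
  have -> : \sum_(0 <= j < n) cotn n j * sin (angle n (b.+1 * j) *+ 2) =
    \sum_(0 <= j < n) cotn n j * sin (angle n (b * j) *+ 2) +
    (\sum_(0 <= j < n) cos (angle n b.+1 *+ 2 *+ j) +
     \sum_(0 <= j < n) cos (angle n b *+ 2 *+ j) - 2).
    have c1 m : \sum_(0 <= j < n) cos (angle n m *+ 2 *+ j) =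
        1 + \sum_(1 <= j < n) cos (angle n m *+ 2 *+ j).
      by rewrite big_ltn// mulr0n cos0.
    have s1 m : \sum_(0 <= j < n) cotn n j * sin (angle n (m * j) *+ 2) =
        \sum_(1 <= j < n) cotn n j * sin (angle n (m * j) *+ 2).
      by rewrite big_ltn// cotn_dvd// mul0r add0r.
    rewrite !c1 !s1.
    suff e : \sum_(1 <= j < n) cotn n j * sin (angle n (b.+1 * j) *+ 2) -
       \sum_(1 <= j < n) cotn n j * sin (angle n (b * j) *+ 2) =
       \sum_(1 <= j < n) cos (angle n b.+1 *+ 2 *+ j) +
       \sum_(1 <= j < n) cos (angle n b *+ 2 *+ j).
      by move: e; do 4 move: (\sum_(_ <= _ < _) _); move=> *; lra.
    rewrite -sumrB -big_split/= big_seq [RHS]big_seq; apply: eq_bigr => j.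
    rewrite mem_index_iota => jn.
    have := mul_cot_sin (angle n (b * j) *+ 2 + angle n j) n0 jn.
    rewrite addrK => h; rewrite -mulrBr.
    have -> : angle n (b.+1 * j) *+ 2 = angle n (b * j) *+ 2 + angle n j + angle n j.
      by rewrite mulSn angleD; ring.
    rewrite h.
    have -> : angle n b.+1 *+ 2 *+ j = angle n (b * j) *+ 2 + angle n j + angle n j.
      by rewrite mulrnAC (angle_mulrn n b.+1) (mulnC j) mulSn angleD; ring.
    have -> : angle n b *+ 2 *+ j = angle n (b * j) *+ 2 + angle n j - angle n j.
      by rewrite mulrnAC (angle_mulrn n b) (mulnC j); ring.
    by move: (angle n (b * j) *+ 2 + angle n j) => t; rewrite cosB cosD; ring.
  rewrite IH// !sum_cos_angle// [(n %| b.+1)%N]gtnNdvd// mulr0 add0r mulr1.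
  have [->|b0] := posnP b; first by rewrite dvdn0 /=; ring.
  by rewrite [(n %| b)%N]gtnNdvd// -natr1 /=; ring.
rewrite tele// /sawtooth; have [->|a0] := posnP a; first by rewrite dvdn0 !mulr0 subr0.
rewrite gtnNdvd// modn_small//=. rewrite mulr1; lra.
Qed.

End Cot.

(** * Dedekind sums over units as cotangent sums *)

(** Congruence to -x, written with natural numbers only. *)
Lemma dvdn_add_opp n j x : (0 < n)%N -> (n %| j + x)%N = (j == n.-1 * x %[mod n]).
Proof.
move=> n0; rewrite -(eqn_modDr x) -mulSnr prednK//.
by rewrite modnMr /dvdn.
Qed.

Lemma coprime_all_primes d n : (0 < n)%N ->
  coprime d n = all (fun p => ~~ (p %| d)%N) (primes n).
Proof.
move=> n0; apply/idP/allP => [cdn p|h].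
  rewrite mem_primes => /and3P[pp _ pn]; apply/negP => pd.
  have : (p %| gcdn d n)%N by rewrite dvdn_gcd pd.
  by rewrite (eqP cdn) dvdn1 => /eqP p1; move: pp; rewrite p1.
rewrite /coprime eqn_leq gcdn_gt0 n0 orbT andbT leqNgt; apply/negP => g1.
have pp := pdiv_prime g1; have := pdiv_dvd (gcdn d n); rewrite dvdn_gcd => /andP[pd pn].
by have := h (pdiv (gcdn d n)); rewrite mem_primes pp n0 pn pd => /(_ isT).
Qed.

(** Distinct primes are coprime to each other. *)
Lemma prod_primes_dvd (ps : seq nat) g : uniq ps -> all prime ps ->
  all (fun p => p %| g)%N ps -> (\prod_(p <- ps) p %| g)%N.
Proof.
elim: ps => [|p ps IH]; first by rewrite big_nil dvd1n.
rewrite big_cons /= => /andP[pps ups] /andP[pp aps] /andP[pg apg].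
rewrite Gauss_dvd ?pg ?IH// prime_coprime// Euclid_dvd_prod// big_has.
apply/negP => /hasP[q qps pq]; move/allP: aps => /(_ _ qps) qp.
by move: pq; rewrite dvdn_prime2// => /eqP e; rewrite e qps in pps.
Qed.

Section Dedekind.
Variable R : realType.
Implicit Types (F : nat -> R).

Lemma sum_mod_dirac n x F : (0 < n)%N ->
  \sum_(0 <= j < n) (j == x %[mod n])%:R * F j = F (x %% n)%N.
Proof.
move=> n0; apply: sum_bool_dirac; first exact: iota_uniq.
  by rewrite mem_index_iota ltn_pmod.
by move=> j; rewrite mem_index_iota => /andP[_ jn]; rewrite modn_small.
Qed.

Lemma sum_multiples0 e k F : (0 < e)%N ->
  \sum_(0 <= d < e * k) (e %| d)%:R * F d = \sum_(0 <= d < k) F (e * d)%N.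
Proof.
move=> e0.
have [->|k0] := posnP k; first by rewrite muln0 !big_geq.
have -> : (e * k)%N = (e * k).-1.+1 by rewrite prednK// muln_gt0 e0.
rewrite big_ltn// sum_multiples// dvdn0 mul1r.
rewrite [in RHS]big_ltn// muln0; congr (_ + _).
suff -> : ((e * k).-1 %/ e).+1 = k by [].
apply/eqP; rewrite eqn_leq; apply/andP; split.
  by rewrite ltn_divLR// [(k * e)%N]mulnC ltn_predL muln_gt0 e0.
by rewrite -(prednK k0) ltnS leq_divRL//; nia.
Qed.

Lemma sin_angle_sub_eq0 n x y : (0 < n)%N ->
  (sin (angle R n x - angle R n y) == 0) = (x == y %[mod n]).
Proof.
move=> n0; have := alternatingn (@sinDpi R) y (angle R n x - angle R n y).
have -> : angle R n x - angle R n y + pi *+ y = angle R n (x + n.-1 * y).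
  rewrite angleD -addrA; congr (_ + _); apply: (addIr (angle R n y)).
  by rewrite -angleD -mulSnr prednK// addrAC addNr add0r mulnC angle_muln.
move=> h.
have -> : (sin (angle R n x - angle R n y) == 0) =
  ((-1) ^+ y * sin (angle R n x - angle R n y) == 0).
  by rewrite mulf_eq0 signr_eq0.
rewrite -h sin_angle_eq0// -(eqn_modDr (n.-1 * y)) -mulSn prednK//.
by rewrite modnMr /dvdn.
Qed.

Lemma angle_mulrn_n n j : (0 < n)%N -> angle R n j *+ n = pi *+ j.
Proof. by move=> n0; rewrite angle_mulrn mulnC angle_muln. Qed.

(** Product to sum: the congruences j = l and j = -l modulo n come from the difference and from
the sum of the angles. *)
Lemma sum_sin_sin n j l : (0 < n)%N ->
  \sum_(0 <= d < n) sin (angle R n (d * j) *+ 2) * sin (angle R n (d * l) *+ 2) =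
  n%:R / 2 * ((j == l %[mod n])%:R - (n %| j + l)%:R).
Proof.
move=> n0.
have h1 : \sum_(0 <= d < n) cos ((angle R n j - angle R n l) *+ 2 *+ d) =
     n%:R * (j == l %[mod n])%:R.
  rewrite sum_cos_orthogonal ?sin_angle_sub_eq0//.
  by rewrite mulrnBl !angle_mulrn_n// sinB !sin_pin mul0r mulr0 subr0.
have h2 : \sum_(0 <= d < n) cos ((angle R n j + angle R n l) *+ 2 *+ d) =
     n%:R * (n %| j + l)%:R.
  rewrite -angleD sum_cos_orthogonal ?sin_angle_eq0//.
  by rewrite angle_mulrn_n// sin_pin.
rewrite mulrAC mulrBr -h1 -h2 -sumrB mulr_suml.
apply: eq_bigr => d _.
have -> : (angle R n j - angle R n l) *+ 2 *+ d = angle R n (d * j) *+ 2 - angle R n (d * l) *+ 2.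
  by rewrite -![_ *+ 2 *+ d]mulr_natr /angle !natrM; ring.
have -> : (angle R n j + angle R n l) *+ 2 *+ d = angle R n (d * j) *+ 2 + angle R n (d * l) *+ 2.
  by rewrite -![_ *+ 2 *+ d]mulr_natr /angle !natrM; ring.
by move: (angle R n (d * j) *+ 2) (angle R n (d * l) *+ 2) => a b; rewrite cosB cosD; field.
Qed.

(** The classical formula for the Dedekind sum: expand both sawtooth functions and sum over d
first. Only j = hl and j = -hl survive, with equal contributions as cot is odd. *)
Lemma dedekind_cot n h : (0 < n)%N ->
  \sum_(0 <= d < n) sawtooth R n d * sawtooth R n (h * d) =
  n%:R / 4 * \sum_(0 <= j < n) cotn R n j * cotn R n (h * j).
Proof.
move=> n0.
have -> : \sum_(0 <= d < n) sawtooth R n d * sawtooth R n (h * d) = 4^-1 *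
   \sum_(0 <= d < n) (\sum_(0 <= j < n) cotn R n j * sin (angle R n (d * j) *+ 2)) *
     (\sum_(0 <= l < n) cotn R n l * sin (angle R n (d * (h * l)) *+ 2)).
  rewrite mulr_sumr; apply: eq_bigr => d _; rewrite fourier_sawtooth//.
  under eq_bigr do rewrite mulnA [(d * h)%N]mulnC.
  by rewrite fourier_sawtooth//; field.
have -> : \sum_(0 <= d < n) (\sum_(0 <= j < n) cotn R n j * sin (angle R n (d * j) *+ 2)) *
     (\sum_(0 <= l < n) cotn R n l * sin (angle R n (d * (h * l)) *+ 2)) =
   \sum_(0 <= l < n) cotn R n l * \sum_(0 <= j < n) cotn R n j *
     \sum_(0 <= d < n) sin (angle R n (d * j) *+ 2) * sin (angle R n (d * (h * l)) *+ 2).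
  under eq_bigr do rewrite mulr_sumr.
  rewrite exchange_big; apply: eq_bigr => l _.
  under [in RHS]eq_bigr do rewrite mulr_sumr.
  rewrite [in RHS]exchange_big mulr_sumr; apply: eq_bigr => d _ /=.
  rewrite mulr_suml mulr_sumr; apply: eq_bigr => j _; ring.
rewrite !mulr_sumr; apply: eq_bigr => l _.
under eq_bigr do rewrite sum_sin_sin// mulrCA mulrBr.
rewrite -mulr_sumr.
have -> : \sum_(0 <= j < n) (cotn R n j * (j == h * l %[mod n])%:R -
    cotn R n j * (n %| j + h * l)%:R) = 2 * cotn R n (h * l).
  rewrite sumrB; under eq_bigr do rewrite mulrC.
  rewrite sum_mod_dirac//; under eq_bigr do rewrite mulrC dvdn_add_opp//.
  rewrite sum_mod_dirac// !(cotn_mod _ n0 (modn_mod _ _)).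
  rewrite (@cotn_opp _ n (n.-1 * (h * l)) (h * l))//; first by ring.
  by rewrite -mulSnr prednK// dvdn_mulr.
by field.
Qed.

(** Restricting d to the multiples of e gives the Dedekind sum of modulus n/e. On the cotangent
side this becomes a restriction of j to the multiples of e, with weight e. *)
Lemma dedekind_multiples n e h : (0 < n)%N -> (e %| n)%N ->
  \sum_(0 <= d < n) (e %| d)%:R * (sawtooth R n d * sawtooth R n (h * d)) =
  n%:R / 4 * e%:R * \sum_(0 <= j < n) (e %| j)%:R * (cotn R n j * cotn R n (h * j)).
Proof.
move=> n0 en; have e0 := dvdn_gt0 n0 en.
move/dvdnP: en => [k nE]; rewrite mulnC in nE.
have k0 : (0 < k)%N by move: n0; rewrite nE muln_gt0 => /andP[].
rewrite nE !sum_multiples0//.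
under eq_bigr do rewrite mulnCA !sawtooth_scale// mulrACA.
rewrite -mulr_sumr dedekind_cot//.
under [in RHS]eq_bigr do rewrite mulnCA !cotn_scale//.
by rewrite natrM; ring.
Qed.

(** Inclusion-exclusion over the primes of ps, one prime at a time: removing the multiples of p
on the left subtracts p times the multiples of p on the right. The factor e carries the primes
already treated. *)
Lemma dedekind_sieve n h (ps : seq nat) e : (0 < n)%N -> (e * \prod_(p <- ps) p %| n)%N ->
  uniq ps -> all prime ps -> all (coprime e) ps ->
  \sum_(0 <= d < n) (e %| d)%:R * (\prod_(p <- ps) (1 - (p %| d)%:R) *
      (sawtooth R n d * sawtooth R n (h * d))) =
  n%:R / 4 * e%:R * \sum_(0 <= j < n) (e %| j)%:R *
     (\prod_(p <- ps) (1 - p%:R * (p %| j)%:R) * (cotn R n j * cotn R n (h * j))).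
Proof.
move=> n0; elim: ps e => [|p ps IH] e.
  rewrite big_nil muln1 => en _ _ _.
  under eq_bigr do rewrite big_nil mul1r; rewrite dedekind_multiples//.
  by under [in RHS]eq_bigr do rewrite big_nil mul1r.
rewrite big_cons => en /andP[pps ups] /andP[pp aps] /andP[cep ce].
have en1 : (e * \prod_(q <- ps) q %| n)%N.
  by apply: dvdn_trans en; rewrite dvdn_mul// dvdn_mull.
have en2 : (e * p * \prod_(q <- ps) q %| n)%N by rewrite -mulnA.
have ce2 : all (coprime (e * p)) ps.
  apply/allP => q qps; rewrite coprimeMl (allP ce _ qps) prime_coprime//.
  rewrite dvdn_prime2 ?(allP aps _ qps)//; apply/eqP => e'.
  by move: pps; rewrite e' qps.
have h1 := IH e en1 ups aps ce; have h2 := IH (e * p)%N en2 ups aps ce2.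
have dvM x : ((e * p %| x)%N)%:R = (e %| x)%:R * (p %| x)%:R :> R.
  by rewrite Gauss_dvd// -natrM mulnb.
have -> : \sum_(0 <= d < n) (e %| d)%:R * (\prod_(q <- p :: ps) (1 - (q %| d)%:R) *
      (sawtooth R n d * sawtooth R n (h * d))) =
   \sum_(0 <= d < n) (e %| d)%:R * (\prod_(p <- ps) (1 - (p %| d)%:R) *
      (sawtooth R n d * sawtooth R n (h * d))) -
   \sum_(0 <= d < n) (e * p %| d)%:R * (\prod_(p <- ps) (1 - (p %| d)%:R) *
      (sawtooth R n d * sawtooth R n (h * d))).
  rewrite -sumrB; apply: eq_bigr => d _; rewrite big_cons dvM; ring.
rewrite h1 h2 natrM.
set S1 := \sum_(0 <= j < n) _; set S2 := \sum_(0 <= j < n) _.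
have -> : \sum_(0 <= j < n) (e %| j)%:R * (\prod_(q <- p :: ps) (1 - q%:R * (q %| j)%:R) *
   (cotn R n j * cotn R n (h * j))) = S1 - p%:R * S2.
  rewrite mulr_sumr -sumrB; apply: eq_bigr => j _; rewrite big_cons dvM; ring.
ring.
Qed.

(** The cotangent side of the coprimality condition: the sum of mu(e) e over the common
divisors e of n and a. *)
Definition sieve_wt (n a : nat) : R := \prod_(p <- primes n) (1 - p%:R * (p %| a)%:R).

Definition unit_dedekind (n h : nat) : R :=
  \sum_(0 <= d < n) (coprime d n)%:R * (sawtooth R n d * sawtooth R n (h * d)).

Lemma coprime_prod n d : (0 < n)%N ->
  (coprime d n)%:R = \prod_(p <- primes n) (1 - (p %| d)%:R) :> R.
Proof.
move=> n0; rewrite coprime_all_primes//; elim: (primes n) => [|p ps IH].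
  by rewrite big_nil.
rewrite big_cons /= -IH; case: (p %| d)%N; rewrite /= ?subrr ?mul0r//.
by rewrite subr0 mul1r.
Qed.

Lemma all_prime_primes n : all prime (primes n).
Proof. by apply/allP => p; rewrite mem_primes => /and3P[]. Qed.

Lemma unit_dedekind_cot n h : (0 < n)%N ->
  unit_dedekind n h = n%:R / 4 * \sum_(0 <= j < n) sieve_wt n j * (cotn R n j * cotn R n (h * j)).
Proof.
move=> n0; have := @dedekind_sieve n h (primes n) 1 n0.
rewrite mul1n mulr1.
have hd : (\prod_(p <- primes n) p %| n)%N.
  apply: prod_primes_dvd; [exact: primes_uniq|exact: all_prime_primes|].
  by apply/allP => p; rewrite mem_primes => /and3P[].
have hc : all (coprime 1) (primes n) by apply/allP => p _; rewrite coprime1n.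
move=> /(_ hd (primes_uniq n) (all_prime_primes n) hc) e.
rewrite /unit_dedekind (eq_bigr (fun d => (1 %| d)%:R * (\prod_(p <- primes n) (1 - (p %| d)%:R) *
      (sawtooth R n d * sawtooth R n (h * d))))); last first.
  by move=> d _; rewrite dvd1n mul1r coprime_prod.
by rewrite e; congr (_ * _); apply: eq_bigr => j _; rewrite dvd1n mul1r.
Qed.

Lemma normr_sieve_wt_le n a : (0 < n)%N -> `|sieve_wt n a| <= (gcdn a n)%:R.
Proof.
move=> n0; rewrite /sieve_wt normr_prod.
apply: (@le_trans _ _ (\prod_(p <- primes n | (p %| a)%N) p%:R)).
  rewrite [leRHS]big_mkcond big_seq [leRHS]big_seq.
  apply: ler_prod => p; rewrite mem_primes => /and3P[pp _ _]; rewrite normr_ge0/=.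
  case: (p %| a)%N; last by rewrite mulr0 subr0 normr1.
  rewrite mulr1 ler_norml; have : (1 : R) <= p%:R by rewrite ler1n prime_gt0.
  by move=> p1; apply/andP; split; lra.
rewrite -natr_prod ler_nat; apply: dvdn_leq; first by rewrite gcdn_gt0 n0 orbT.
rewrite -big_filter; apply: prod_primes_dvd.
- by rewrite filter_uniq// primes_uniq.
- by apply/allP => p; rewrite mem_filter mem_primes => /andP[_ /and3P[]].
- apply/allP => p; rewrite mem_filter mem_primes => /andP[pa /and3P[_ _ pn]].
  by rewrite dvdn_gcd pa.
Qed.

Lemma sieve_wt_gcd n a b : gcdn a n = gcdn b n -> sieve_wt n a = sieve_wt n b.
Proof.
move=> ab; rewrite /sieve_wt big_seq [RHS]big_seq; apply: eq_bigr => p.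
rewrite mem_primes => /and3P[_ _ pn].
have -> // : (p %| a)%N = (p %| b)%N.
by have := congr1 (dvdn p) ab; rewrite !dvdn_gcd pn !andbT.
Qed.

(** The residues j and n - j are paired; oddness of n leaves no middle term. *)
Lemma sum_even_fold n F : odd n -> F 0%N = 0 ->
  (forall j, (0 < j < n)%N -> F (n - j)%N = F j) ->
  \sum_(0 <= j < n) F j = 2 * \sum_(1 <= j < n./2.+1) F j.
Proof.
move=> no F0 Fs; have nE : n = (n./2 + n./2).+1.
  by rewrite addnn -{1}(odd_double_half n) no.
rewrite big_ltn; last by rewrite nE.
rewrite F0 add0r (@big_cat_nat _ _ _ n./2.+1)//=; last by rewrite {2}nE ltnS leq_addr.
rewrite mulr_natl mulr2n; congr (_ + _).
rewrite -[X in \sum_(X <= _ < _) _]add1n big_addn.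
have -> : (n - n./2 = n./2.+1)%N by lia.
rewrite big_nat_rev/= big_seq [RHS]big_seq; apply: eq_bigr => j.
rewrite mem_index_iota => jn; rewrite -Fs; last by lia.
by congr F; lia.
Qed.

(** Every residue prime to 0 modulo an odd n is b or -b for exactly one b <= n/2. This is the
step that trades residues for integers of size at most n/2. *)
Lemma cotn_fold n x : odd n ->
  cotn R n x = \sum_(1 <= b < n./2.+1)
    ((x == b %[mod n])%:R - (n %| x + b)%:R) * cotn R n b.
Proof.
move=> no; have n0 : (0 < n)%N by case: n no.
under eq_bigr do rewrite mulrBl; rewrite sumrB.
have e1 (b : nat) : (n %| x + b)%N = (n %| x %% n + b)%N by rewrite /dvdn modnDml.
rewrite -(cotn_mod _ n0 (modn_mod _ _)).
under eq_bigr do rewrite -(modn_mod x).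
under [X in _ = _ - X]eq_bigr do rewrite e1.
have := ltn_pmod x n0; move: (x %% n)%N => r rn {e1}.
have small (b : nat) : (0 < b <= n./2)%N -> (b < n)%N by move=> /andP[_]; lia.
have [->|r0] := posnP r.
  rewrite cotn_dvd// !big1_seq ?subr0// => b; rewrite mem_index_iota ltnS /= => bn.
    by rewrite add0n gtnNdvd ?mul0r ?small//; lia.
  rewrite mod0n modn_small ?small//; have -> : (0 == b)%N = false by lia.
  by rewrite mul0r.
have [rN|rN] := leqP r n./2.
  rewrite (@sum_bool_dirac R _ _ _ r)//; first last.
  - move=> b; rewrite mem_index_iota ltnS => bn; by rewrite (modn_small rn) modn_small ?small//
    eq_sym.
  - by rewrite mem_index_iota r0 ltnS.
  - exact: iota_uniq.
  rewrite big1_seq ?subr0// => b; rewrite mem_index_iota ltnS /= => bn.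
  by rewrite gtnNdvd ?mul0r//; lia.
rewrite big1_seq ?sub0r; last first.
  move=> b; rewrite mem_index_iota ltnS /= => bn.
  rewrite (modn_small rn) modn_small ?small//; have -> : (r == b)%N = false by lia.
  by rewrite mul0r.
rewrite (@sum_bool_dirac R _ _ _ (n - r)%N); first last.
- move=> b; rewrite mem_index_iota ltnS => bn; apply/idP/eqP => [|->]; last first.
    by rewrite subnKC// ltnW.
  by move=> /dvdnP[q]; case: q => [|[|q]]; nia.
- by rewrite mem_index_iota; lia.
- exact: iota_uniq.
by apply: cotn_opp => //; rewrite subnKC// ltnW.
Qed.

Definition corr_pos (n h : nat) : R := \sum_(1 <= a < n./2.+1) \sum_(1 <= b < n./2.+1)
  (h * a == b %[mod n])%:R * (sieve_wt n a * (cotn R n a * cotn R n b)).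

Definition corr_neg (n h : nat) : R := \sum_(1 <= a < n./2.+1) \sum_(1 <= b < n./2.+1)
  (n %| h * a + b)%:R * (sieve_wt n a * (cotn R n a * cotn R n b)).

Lemma unit_dedekind_fold n h : odd n ->
  unit_dedekind n h = n%:R / 2 * (corr_pos n h - corr_neg n h).
Proof.
move=> no; have n0 : (0 < n)%N by case: n no.
rewrite unit_dedekind_cot// sum_even_fold//; first last.
- move=> j /andP[j0 jn].
  have -> : sieve_wt n (n - j) = sieve_wt n j.
    apply: sieve_wt_gcd; have := gcdnDl (n - j) j; have := gcdnDl j (n - j).
    rewrite (subnK (ltnW jn)) (subnKC (ltnW jn)). by move=> -> ->; exact: gcdnC.
  have -> : cotn R n (n - j) = - cotn R n j.
    by apply: cotn_opp; rewrite // (subnK (ltnW jn)).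
  have -> : cotn R n (h * (n - j)) = - cotn R n (h * j).
    by apply: cotn_opp; rewrite // -mulnDr (subnK (ltnW jn)) dvdn_mull.
  by rewrite mulrNN.
- by rewrite (@cotn_dvd _ n 0)// mul0r mulr0.
rewrite mulrA; have -> : n%:R / 4 * 2 = n%:R / 2 :> R by field.
rewrite /corr_pos /corr_neg -sumrB; congr (_ * _); apply: eq_bigr => a _.
rewrite -sumrB (cotn_fold (h * a) no) mulrA mulr_sumr; apply: eq_bigr => b _; ring.
Qed.

(** Replacing h by -h exchanges the two congruences. *)
Lemma corr_neg_opp n h : odd n -> corr_neg n (n.-1 * h) = corr_pos n h.
Proof.
move=> no; have n0 : (0 < n)%N by case: n no.
apply: eq_bigr => a _; apply: eq_bigr => b _; congr (_%:R * _).
rewrite -mulnA -[in RHS](eqn_modDr (n.-1 * (h * a))) -mulSn prednK//.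
by rewrite modnMr addnC /dvdn eq_sym.
Qed.

End Dedekind.

(** * Size of the cotangents and the value of zeta(2) *)

Section CotBounds.
Variable R : realType.
Implicit Types x : R.

Lemma sin_MVT x : 0 <= x -> exists2 c, 0 <= c <= x & sin x = cos c * x.
Proof.
move=> x0; have hd y : y \in `]0, x[ -> is_derive y 1 (@sin R) ((@cos R) y) by move=> _; apply:
  is_derive_sin.
have [] := MVT_segment x0 hd; first by apply: continuous_subspaceT; exact: continuous_sin.
by move=> c; rewrite in_itv/= sin0 !subr0 => cx e; exists c.
Qed.

Lemma cos_MVT x : 0 <= x -> exists2 c, 0 <= c <= x & cos x - 1 = - sin c * x.
Proof.
move=> x0; have hd y : y \in `]0, x[ -> is_derive y 1 (@cos R) ((fun z => - sin z) y) by move=>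
  _; apply: is_derive_cos.
have [] := MVT_segment x0 hd; first by apply: continuous_subspaceT; exact: continuous_cos.
by move=> c; rewrite in_itv/= cos0 !subr0 => cx e; exists c.
Qed.

Lemma sin_le_id x : 0 <= x -> sin x <= x.
Proof. by move=> x0; have [c _ ->] := sin_MVT x0; rewrite ler_piMl// cos_le1. Qed.

Lemma id_cos_le_sin x : 0 <= x <= pi -> x * cos x <= sin x.
Proof.
move=> /andP[x0 xp]; have [c /andP[c0 cx] ->] := sin_MVT x0.
rewrite mulrC ler_wpM2r// leNgt ltr_cos ?in_itv/= ?c0 ?x0 ?xp ?(le_trans cx)//.
by rewrite -leNgt.
Qed.

Lemma oneB_le_cos x : 0 <= x -> 1 - x <= cos x.
Proof.
move=> x0; have [c _ e] := cos_MVT x0.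
have : sin c * x <= x by rewrite ler_piMl// sin_le1.
by move: e; rewrite mulNr; move: (sin c * x) (cos x) => *; lra.
Qed.

Lemma pi_lt4 : (pi : R) < 4.
Proof. have := @pihalf_lt2 R; lra. Qed.

Definition kappa (n : nat) : R := n%:R / pi.

Lemma angle_itv n a : odd n -> (0 < a <= n./2)%N -> 0 < angle R n a < pi / 2.
Proof.
move=> no /andP[a0 aN]; have n0 : (0 : R) < n%:R by rewrite ltr0n; case: n no aN.
have pi0 := @pi_gt0 R.
have a0' : (0 : R) < a%:R by rewrite ltr0n.
rewrite /angle; apply/andP; split; first by rewrite divr_gt0// mulr_gt0.
rewrite -mulrA ltr_pM2l// ltr_pdivrMr//.
have : (a%:R *+ 2 : R) < n%:R by rewrite -mulrnA ltr_nat; lia.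
by rewrite mulr2n; lra.
Qed.

Lemma inv_angle n a : (angle R n a)^-1 = kappa n / a%:R.
Proof. by rewrite /angle /kappa !invfM invrK mulrC mulrA. Qed.

(** With t = pi a/n, these are t cot t <= 1 and t cot t >= cos t >= 1 - t. *)
Lemma cotn_bounds n a : odd n -> (0 < a <= n./2)%N ->
  [/\ 0 <= cotn R n a, kappa n / a%:R - 1 <= cotn R n a & cotn R n a <= kappa n / a%:R].
Proof.
move=> no aN; have /andP[t0 tp] := angle_itv no aN; rewrite -inv_angle /cotn.
set t := angle R n a in t0 tp *.
have pi0 := @pi_gt0 R.
have s0 : 0 < sin t by rewrite sin_gt0_pihalf// t0.
have c0 : 0 < cos t by rewrite cos_gt0_pihalf// tp andbT; lra.
split; first by rewrite divr_ge0// ltW.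
- rewrite lerBlDr -(ler_pM2l t0) mulfV ?gt_eqF// mulrDr mulr1.
  have h1 := oneB_le_cos (ltW t0).
  have h2 : cos t <= t * (cos t / sin t).
    rewrite mulrCA ler_peMr// ?(ltW c0)//.
    by rewrite ler_pdivlMr// mul1r sin_le_id// ltW.
  by move: h2; move: (t * _) => u h2; lra.
- rewrite ler_pdivrMr// mulrC ler_pdivlMr// mulrC id_cos_le_sin//.
  by rewrite ltW//=; lra.
Qed.

(** In terms of t = pi a/n this is sin t <= t, since 1 + cot^2 = 1/sin^2. *)
Lemma cotn_sq_lower n a : odd n -> (0 < a <= n./2)%N ->
  kappa n ^+ 2 / a%:R ^+ 2 <= 1 + cotn R n a ^+ 2.
Proof.
move=> no aN; have /andP[t0 tp] := angle_itv no aN.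
rewrite -expr_div_n -inv_angle /cotn; set t := angle R n a in t0 tp *.
have s0 : 0 < sin t by rewrite sin_gt0_pihalf// t0.
have -> : 1 + (cos t / sin t) ^+ 2 = (sin t)^-1 ^+ 2.
  have h := cos2Dsin2 t; rewrite expr_div_n exprVn.
  by apply/(mulIf (x := sin t ^+ 2)); rewrite ?mulrDl ?mulfVK ?mulVf ?expf_neq0 ?gt_eqF// addrC
    mul1r.
rewrite ler_pXn2r ?nnegrE ?invr_ge0 ?(ltW t0) ?(ltW s0)//.
by rewrite lef_pV2 ?posrE// sin_le_id// ltW.
Qed.

Lemma sum_sq_shift (y : R) m : \sum_(1 <= d < m.+1) (d%:R - y) ^+ 2 =
   m%:R * (m%:R + 1) * (2 * m%:R + 1) / 6 - y * m%:R * (m%:R + 1) + m%:R * y ^+ 2.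
Proof.
elim: m => [|m IH]; first by rewrite big_geq//; field.
by rewrite big_nat_recr//= IH -natr1; field.
Qed.

(** Parseval: the Dedekind sum with h = 1 is the sum of the squares of the sawtooth values, a
polynomial in n. *)
Lemma sum_cotn_sq n : odd n -> (1 < n)%N ->
  \sum_(1 <= j < n./2.+1) cotn R n j ^+ 2 = (n%:R - 1) * (n%:R - 2) / 6.
Proof.
move=> no n1; have n0 : (0 < n)%N by lia.
have := @dedekind_cot R n 1 n0.
under eq_bigr do rewrite mul1n.
under [X in _ = _ * X]eq_bigr do rewrite mul1n.
rewrite (sum_even_fold (F := fun j => cotn R n j * cotn R n j) no); first last.
- move=> j /andP[j0 jn].
  have -> : cotn R n (n - j) = - cotn R n j.
    by apply: cotn_opp; rewrite // (subnK (ltnW jn)).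
  by rewrite mulrNN.
- by rewrite cotn_dvd// mul0r.
rewrite big_ltn// {1}/sawtooth dvdn0 mul0r add0r.
have -> : \sum_(1 <= d < n) sawtooth R n d * sawtooth R n d =
  \sum_(1 <= d < n.-1.+1) (d%:R - n%:R / 2) ^+ 2.
  rewrite (prednK n0) big_seq [RHS]big_seq; apply: eq_bigr => d.
  rewrite mem_index_iota => /andP[d0 dn].
  by rewrite /sawtooth gtnNdvd// modn_small// expr2.
rewrite sum_sq_shift.
have n0' : (n%:R : R) != 0 by rewrite pnatr_eq0 -lt0n.
have -> : n.-1%:R = n%:R - 1 :> R by rewrite -subn1 natrB.
move=> /(congr1 (fun x => 2 / n%:R * x)) e.
under eq_bigr do rewrite expr2.
rewrite (_ : \sum_(_ <= _ < _) _ = 2 / n%:R * (n%:R / 4 * (2 * \sum_(1 <= j < n./2.+1) cotn R n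
  j * cotn R n j))); last by field.
by rewrite -e; field.
Qed.

Definition zeta2 : R := pi ^+ 2 / 6.

(** Cauchy's proof that zeta(2) = pi^2/6, with an error term: the sum of cot^2 over the first Y
angles of modulus 2Y+1 is known exactly, and (n/(pi k))^2 lies between cot^2 and 1 + cot^2. *)
Lemma harm2_zeta2 Y : harm2 R Y <= zeta2 /\ zeta2 - harm2 R Y <= 8 / (Y.+1)%:R.
Proof.
have pi0 := @pi_gt0 R; have pi4 := pi_lt4.
have [->|Y0] := posnP Y.
  rewrite /harm2 big_geq// /zeta2; split; first by rewrite divr_ge0// sqr_ge0.
  by rewrite divr1; nra.
pose n := Y.*2.+1.
have no : odd n by rewrite /n /= odd_double.
have n2 : n./2 = Y by rewrite /n -[_./2]/(uphalf Y.*2) uphalf_double.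
have n1 : (1 < n)%N by rewrite /n; lia.
have S := sum_cotn_sq no n1; rewrite n2 in S.
have up : \sum_(1 <= j < Y.+1) cotn R n j ^+ 2 <= kappa n ^+ 2 * harm2 R Y.
  rewrite /harm2 mulr_sumr; apply: ler_sum1 => a aY.
  have [c0 _ c1] := cotn_bounds no (ltac:(rewrite n2; exact: aY) : (0 < a <= n./2)%N).
  by rewrite -expr_div_n ler_pXn2r ?nnegrE// (le_trans c0).
have lo : kappa n ^+ 2 * harm2 R Y <= Y%:R + \sum_(1 <= j < Y.+1) cotn R n j ^+ 2.
  have -> : Y%:R = \sum_(1 <= j < Y.+1) 1 :> R by rewrite sumr_const_nat subSS subn0.
  rewrite /harm2 mulr_sumr -big_split; apply: ler_sum1 => a aY.
  exact: (cotn_sq_lower no (ltac:(rewrite n2; exact: aY) : (0 < a <= n./2)%N)).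
rewrite S in up lo.
have nE : n%:R = 2 * Y%:R + 1 :> R by rewrite /n -natr1 -muln2 natrM mulrC.
rewrite /kappa expr_div_n nE in up lo.
have y0 : (1 : R) <= Y%:R by rewrite ler1n.
rewrite -(natr1 Y) /zeta2; move: (Y%:R : R) y0 up lo => y y0 up lo.
have p2 : 0 < (pi : R) ^+ 2 by rewrite exprn_gt0.
have n20 : 0 < (2 * y + 1) ^+ 2 by rewrite exprn_gt0//; lra.
move: (harm2 R Y) up lo => h up lo.
have e : (2 * y + 1) ^+ 2 / pi ^+ 2 * h * pi ^+ 2 = (2 * y + 1) ^+ 2 * h.
  by rewrite mulrAC mulfVK// lt0r_neq0.
have up' := ler_wpM2r (ltW p2) up; have lo' := ler_wpM2r (ltW p2) lo.
rewrite e in up' lo'.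
have P16 : (pi : R) ^+ 2 <= 16 by nra.
move: (pi ^+ 2) p2 up' lo' P16 => P p2 up' lo' P16.
have hP : h <= P / 6.
  rewrite -(ler_pM2l n20); by move: p2 lo'; clear => p2 lo'; lra.
split; first exact: hP.
rewrite ler_pdivlMr; last by lra.
have : (2 * y + 1) ^+ 2 * (P / 6 - h) <= P * (y * 2 + 1) / 2.
  by move: p2 up'; clear => p2 up'; lra.
have -> : (2 * y + 1) ^+ 2 * (P / 6 - h) = (2 * y + 1) * ((2 * y + 1) * (P / 6 - h)) by ring.
have -> : P * (y * 2 + 1) / 2 = (2 * y + 1) * (P / 2) by field.
rewrite ler_pM2l; last by lra.
move: hP P16 y0; clear => hP P16 y0 h1.
have : 0 <= y * (P / 6 - h) by rewrite mulr_ge0//; lra.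
lra.
Qed.
End CotBounds.

(** * Counting the off-diagonal and diagonal quadruples *)

Definition signed_cong (s : bool) (m u v : nat) : bool :=
  if s then (m %| u + v)%N else u == v %[mod m].

Definition offdiag (s : bool) (u v : nat) : bool := s || (u != v).

Lemma signed_cong_scale s k m u v : (0 < k)%N -> signed_cong s (k * m) (k * u) (k * v) =
  signed_cong s m u v.
Proof.
move=> k0; case: s => /=; first by rewrite -mulnDr dvdn_pmul2l.
by rewrite -!muln_modr eqn_pmul2l.
Qed.

(** A unit h does not change the common divisors with n. *)
Lemma signed_cong_gcd s n h a b : coprime h n -> signed_cong s n (h * a) b -> gcdn a n = gcdn b n.
Proof.
move=> hn ab.
have key d : (d %| n)%N -> (d %| a)%N = (d %| b)%N.
  move=> dn; have dh : coprime d h by rewrite (coprime_dvdl dn)// coprime_sym.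
  rewrite -[LHS](Gauss_dvdr a dh); case: s ab => /= ab.
    have dab := dvdn_trans dn ab; apply/idP/idP => dd.
      by rewrite -(dvdn_addr _ dd).
    by rewrite -(dvdn_addl _ dd).
  by rewrite /dvdn -(modn_dvdm (h * a) dn) (eqP ab) modn_dvdm.
apply/eqP; rewrite eqn_dvd !dvdn_gcd !dvdn_gcdr !andbT.
by rewrite -key ?dvdn_gcdr// dvdn_gcdl key ?dvdn_gcdr// dvdn_gcdl.
Qed.

Lemma signed_cong_diff s n h h' c d : (h' <= h)%N -> signed_cong s n (h * c) d ->
  signed_cong s n (h' * c) d -> (n %| (h - h') * c)%N.
Proof.
move=> hh; case: s => /= e1 e2.
  have -> : ((h - h') * c = (h * c + d) - (h' * c + d))%N by rewrite subnDr mulnBl.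
  exact: dvdn_sub.
rewrite mulnBl -eqn_mod_dvd ?leq_mul2r ?hh ?orbT//.
by rewrite (eqP e1) (eqP e2).
Qed.

(** Writing b = ha - xn and d = +-(hc - yn), the combination ad -+ bc equals +-n(xc - ay). This
is divisible by n gcd(a, c), not only by n, and the extra factor gcd(a, c) compensates the
number of possible h. *)
Lemma signed_cong_cross s n h a b c d : signed_cong false n (h * a) b ->
  signed_cong s n (h * c) d ->
  signed_cong s (n * gcdn a c) (a * d) (b * c).
Proof.
move=> /= ab; set G := gcdn a c.
have /dvdnP[a' aE] : (G %| a)%N := dvdn_gcdl a c.
have /dvdnP[c' cE] : (G %| c)%N := dvdn_gcdr a c.
have aZ : a%:Z = a'%:Z * G%:Z by rewrite -PoszM -aE.
have cZ : c%:Z = c'%:Z * G%:Z by rewrite -PoszM -cE.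
have /dvdzP[x e1] : (n%:Z %| (h * a)%:Z - b%:Z)%Z.
  by rewrite -eqz_mod_dvd !modz_nat eqz_nat.
case: s => /= cd.
  move/dvdnP: cd => [y e2].
  have e2' : d%:Z = y%:Z * n%:Z - h%:Z * c%:Z.
    by move/(congr1 Posz): e2; rewrite PoszD !PoszM => <-; rewrite addrAC subrr add0r.
  have e1' : b%:Z = h%:Z * a%:Z - x * n%:Z by rewrite -e1 PoszM opprB addrC subrK.
  have : ((n * G)%:Z %| (a * d + b * c)%:Z)%Z; last by [].
  apply/dvdzP; exists (a'%:Z * y%:Z - x * c'%:Z).
  by rewrite PoszD !PoszM e2' e1' aZ cZ; ring.
have /dvdzP[y e2] : (n%:Z %| (h * c)%:Z - d%:Z)%Z.
  by rewrite -eqz_mod_dvd !modz_nat eqz_nat.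
rewrite -eqz_nat -!modz_nat eqz_mod_dvd.
have e2' : d%:Z = h%:Z * c%:Z - y * n%:Z by rewrite -e2 PoszM opprB addrC subrK.
have e1' : b%:Z = h%:Z * a%:Z - x * n%:Z by rewrite -e1 PoszM opprB addrC subrK.
apply/dvdzP; exists (x * c'%:Z - a'%:Z * y).
by rewrite !PoszM e2' e1' aZ cZ; ring.
Qed.

Lemma signed_cong_dvd s m m' u v : (m' %| m)%N -> signed_cong s m u v -> signed_cong s m' u v.
Proof.
move=> mm; case: s => /=; first exact: dvdn_trans.
by move=> /eqP e; rewrite -(modn_dvdm u mm) e modn_dvdm.
Qed.

Section OffDiag.
Variable R : realType.

(** If the h satisfying P all agree modulo q, they have distinct quotients by q. *)
Lemma count_residue_class_le n q (P : pred nat) : (0 < q)%N -> (q %| n)%N ->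
  (forall h h', (h' <= h)%N -> P h -> P h' -> (q %| h - h')%N) ->
  \sum_(0 <= h < n) (P h)%:R <= (n %/ q)%:R :> R.
Proof.
move=> q0 qn key.
have := @sum_inj_le R _ _ (index_iota 0 n) (iota 0 (n %/ q)) P (divn^~ q) (fun=> 1)
  (iota_uniq _ _) (iota_uniq _ _).
have -> : \sum_(k <- iota 0 (n %/ q)) 1 = (n %/ q)%:R :> R.
  by rewrite big_const_seq count_predT size_iota -Monoid.iteropE.
move=> h; apply: (le_trans _ (h _ _ _)) => //.
- by rewrite [leRHS]big_mkcond; apply: ler_sum => i _; case: ifP.
- move=> x; rewrite mem_index_iota mem_iota => /andP[_ xn] _.
  by rewrite add0n /= ltn_divLR// divnK.
- move=> x y _ _ Px Py e; have [yx|xy] := leqP y x.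
    have := key _ _ yx Px Py; rewrite -eqn_mod_dvd// => /eqP m.
    by rewrite (divn_eq x q) (divn_eq y q) m e.
  have := key _ _ (ltnW xy) Py Px; rewrite -eqn_mod_dvd ?(ltnW xy)// => /eqP m.
  by rewrite (divn_eq x q) (divn_eq y q) m e.
Qed.

(** Two solutions h, h' satisfy (h - h')a = (h - h')c = 0 modulo n, hence they agree modulo
n/G, where G is the greatest common divisor of a, c and n. So there are at most G of them. *)
Lemma count_signed_cong s n a b c d : (0 < n)%N ->
  \sum_(0 <= h < n) (signed_cong false n (h * a) b && signed_cong s n (h * c) d)%:R <=
    (gcdn (gcdn a n) (gcdn c n))%:R :> R.
Proof.
move=> n0; set G := gcdn _ _.
have Gn : (G %| n)%N by rewrite (dvdn_trans (dvdn_gcdl _ _))// dvdn_gcdr.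
have G0 : (0 < G)%N := dvdn_gt0 n0 Gn.
have q0 : (0 < n %/ G)%N by rewrite divn_gt0// dvdn_leq.
have nGG : (n %/ (n %/ G) = G)%N by rewrite -{1}(divnK Gn) mulKn.
have dG : (n %/ G %| n)%N by rewrite -{2}(divnK Gn) dvdn_mulr.
rewrite -nGG; apply: count_residue_class_le q0 dG _ => h h' hh /andP[a1 c1] /andP[a2 c2].
have da := signed_cong_diff hh a1 a2; have dc := signed_cong_diff hh c1 c2.
have : (n %| (h - h') * G)%N by rewrite /G !muln_gcdr !dvdn_gcd da dc dvdn_mull.
by rewrite -{1}(divnK Gn) dvdn_pmul2r.
Qed.

(** Splitting according to g = gcd(a, n) = gcd(b, n), then dropping the condition that the
quotients are prime to n/g. *)
Lemma sum_gcd_split n N (K : nat -> nat -> nat -> R) : (0 < n)%N ->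
  (forall g a b, 0 <= K g a b) ->
  \sum_(1 <= a < N.+1) \sum_(1 <= b < N.+1) (gcdn a n == gcdn b n)%:R * K (gcdn a n) a b <=
  \sum_(g <- divisors n) \sum_(1 <= a < N.+1) \sum_(1 <= b < N.+1) K g (g * a)%N (g * b)%N.
Proof.
move=> n0 K0.
apply: (@le_trans _ _ (\sum_(g <- divisors n) \sum_(1 <= a < N.+1) (g %| a)%:R *
    \sum_(1 <= b < N.+1) (g %| b)%:R * K g a b)).
  rewrite [leRHS]exchange_big; apply: ler_sum1 => a /andP[a0 aN] /=.
  have gn : gcdn a n \in divisors n by rewrite -dvdn_divisors ?dvdn_gcdr.
  rewrite (bigD1_seq _ gn (divisors_uniq n))/= dvdn_gcdl mul1r -[leLHS]addr0 lerD//.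
    apply: ler_sum1 => b _; case: eqP => [->|_]; first by rewrite dvdn_gcdl.
    by rewrite mul0r mulr_ge0.
  apply: sumr_ge0 => g _; rewrite mulr_ge0// sumr_ge0// => b _.
  by rewrite mulr_ge0.
rewrite big_seq [leRHS]big_seq; apply: ler_sum => g; rewrite -dvdn_divisors// => gn.
have g0 := dvdn_gt0 n0 gn.
rewrite sum_multiples//; apply: (@le_trans _ _ (\sum_(1 <= a < N.+1)
  \sum_(1 <= b < N.+1) (g %| b)%:R * K g (g * a)%N b)).
  apply: sum_le_size1; first exact: leq_div.
  by move=> k _; apply: sumr_ge0 => b _; rewrite mulr_ge0.
apply: ler_sum => a _; rewrite sum_multiples//.
by apply: sum_le_size1; first exact: leq_div.
Qed.

Definition sum4 N (F : nat -> nat -> nat -> nat -> R) : R :=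
  \sum_(1 <= a < N.+1) \sum_(1 <= b < N.+1) \sum_(1 <= c < N.+1) \sum_(1 <= d < N.+1)
    F a b c d.

Lemma sum4_le N F G : (forall a b c d, (0 < a <= N)%N -> (0 < b <= N)%N ->
    (0 < c <= N)%N -> (0 < d <= N)%N -> F a b c d <= G a b c d) ->
  sum4 N F <= sum4 N G.
Proof.
move=> h; apply: ler_sum1 => a ?; apply: ler_sum1 => b ?.
by apply: ler_sum1 => c ?; apply: ler_sum1 => d ?; apply: h.
Qed.

Lemma sum4Z N k F : sum4 N (fun a b c d => k * F a b c d) = k * sum4 N F.
Proof.
rewrite /sum4 mulr_sumr; apply: eq_bigr => a _; rewrite mulr_sumr; apply: eq_bigr => b _.
by rewrite mulr_sumr; apply: eq_bigr => c _; rewrite mulr_sumr.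
Qed.

Lemma exchange_sum2 (I J : Type) (r : seq I) (s : seq J) (F : I -> J -> J -> R) :
  \sum_(i <- r) \sum_(a <- s) \sum_(b <- s) F i a b =
  \sum_(a <- s) \sum_(b <- s) \sum_(i <- r) F i a b.
Proof. by rewrite exchange_big; apply: eq_bigr => a _; rewrite exchange_big. Qed.

Lemma exchange_sum4 (I J : Type) (r : seq I) (s : seq J) (F : I -> J -> J -> J -> J -> R) :
  \sum_(i <- r) \sum_(a <- s) \sum_(b <- s) \sum_(c <- s) \sum_(d <- s) F i a b c d =
  \sum_(a <- s) \sum_(b <- s) \sum_(c <- s) \sum_(d <- s) \sum_(i <- r) F i a b c d.
Proof.
by rewrite exchange_sum2; apply: eq_bigr => a _; apply: eq_bigr => b _; rewrite exchange_sum2.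
Qed.

Lemma sum4_exchange (I : Type) (r : seq I) N (F : I -> nat -> nat -> nat -> nat -> R) :
  \sum_(i <- r) sum4 N (F i) = sum4 N (fun a b c d => \sum_(i <- r) F i a b c d).
Proof. exact: exchange_sum4.
Qed.

(** The sum over h is at most gcd(g, f) with g = gcd(a, n) and f = gcd(c, n), and it is 0
unless the cross congruence holds. Splitting by g and f then leaves sums over all a, b, c, d. *)
Lemma sum_units_sum4_le s n N (F : nat -> nat -> nat -> nat -> R) : (0 < n)%N ->
  (forall a b c d, 0 <= F a b c d) ->
  \sum_(0 <= h < n) (coprime h n)%:R * sum4 N (fun a b c d =>
    (signed_cong false n (h * a) b)%:R * (signed_cong s n (h * c) d)%:R *
      ((gcdn a n)%:R * (gcdn c n)%:R * F a b c d)) <=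
  \sum_(g <- divisors n) \sum_(f <- divisors n) sum4 N (fun a b c d =>
     (signed_cong s (n * gcdn g f) ((g * a) * (f * d)) ((g * b) * (f * c)))%:R *
     (g%:R * f%:R * (gcdn g f)%:R * F (g * a)%N (g * b)%N (f * c)%N (f * d)%N)).
Proof.
move=> n0 F0.
pose W g f a b c d : R := (signed_cong s (n * gcdn g f) (a * d) (b * c))%:R *
     (g%:R * f%:R * (gcdn g f)%:R * F a b c d).
have W0 g f a b c d : 0 <= W g f a b c d by rewrite !mulr_ge0.
apply: (@le_trans _ _ (sum4 N (fun a b c d => (gcdn a n == gcdn b n)%:R *
   ((gcdn c n == gcdn d n)%:R * W (gcdn a n) (gcdn c n) a b c d)))).
  under eq_bigr do rewrite -sum4Z.
  rewrite sum4_exchange; apply: sum4_le => a b c d _ _ _ _.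
  set A := (gcdn a n == gcdn b n); set B := (gcdn c n == gcdn d n).
  set E := signed_cong s (n * gcdn (gcdn a n) (gcdn c n)) (a * d) (b * c).
  apply: (@le_trans _ _ (A%:R * B%:R * E%:R *
     ((gcdn a n)%:R * (gcdn c n)%:R * F a b c d) *
     \sum_(0 <= h < n) (signed_cong false n (h * a) b && signed_cong s n (h * c) d)%:R)).
    rewrite mulr_sumr; apply: ler_sum => h _.
    have [hn|_] := boolP (coprime h n); last by rewrite mul0r !mulr_ge0.
    have [e1|_] := boolP (signed_cong false n (h * a) b); last by rewrite !(mul0r, mulr0).
    have [e2|_] := boolP (signed_cong s n (h * c) d); last by rewrite !(mul0r, mulr0).
    rewrite /A /B (signed_cong_gcd hn e1) (signed_cong_gcd hn e2) !eqxx !mul1r mulr1.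
    have -> : E.
      apply: signed_cong_dvd (signed_cong_cross e1 e2); apply: dvdn_mul => //.
      by rewrite dvdn_gcd (dvdn_trans (dvdn_gcdl _ _)) ?dvdn_gcdl//
        (dvdn_trans (dvdn_gcdr _ _)) ?dvdn_gcdl.
    by rewrite mul1r.
  rewrite /W -!mulrA; do 3 rewrite ler_wpM2l//.
  have := count_signed_cong s a b c d n0.
  have w0 : 0 <= (gcdn a n)%:R * (gcdn c n)%:R * F a b c d by rewrite !mulr_ge0.
  move=> /(ler_wpM2l w0); rewrite -!mulrA => h; apply: le_trans h _.
  by rewrite le_eqVlt; apply/orP; left; apply/eqP; ring.
pose V g a b := \sum_(1 <= c < N.+1) \sum_(1 <= d < N.+1) (gcdn c n == gcdn d n)%:R * W g (gcdn
  c n) a b c d.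
have V0 g a b : 0 <= V g a b by do 2 (apply: sumr_ge0 => ? _); rewrite mulr_ge0.
have e1 := @sum_gcd_split n N V n0 V0.
apply: (le_trans _ (le_trans e1 _)).
  apply: ler_sum => a _; apply: ler_sum => b _; rewrite mulr_sumr.
  by apply: ler_sum => c _; rewrite mulr_sumr.
apply: ler_sum => g _; rewrite sum4_exchange /sum4.
apply: ler_sum => a _; apply: ler_sum => b _.
have := @sum_gcd_split n N (fun f => W g f (g * a)%N (g * b)%N) n0
   (fun f => W0 g f (g * a)%N (g * b)%N).
move=> h; apply: le_trans h _; rewrite exchange_big; apply: ler_sum => c _.
by rewrite exchange_big.
Qed.

Section WithT.
Variables (n : nat) (T : R).
Hypotheses (no : odd n) (T1 : 1 <= T)
  (hT : forall u, (0 < u <= n * n)%N -> (size (divisors u))%:R <= T)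
  (hH : harm R (n * n) <= T).

Let N := n./2.
Let n0 : (0 < n)%N. Proof. by case: n no. Qed.
Let T0 : 0 <= T. Proof. by apply: le_trans T1. Qed.

Lemma sum_divisors_le (B : R) (F : nat -> R) : 0 <= B ->
  (forall g, (g %| n)%N -> F g <= B) -> \sum_(g <- divisors n) F g <= T * B.
Proof.
move=> B0 h; apply: (@le_trans _ _ (\sum_(g <- divisors n) B)).
  by rewrite big_seq [leRHS]big_seq; apply: ler_sum => g; rewrite -dvdn_divisors// => /h.
rewrite (eq_bigr (fun=> 1%:R * B)); last by move=> *; rewrite mul1r.
rewrite -mulr_suml -natr_sum sum1_size.
by rewrite ler_wpM2r// hT// n0 leq_pmulr.
Qed.

Lemma offdiag_uv s m : (0 < m)%N ->
  \sum_(1 <= u < (N * N).+1) \sum_(1 <= v < (N * N).+1)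
    (signed_cong s m u v && offdiag s u v)%:R / (u%:R * v%:R) <= 2 * T ^+ 2 / m%:R.
Proof.
move=> m0; have NN : ((N * N).*2 <= n * n)%N by rewrite /N; nia.
have N1 : (N * N <= n * n)%N by apply: leq_trans NN; lia.
have hX1 : harm R (N * N) <= T := le_trans (harm_mono R N1) hH.
have hX2 : harm R (N * N).*2 <= T := le_trans (harm_mono R NN) hH.
have Hp X := harm_ge0 R X.
have mV : 0 <= m%:R^-1 :> R by rewrite invr_ge0.
case: s; rewrite /offdiag /=.
  under eq_bigr do under eq_bigr do rewrite andbT.
  apply: le_trans (offdiag_add R (N * N) m0) _.
  by rewrite ler_wpM2r// ler_wpM2l// expr2 ler_pM.
have := offdiag_sub R (N * N) m0.
set S := \sum_(_ <= _ < _) _ => hS.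
apply: (@le_trans _ _ (S + S)); last first.
  have : harm R (N * N) ^+ 2 <= T ^+ 2 by rewrite lerXn2r ?nnegrE.
  move=> /(ler_wpM2r mV) h; move: (le_trans hS h); rewrite -mulrA; lra.
have SE : S = \sum_(1 <= u < (N * N).+1) \sum_(1 <= v < (N * N).+1)
     ((v < u)%N && (m %| u - v)%N)%:R / (u%:R * v%:R).
  rewrite /S exchange_big; apply: eq_bigr => u _; apply: eq_bigr => v _.
  by rewrite [v%:R * _]mulrC.
rewrite [in X in _ <= _ + X]SE /S -big_split; apply: ler_sum => u _.
rewrite -big_split; apply: ler_sum => v _ /=; rewrite -mulrDl.
rewrite ler_wpM2r ?invr_ge0 ?mulr_ge0//.
have [/eqP e|_] := boolP (u == v %[mod m]); last by rewrite /= addr_ge0.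
case: (ltngtP u v) => uv /=.
- by rewrite -eqn_mod_dvd ?(ltnW uv)// -e eqxx /= lerDl.
- by rewrite -eqn_mod_dvd ?(ltnW uv)// e eqxx /= lerDr.
- by rewrite addr0.
Qed.

(** Dividing the cross congruence by gf leaves ad = bc or -bc modulo m = n/lcm(g, f). The sum
of 1/(uv) over such u = ad and v = bc is at most 2T^2/m, the divisor bound costs T^2, and the
weights combine with 1/m to exactly 1/n. There are at most T^2 pairs (g, f). *)
Lemma offdiag_bound s :
  \sum_(0 <= h < n) (coprime h n)%:R * sum4 N (fun a b c d =>
    (signed_cong false n (h * a) b)%:R * (signed_cong s n (h * c) d)%:R *
      ((gcdn a n)%:R * (gcdn c n)%:R *
       ((offdiag s (a * d) (b * c))%:R / ((a * d)%:R * (b * c)%:R))))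
  <= 2 * T ^+ 6 / n%:R.
Proof.
apply: le_trans (sum_units_sum4_le s N n0 _) _.
  by move=> a b c d; rewrite mulr_ge0// invr_ge0 mulr_ge0.
have nV : 0 <= n%:R^-1 :> R by rewrite invr_ge0.
have -> : 2 * T ^+ 6 / n%:R = T * (T * (2 * T ^+ 4 / n%:R)) by ring.
have B0 : 0 <= 2 * T ^+ 4 / n%:R by rewrite !mulr_ge0// exprn_ge0.
apply: sum_divisors_le => [|g gn]; first by rewrite mulr_ge0.
apply: sum_divisors_le => // f fn.
have g0 := dvdn_gt0 n0 gn; have f0 := dvdn_gt0 n0 fn.
have G0 : (0 < gcdn g f)%N by rewrite gcdn_gt0 g0.
have Ln : (lcmn g f %| n)%N by rewrite dvdn_lcm gn.
have L0 := dvdn_gt0 n0 Ln.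
(* gf = lcm gcd turns the modulus n gcd(g, f) into gf m. *)
pose m := (n %/ lcmn g f)%N.
have nE : n = (m * lcmn g f)%N by rewrite /m divnK.
have m0 : (0 < m)%N by move: n0; rewrite {1}nE muln_gt0 => /andP[].
have gfE : (g * f = lcmn g f * gcdn g f)%N by rewrite muln_lcm_gcd.
have nG : (n * gcdn g f = (g * f) * m)%N by rewrite gfE {1}nE -mulnA mulnC.
pose A u v : R := (signed_cong s m u v && offdiag s u v)%:R / (u%:R * v%:R).
have gf0 : (0 < g * f)%N by rewrite muln_gt0 g0.
have gfR : (g%:R : R) != 0 by rewrite pnatr_eq0 -lt0n.
have ffR : (f%:R : R) != 0 by rewrite pnatr_eq0 -lt0n.
apply: (@le_trans _ _ (sum4 N (fun a b c d => ((gcdn g f)%:R / (g%:R * f%:R)) * A (a * d)%N (b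
  * c)%N))).
  apply: sum4_le => a b c d /andP[a0 _] /andP[b0 _] /andP[c0 _] /andP[d0 _].
  rewrite !(mulnACA g _ f _) nG signed_cong_scale// /A.
  have -> : offdiag s (g * f * (a * d)) (g * f * (b * c)) = offdiag s (a * d) (b * c).
    by rewrite /offdiag eqn_pmul2l.
  rewrite -mulnb natrM !natrM le_eqVlt; apply/orP; left; apply/eqP; field.
  by rewrite gfR ffR !pnatr_eq0 -!lt0n a0 b0 c0 d0.
rewrite sum4Z.
have NX : (N * N <= N * N)%N by [].
have hT' u : (0 < u <= N * N)%N -> (size (divisors u))%:R <= T.
  by move=> /andP[u0 uN]; apply: hT; rewrite u0 (leq_trans uN)// /N; nia.
have := sum4_prod_le NX hT' (F := A).
have A0 u v : 0 <= A u v by rewrite mulr_ge0// invr_ge0 mulr_ge0.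
move=> /(_ A0) q.
have Tsq : 0 <= T ^+ 2 by rewrite exprn_ge0.
have h1 := le_trans q (ler_wpM2l Tsq (offdiag_uv s m0)).
have c0 : 0 <= (gcdn g f)%:R / (g%:R * f%:R) :> R by rewrite divr_ge0// mulr_ge0.
apply: le_trans (ler_wpM2l c0 h1) _.
rewrite -natrM gfE [in leRHS]nE !natrM le_eqVlt; apply/orP; left; apply/eqP; field.
by rewrite !pnatr_eq0 -!lt0n m0 L0 G0.
Qed.

(** The size of the error on the diagonal, relative to n^3, when the four cotangents are
replaced by their principal parts: one of the four denominators is lost. *)
Definition diag_maj (a b c d : nat) : R := ((a * d)%N == (b * c)%N)%:R *
  ((b%:R * c%:R * d%:R)^-1 + (a%:R * c%:R * d%:R)^-1 +
   (a%:R * b%:R * d%:R)^-1 + (a%:R * b%:R * c%:R)^-1).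

Lemma sum_diag_maj : sum4 N diag_maj <= 8 * T ^+ 2.
Proof.
have hT' u : (0 < u <= N * N)%N -> (size (divisors u))%:R <= T.
  by move=> /andP[u0 uN]; apply: hT; rewrite u0 (leq_trans uN)// /N; nia.
have NX : (N * N <= N * N)%N by [].
have Nn : (N <= n * n)%N by rewrite /N; nia.
have HN : harm R N <= T := le_trans (harm_mono R Nn) hH.
pose G1 (a d : nat) : R := (a%:R^-1 * (d%:R ^+ 2)^-1).
have G10 a d : 0 <= G1 a d by rewrite mulr_ge0// invr_ge0// exprn_ge0.
have SG1 : \sum_(1 <= a < N.+1) \sum_(1 <= d < N.+1) G1 a d <= 2 * T.
  under eq_bigr do rewrite -mulr_sumr; rewrite -mulr_suml mulrC.
  by apply: ler_pM; rewrite ?harm_ge0 ?harm2_ge0// harm2_le2.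
have SG2 : \sum_(1 <= a < N.+1) \sum_(1 <= d < N.+1) G1 d a <= 2 * T.
  by rewrite exchange_big.
have f1 := sum4_diag_le NX hT' G10.
have f2 := sum4_diag_le NX hT' (fun a d => G10 d a).
have b1 := le_trans f1 (ler_wpM2l T0 SG1).
have b2 := le_trans f2 (ler_wpM2l T0 SG2).
have sw (G : nat -> nat -> R) :
   sum4 N (fun a b c d => ((a * d)%N == (b * c)%N)%:R * G b c) =
   sum4 N (fun a b c d => ((a * d)%N == (b * c)%N)%:R * G a d).
  rewrite /sum4 exchange_big; apply: eq_bigr => a _; apply: eq_bigr => b _.
  rewrite exchange_big; apply: eq_bigr => c _; apply: eq_bigr => d _.
  by rewrite eq_sym.
apply: (@le_trans _ _ (sum4 N (fun a b c d => ((a * d)%N == (b * c)%N)%:R * G1 a d) +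
   sum4 N (fun a b c d => ((a * d)%N == (b * c)%N)%:R * G1 b c) +
   sum4 N (fun a b c d => ((a * d)%N == (b * c)%N)%:R * G1 c b) +
   sum4 N (fun a b c d => ((a * d)%N == (b * c)%N)%:R * G1 d a))).
  rewrite /sum4 -!big_split; apply: ler_sum1 => a /andP[a0 _].
  rewrite -!big_split; apply: ler_sum1 => b /andP[b0 _].
  rewrite -!big_split; apply: ler_sum1 => c /andP[c0 _].
  rewrite -!big_split; apply: ler_sum1 => d /andP[d0 _] /=.
  rewrite /diag_maj /G1; have [/eqP e|_] := boolP (_ == _); last by rewrite !mul0r !addr0.
  have eR : a%:R * d%:R = b%:R * c%:R :> R by rewrite -!natrM e.
  rewrite !mul1r -!invfM le_eqVlt; apply/orP; left; apply/eqP.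
  congr (_^-1 + _^-1 + _^-1 + _^-1).
  - by rewrite -eR; ring.
  - by rewrite expr2 mulrA -eR; ring.
  - by rewrite [a%:R * _]mulrC -mulrA eR; ring.
  - by rewrite -mulrA -eR; ring.
have e4 := sw (fun b c => G1 b c); have e5 := sw (fun b c => G1 c b).
rewrite e4 e5; move: b1 b2; rewrite -/(sum4 N _) -/(sum4 N _) => b1 b2.
have -> : 8 * T ^+ 2 = T * (2 * T) + T * (2 * T) + T * (2 * T) + T * (2 * T) by ring.
by rewrite !lerD.
Qed.

(** With a, b scaled by g and c, d by f, every term of diag_maj loses at least a factor g^2 f
or g f^2, which absorbs g f gcd(g, f). *)
Lemma diag_error_bound :
  \sum_(0 <= h < n) (coprime h n)%:R * sum4 N (fun a b c d =>
    (signed_cong false n (h * a) b)%:R * (signed_cong false n (h * c) d)%:R *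
      ((gcdn a n)%:R * (gcdn c n)%:R * diag_maj a b c d))
  <= 8 * T ^+ 4.
Proof.
have F0 a b c d : 0 <= diag_maj a b c d.
  by rewrite mulr_ge0// !addr_ge0// invr_ge0 !mulr_ge0.
apply: le_trans (sum_units_sum4_le false N n0 F0) _.
have -> : 8 * T ^+ 4 = T * (T * (8 * T ^+ 2)) by ring.
have B0 : 0 <= 8 * T ^+ 2 by rewrite mulr_ge0// exprn_ge0.
apply: sum_divisors_le => [|g gn]; first by rewrite mulr_ge0.
apply: sum_divisors_le => // f fn.
apply: le_trans sum_diag_maj; apply: sum4_le => a b c d /andP[a0 _] /andP[b0 _] /andP[c0 _]
  /andP[d0 _].
have g0 := dvdn_gt0 n0 gn; have f0 := dvdn_gt0 n0 fn.
apply: (@le_trans _ _ (1 * (g%:R * f%:R * (gcdn g f)%:R *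
  diag_maj (g * a) (g * b) (f * c) (f * d)))).
  apply: ler_wpM2r; first by apply: mulr_ge0; [rewrite !mulr_ge0|exact: F0].
  by case: (signed_cong _ _ _ _); rewrite ?lexx ?ler01.
rewrite mul1r /diag_maj.
have -> : ((g * a * (f * d))%N == (g * b * (f * c))%N) = ((a * d)%N == (b * c)%N).
  by rewrite !(mulnACA g _ f _) eqn_pmul2l// muln_gt0 g0.
rewrite mulrCA ler_wpM2l//.
have Gg : (gcdn g f)%:R / g%:R <= 1 :> R.
  by rewrite ler_pdivrMr ?ltr0n// mul1r ler_nat dvdn_leq// dvdn_gcdl.
have local_sq : (gcdn g f)%:R / f%:R <= 1 :> R.
  by rewrite ler_pdivrMr ?ltr0n// mul1r ler_nat dvdn_leq// dvdn_gcdr.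
have gR : (g%:R : R) != 0 by rewrite pnatr_eq0 -lt0n.
have fR : (f%:R : R) != 0 by rewrite pnatr_eq0 -lt0n.
have aR : (a%:R : R) != 0 by rewrite pnatr_eq0 -lt0n.
have bR : (b%:R : R) != 0 by rewrite pnatr_eq0 -lt0n.
have cR : (c%:R : R) != 0 by rewrite pnatr_eq0 -lt0n.
have dR : (d%:R : R) != 0 by rewrite pnatr_eq0 -lt0n.
rewrite !natrM !mulrDr.
have x1 : g%:R * f%:R * (gcdn g f)%:R * (g%:R * b%:R * (f%:R * c%:R) * (f%:R * d%:R))^-1
   = (gcdn g f)%:R / f%:R * (b%:R * c%:R * d%:R)^-1 :> R.
  by field; rewrite gR fR bR cR dR.
have x2 : g%:R * f%:R * (gcdn g f)%:R * (g%:R * a%:R * (f%:R * c%:R) * (f%:R * d%:R))^-1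
   = (gcdn g f)%:R / f%:R * (a%:R * c%:R * d%:R)^-1 :> R.
  by field; rewrite gR fR aR cR dR.
have x3 : g%:R * f%:R * (gcdn g f)%:R * (g%:R * a%:R * (g%:R * b%:R) * (f%:R * d%:R))^-1
   = (gcdn g f)%:R / g%:R * (a%:R * b%:R * d%:R)^-1 :> R.
  by field; rewrite gR fR aR bR dR.
have x4 : g%:R * f%:R * (gcdn g f)%:R * (g%:R * a%:R * (g%:R * b%:R) * (f%:R * c%:R))^-1
   = (gcdn g f)%:R / g%:R * (a%:R * b%:R * c%:R)^-1 :> R.
  by field; rewrite gR fR aR bR cR.
rewrite x1 x2 x3 x4; have pos x y z : 0 <= (x%:R * y%:R * z%:R : R)^-1.
  by rewrite invr_ge0 !mulr_ge0.
by rewrite !lerD// ler_piMl.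
Qed.

End WithT.
End OffDiag.

(** * Reduction to the diagonal *)

Lemma eqmod_mull u x y n : coprime u n -> (u * x == u * y %[mod n]) = (x == y %[mod n]).
Proof.
move=> un; wlog xy : x y / (x <= y)%N => [hw|].
  have [|yx] := leqP x y; first exact: hw.
  by rewrite eq_sym hw ?(ltnW yx)// eq_sym.
rewrite eq_sym [RHS]eq_sym !eqn_mod_dvd ?leq_mul2l ?xy ?orbT// -mulnBr.
by rewrite Gauss_dvdr// coprime_sym.
Qed.

(** Multiplication by a unit permutes the residues. *)
Lemma sum_mul_unit (R : nmodType) n u (F : nat -> R) : (0 < n)%N -> coprime u n ->
  (forall x y, x = y %[mod n] -> F x = F y) ->
  \sum_(0 <= h < n) F (u * h)%N = \sum_(0 <= h < n) F h.
Proof.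
move=> n0 un Fm.
rewrite (eq_bigr (fun h => F (u * h %% n)%N)); last first.
  by move=> h _; apply: Fm; rewrite modn_mod.
rewrite -(big_map (fun h => u * h %% n)%N predT F); apply: perm_big.
have um : uniq [seq (u * h %% n)%N | h <- index_iota 0 n].
  rewrite map_inj_in_uniq ?iota_uniq// => x y; rewrite !mem_index_iota.
  move=> /andP[_ xn] /andP[_ yn] /eqP; rewrite eqmod_mull//.
  by rewrite !modn_small// => /eqP.
apply: uniq_perm; rewrite ?iota_uniq//.
have sub : {subset [seq (u * h %% n)%N | h <- index_iota 0 n] <= index_iota 0 n}.
  by move=> _ /mapP[x _ ->]; rewrite mem_index_iota ltn_pmod.
have sz : (size (index_iota 0 n) <= size [seq (u * h %% n)%N | h <- index_iota 0 n])%N.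
  by rewrite size_map.
by have [_] := uniq_min_size um sub sz.
Qed.

Section Assemble.
Variable R : realType.

Lemma sum4_mul N (f g : nat -> nat -> R) :
  (\sum_(1 <= a < N.+1) \sum_(1 <= b < N.+1) f a b) *
  (\sum_(1 <= a < N.+1) \sum_(1 <= b < N.+1) g a b) =
  sum4 N (fun a b c d => f a b * g c d).
Proof.
rewrite /sum4 mulr_suml; apply: eq_bigr => a _; rewrite mulr_suml; apply: eq_bigr => b _.
by rewrite mulr_sumr; apply: eq_bigr => c _; rewrite mulr_sumr.
Qed.

Lemma sum4B N (F G : nat -> nat -> nat -> nat -> R) :
  sum4 N F - sum4 N G = sum4 N (fun a b c d => F a b c d - G a b c d).
Proof.
rewrite /sum4 -sumrB; apply: eq_bigr => a _; rewrite -sumrB; apply: eq_bigr => b _.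
by rewrite -sumrB; apply: eq_bigr => c _; rewrite -sumrB.
Qed.

Lemma sum4D N (F G : nat -> nat -> nat -> nat -> R) :
  sum4 N F + sum4 N G = sum4 N (fun a b c d => F a b c d + G a b c d).
Proof.
rewrite /sum4 -big_split; apply: eq_bigr => a _; rewrite -big_split; apply: eq_bigr => b _.
by rewrite -big_split; apply: eq_bigr => c _; rewrite -big_split.
Qed.

Lemma sum4_norm N (F : nat -> nat -> nat -> nat -> R) :
  `|sum4 N F| <= sum4 N (fun a b c d => `|F a b c d|).
Proof.
rewrite /sum4; do 3 (apply: le_trans (ler_norm_sum _ _ _) _; apply: ler_sum => ? _).
exact: ler_norm_sum.
Qed.

Lemma eq_sum4 N (F G : nat -> nat -> nat -> nat -> R) :
  (forall a b c d, F a b c d = G a b c d) -> sum4 N F = sum4 N G.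
Proof.
by move=> h; rewrite /sum4; do 4 apply: eq_bigr => ? _.
Qed.

(** Replacing the factors one at a time costs at most 1 per factor. *)
Lemma prod4_close (k1 k2 k3 k4 c1 c2 c3 c4 : R) :
  0 <= c1 -> k1 - 1 <= c1 -> c1 <= k1 -> 0 <= c2 -> k2 - 1 <= c2 -> c2 <= k2 ->
  0 <= c3 -> k3 - 1 <= c3 -> c3 <= k3 -> 0 <= c4 -> k4 - 1 <= c4 -> c4 <= k4 ->
  `|c1 * c2 * (c3 * c4) - k1 * k2 * (k3 * k4)| <=
    k2 * k3 * k4 + k1 * k3 * k4 + k1 * k2 * k4 + k1 * k2 * k3.
Proof.
move=> a1 b1 d1 a2 b2 d2 a3 b3 d3 a4 b4 d4.
have e1 : 0 <= k1 := le_trans a1 d1. have e2 : 0 <= k2 := le_trans a2 d2.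
have e3 : 0 <= k3 := le_trans a3 d3. have e4 : 0 <= k4 := le_trans a4 d4.
have -> : c1 * c2 * (c3 * c4) - k1 * k2 * (k3 * k4) =
  - ((k1 - c1) * (k2 * k3 * k4) + (k2 - c2) * (c1 * k3 * k4) +
   (k3 - c3) * (c1 * c2 * k4) + (k4 - c4) * (c1 * c2 * c3)) by ring.
have f1 : 0 <= k1 - c1 <= 1 by apply/andP; split; lra.
have f2 : 0 <= k2 - c2 <= 1 by apply/andP; split; lra.
have f3 : 0 <= k3 - c3 <= 1 by apply/andP; split; lra.
have f4 : 0 <= k4 - c4 <= 1 by apply/andP; split; lra.
case/andP: f1 => f1 g1; case/andP: f2 => f2 g2; case/andP: f3 => f3 g3; case/andP: f4 => f4 g4.
rewrite normrN ger0_norm; last by rewrite !addr_ge0// !mulr_ge0.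
apply: lerD; first apply: lerD; first apply: lerD.
- by rewrite ler_piMl// !mulr_ge0.
- by rewrite -[leRHS]mul1r; apply: ler_pM => //; rewrite ?mulr_ge0// !ler_pM ?mulr_ge0.
- by rewrite -[leRHS]mul1r; apply: ler_pM => //; rewrite ?mulr_ge0// !ler_pM ?mulr_ge0.
- by rewrite -[leRHS]mul1r; apply: ler_pM => //; rewrite ?mulr_ge0// !ler_pM ?mulr_ge0.
Qed.

Variables (n : nat) (T : R).
Hypotheses (no : odd n) (T1 : 1 <= T)
  (hT : forall u, (0 < u <= n * n)%N -> (size (divisors u))%:R <= T)
  (hH : harm R (n * n) <= T).

Let N := n./2.
Let n0 : (0 < n)%N. Proof. by case: n no. Qed.
Let T0 : 0 <= T. Proof. by apply: le_trans T1. Qed.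
Let n0R : (0 : R) < n%:R. Proof. by rewrite ltr0n. Qed.

Lemma kappa_gt0 : 0 < kappa R n.
Proof. by rewrite divr_gt0// pi_gt0. Qed.

Lemma kappa_le : kappa R n <= n%:R.
Proof.
rewrite /kappa ler_pdivrMr ?pi_gt0// ler_peMr//.
by have := @pi_ge2 R => h; lra.
Qed.

(** The weight of the pair (a, b) at h, without the factor (n/pi)^2. *)
Definition main_coef (h a b : nat) : R :=
  (h * a == b %[mod n])%:R * (sieve_wt R n a / (a%:R * b%:R)).

Definition diag_main (h : nat) : R := sum4 N (fun a b c d =>
  ((a * d)%N == (b * c)%N)%:R * (main_coef h a b * main_coef h c d)).

Lemma corr_term_le a b c d : (1 <= a < N.+1)%N -> (1 <= b < N.+1)%N ->
  (1 <= c < N.+1)%N -> (1 <= d < N.+1)%N ->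
  `|sieve_wt R n a * (cotn R n a * cotn R n b) * (sieve_wt R n c * (cotn R n c * cotn R n d))| <=
  (gcdn a n)%:R * (gcdn c n)%:R * (kappa R n ^+ 4 / ((a * d)%:R * (b * c)%:R)).
Proof.
have k0 := kappa_gt0 => aN bN cN dN.
have wa := @normr_sieve_wt_le R n a n0; have wc := @normr_sieve_wt_le R n c n0.
have [a1 _ a2] := cotn_bounds R no aN; have [b1 _ b2] := cotn_bounds R no bN.
have [c1 _ c2] := cotn_bounds R no cN; have [d1 _ d2] := cotn_bounds R no dN.
move: aN bN cN dN => /andP[aN _] /andP[bN _] /andP[cN _] /andP[dN _].
rewrite [X in `|X|]mulrACA normrM [`|sieve_wt R n a * _|]normrM.
apply: ler_pM; rewrite ?mulr_ge0 ?normr_ge0//; first by apply: ler_pM.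
have p1 : 0 <= cotn R n a * cotn R n b by apply: mulr_ge0.
have p2 : 0 <= cotn R n c * cotn R n d by apply: mulr_ge0.
rewrite ger0_norm; last exact: mulr_ge0.
have -> : kappa R n ^+ 4 / ((a * d)%:R * (b * c)%:R) =
   kappa R n / a%:R * (kappa R n / b%:R) * (kappa R n / c%:R * (kappa R n / d%:R)).
  by rewrite !natrM; field; rewrite !gt_eqF ?ltr0n.
by apply: ler_pM => //; apply: ler_pM.
Qed.

Lemma corr_pos_sq_main h : `|corr_pos R n h ^+ 2 - kappa R n ^+ 4 * diag_main h| <=
  sum4 N (fun a b c d => (signed_cong false n (h * a) b)%:R * (signed_cong false n (h * c) d)%:R *
      ((gcdn a n)%:R * (gcdn c n)%:R *
       (kappa R n ^+ 4 * ((offdiag false (a * d) (b * c))%:R / ((a * d)%:R * (b * c)%:R)) +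
        kappa R n ^+ 3 * diag_maj R a b c d))).
Proof.
have k0 := kappa_gt0.
rewrite expr2 {1 2}/corr_pos sum4_mul /diag_main -sum4Z sum4B.
apply: le_trans (sum4_norm _ _) _; apply: sum4_le => a b c d aN bN cN dN.
rewrite /main_coef /=.
have [e1|_] := boolP (_ == _ %[mod _]); last by rewrite !(mul0r, mulr0) subrr normr0.
have [e2|_] := boolP (_ == _ %[mod _]); last by rewrite !(mul0r, mulr0) subrr normr0.
rewrite !mul1r /offdiag /diag_maj /=.
have [/eqP e|_] := boolP ((a * d)%N == (b * c)%N); last first.
  by rewrite !(mul0r, mulr0) subr0 addr0 mul1r; apply: corr_term_le.
rewrite !mul1r mul0r mulr0 add0r.
have wa := @normr_sieve_wt_le R n a n0; have wc := @normr_sieve_wt_le R n c n0.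
have [a1 a2 a3] := cotn_bounds R no aN; have [b1 b2 b3] := cotn_bounds R no bN.
have [c1 c2 c3] := cotn_bounds R no cN; have [d1 d2 d3] := cotn_bounds R no dN.
have cc := prod4_close a1 a2 a3 b1 b2 b3 c1 c2 c3 d1 d2 d3.
move: aN bN cN dN => /andP[aN _] /andP[bN _] /andP[cN _] /andP[dN _].
have [an bn] : (a%:R : R) != 0 /\ (b%:R : R) != 0 by rewrite !gt_eqF ?ltr0n.
have [cn dn] : (c%:R : R) != 0 /\ (d%:R : R) != 0 by rewrite !gt_eqF ?ltr0n.
rewrite [X in `|X|](_ : _ = (sieve_wt R n a * sieve_wt R n c) *
    (cotn R n a * cotn R n b * (cotn R n c * cotn R n d) -
     kappa R n / a%:R * (kappa R n / b%:R) * (kappa R n / c%:R * (kappa R n / d%:R)))); last first.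
  by field; rewrite an bn cn dn.
rewrite normrM [`|sieve_wt R n a * _|]normrM.
apply: ler_pM; rewrite ?mulr_ge0 ?normr_ge0//; first by apply: ler_pM.
apply: le_trans cc _; rewrite le_eqVlt; apply/orP; left; apply/eqP.
by field; rewrite an bn cn dn.
Qed.

Lemma corr_cross_le h : `|corr_pos R n h * corr_neg R n h| <=
  kappa R n ^+ 4 * sum4 N (fun a b c d =>
      (signed_cong false n (h * a) b)%:R * (signed_cong true n (h * c) d)%:R *
      ((gcdn a n)%:R * (gcdn c n)%:R *
       ((offdiag true (a * d) (b * c))%:R / ((a * d)%:R * (b * c)%:R)))).
Proof.
have k0 := kappa_gt0.
rewrite /corr_pos /corr_neg sum4_mul -sum4Z.
apply: le_trans (sum4_norm _ _) _; apply: sum4_le => a b c d aN bN cN dN.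
rewrite /=.
have [e1|_] := boolP (_ == _ %[mod _]); last by rewrite !(mul0r, mulr0) normr0.
have [e2|_] := boolP (_ %| _)%N; last by rewrite !(mul0r, mulr0) normr0.
by rewrite !mul1r [leRHS]mulrCA; apply: corr_term_le.
Qed.

Lemma sum_corr_neg_sq : \sum_(0 <= h < n) (coprime h n)%:R * corr_neg R n h ^+ 2 =
  \sum_(0 <= h < n) (coprime h n)%:R * corr_pos R n h ^+ 2.
Proof.
have un : coprime n.-1 n by rewrite coprimePn.
rewrite -(sum_mul_unit n0 un); last first.
  move=> x y e; rewrite -(coprime_modl x) e coprime_modl.
  have -> // : corr_neg R n x = corr_neg R n y.
  apply: eq_bigr => a _; apply: eq_bigr => b _.
  by rewrite /dvdn -modnDml -modnMml e modnMml modnDml.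
by apply: eq_bigr => h _; rewrite corr_neg_opp// coprimeMl un.
Qed.

(** Expanding the square of n/2 (P - Q), where P and Q are corr_pos and corr_neg: P^2 and Q^2
have the same sum over h, and give the diagonal plus off-diagonal terms. All of PQ is
off-diagonal, because ad + bc > 0. *)
Lemma unit_dedekind_second_moment :
  `|\sum_(0 <= h < n) (coprime h n)%:R * unit_dedekind R n h ^+ 2 -
    n%:R ^+ 2 / 2 * kappa R n ^+ 4 * \sum_(0 <= h < n) (coprime h n)%:R * diag_main h|
  <= 6 * n%:R ^+ 5 * T ^+ 6.
Proof.
have k0 := kappa_gt0; have kn := kappa_le.
set SM := \sum_(0 <= h < n) _ * diag_main h.
pose SP := \sum_(0 <= h < n) (coprime h n)%:R * corr_pos R n h ^+ 2.
pose SPQ := \sum_(0 <= h < n) (coprime h n)%:R * (corr_pos R n h * corr_neg R n h).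
have -> : \sum_(0 <= h < n) (coprime h n)%:R * unit_dedekind R n h ^+ 2 =
    n%:R ^+ 2 / 4 * (2 * SP - 2 * SPQ).
  have -> : 2 * SP - 2 * SPQ = \sum_(0 <= h < n) (coprime h n)%:R * corr_pos R n h ^+ 2 +
     \sum_(0 <= h < n) (coprime h n)%:R * corr_neg R n h ^+ 2 - 2 * SPQ.
    by rewrite sum_corr_neg_sq -/SP; ring.
  rewrite /SPQ mulr_sumr -big_split -sumrB mulr_sumr; apply: eq_bigr => h _.
  by rewrite unit_dedekind_fold//=; field.
pose k := kappa R n; rewrite -/k in k0 kn *.
have hPQ : `|SPQ| <= k ^+ 4 * (2 * T ^+ 6 / n%:R).
  apply: le_trans (ler_norm_sum _ _ _) _.
  apply: le_trans (ler_wpM2l _ (offdiag_bound no T1 hT hH true)); last by rewrite exprn_ge0// ltW.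
  rewrite mulr_sumr; apply: ler_sum => h _; rewrite normrM ger0_norm// mulrCA.
  by rewrite ler_wpM2l// corr_cross_le.
have hP : `|SP - k ^+ 4 * SM| <= k ^+ 4 * (2 * T ^+ 6 / n%:R) + k ^+ 3 * (8 * T ^+ 4).
  have o1 := ler_wpM2l (exprn_ge0 4 (ltW k0)) (offdiag_bound no T1 hT hH false).
  have o2 := ler_wpM2l (exprn_ge0 3 (ltW k0)) (diag_error_bound no T1 hT hH).
  apply: le_trans (lerD o1 o2).
  rewrite /SP /SM mulr_sumr -sumrB; apply: le_trans (ler_norm_sum _ _ _) _.
  rewrite !mulr_sumr -big_split; apply: ler_sum => h _ /=.
  set A1 := sum4 _ _; set A2 := sum4 _ _.
  have -> : (coprime h n)%:R * corr_pos R n h ^+ 2 - k ^+ 4 * ((coprime h n)%:R * diag_main h) =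
     (coprime h n)%:R * (corr_pos R n h ^+ 2 - k ^+ 4 * diag_main h) by ring.
  have -> : k ^+ 4 * ((coprime h n)%:R * A1) + k ^+ 3 * ((coprime h n)%:R * A2) =
     (coprime h n)%:R * (k ^+ 4 * A1 + k ^+ 3 * A2) by ring.
  rewrite normrM ger0_norm// ler_wpM2l//.
  apply: le_trans (corr_pos_sq_main h) _; rewrite /A1 /A2 -!sum4Z sum4D.
  rewrite le_eqVlt; apply/orP; left; apply/eqP; apply: eq_sum4 => a b c d.
  by rewrite -/k /=; ring.
have -> : n%:R ^+ 2 / 4 * (2 * SP - 2 * SPQ) - n%:R ^+ 2 / 2 * k ^+ 4 * SM =
   n%:R ^+ 2 / 2 * ((SP - k ^+ 4 * SM) - SPQ) by field.
have n2 : 0 <= n%:R ^+ 2 / 2 :> R by rewrite divr_ge0// exprn_ge0.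
rewrite normrM (ger0_norm n2).
apply: le_trans (ler_wpM2l n2 (le_trans (ler_normB _ _) (lerD hP hPQ))) _.
have k4 : k ^+ 4 / n%:R <= n%:R ^+ 3.
  by rewrite ler_pdivrMr// -exprSr ler_pXn2r ?nnegrE ?(ltW k0) ?(ltW n0R)//.
have k3 : k ^+ 3 <= n%:R ^+ 3 by rewrite ler_pXn2r ?nnegrE ?(ltW k0) ?(ltW n0R)//.
have T46 : T ^+ 4 <= T ^+ 6 by rewrite ler_weXn2l.
have T4 : 0 <= T ^+ 4 by rewrite exprn_ge0.
have T6 : 0 <= T ^+ 6 by rewrite exprn_ge0.
have n3 : 0 <= n%:R ^+ 3 :> R by rewrite exprn_ge0.
have -> : 6 * n%:R ^+ 5 * T ^+ 6 = n%:R ^+ 2 / 2 * (n%:R ^+ 3 * (12 * T ^+ 6)) by field.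
rewrite ler_wpM2l//.
have x1 : k ^+ 4 * (2 * T ^+ 6 / n%:R) <= n%:R ^+ 3 * (2 * T ^+ 6).
  have -> : k ^+ 4 * (2 * T ^+ 6 / n%:R) = k ^+ 4 / n%:R * (2 * T ^+ 6) by ring.
  by rewrite ler_wpM2r// mulr_ge0.
have x2 : k ^+ 3 * (8 * T ^+ 4) <= n%:R ^+ 3 * (8 * T ^+ 6).
  have p1 : 0 <= k ^+ 3 by rewrite exprn_ge0// ltW.
  have p2 : 0 <= 8 * T ^+ 4 by rewrite mulr_ge0.
  by apply: ler_pM => //; rewrite ler_wpM2l.
have e1 : n%:R ^+ 3 * (2 * T ^+ 6) = 2 * (n%:R ^+ 3 * T ^+ 6) by ring.
have e2 : n%:R ^+ 3 * (8 * T ^+ 6) = 8 * (n%:R ^+ 3 * T ^+ 6) by ring.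
have e3 : n%:R ^+ 3 * (12 * T ^+ 6) = 12 * (n%:R ^+ 3 * T ^+ 6) by ring.
rewrite e1 in x1; rewrite e2 in x2; rewrite e3.
move: x1 x2; move: (k ^+ 4 * _) (k ^+ 3 * _) (n%:R ^+ 3 * _) => X Y Z x1 x2; lra.
Qed.
End Assemble.

(** * Parametrising the diagonal *)

Definition absdiff (u v : nat) : nat := (u - v + (v - u))%N.

Lemma absdiff_mod u v m : (u == v %[mod m]) = (m %| absdiff u v)%N.
Proof.
rewrite /absdiff; case: (leqP u v) => uv.
  by rewrite eq_sym eqn_mod_dvd// (eqP uv).
by rewrite eqn_mod_dvd ?(ltnW uv)// (eqP (ltnW uv)) addn0.
Qed.

Lemma absdiffM t u v : absdiff (t * u) (t * v) = (t * absdiff u v)%N.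
Proof. by rewrite /absdiff -!mulnBr -mulnDr. Qed.

(** A fraction has one reduced form. *)
Lemma eq_cross_coprime x y x' y' : (0 < x)%N -> (0 < y)%N -> coprime x y -> coprime x' y' ->
  (x * y')%N = (y * x')%N -> x' = x /\ y' = y.
Proof.
move=> x0 y0 c c' e.
have xx' : (x %| x')%N by rewrite -(Gauss_dvdr _ c) -e dvdn_mulr.
have x'x : (x' %| x)%N by rewrite -(Gauss_dvdl _ c') e dvdn_mull.
have ex : x' = x by apply/eqP; rewrite eqn_dvd xx' x'x.
by split=> //; move: e; rewrite ex mulnC => /eqP; rewrite eqn_pmul2r// => /eqP.
Qed.

Section MainParam.
Variable R : realType.

Lemma sum_bool_dirac1 (s : seq nat) (P : pred nat) x0 : uniq s -> x0 \in s ->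
  (forall x, x \in s -> P x = (x == x0)) -> \sum_(x <- s) (P x)%:R = 1 :> R.
Proof.
move=> us xs h; have := @sum_bool_dirac R _ s P x0 (fun=> 1) us xs h.
by under eq_bigr do rewrite mulr1.
Qed.

(** Each pair (a, b) is t(x, y) for exactly one coprime pair (x, y), with t = gcd(a, b). *)
Lemma sum_primitive N (K : nat -> nat -> R) :
  \sum_(1 <= a < N.+1) \sum_(1 <= b < N.+1) K a b =
  \sum_(1 <= x < N.+1) \sum_(1 <= y < N.+1) (coprime x y)%:R *
    \sum_(1 <= t < N.+1) (t * maxn x y <= N)%:R * K (t * x)%N (t * y)%N.
Proof.
have e1 : \sum_(1 <= x < N.+1) \sum_(1 <= y < N.+1) (coprime x y)%:R *
    \sum_(1 <= t < N.+1) (t * maxn x y <= N)%:R * K (t * x)%N (t * y)%N =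
   \sum_(1 <= x < N.+1) \sum_(1 <= y < N.+1) \sum_(1 <= t < N.+1)
   \sum_(1 <= a < N.+1) \sum_(1 <= b < N.+1)
     (coprime x y)%:R * ((a == t * x)%N%:R * ((b == t * y)%N%:R * K a b)).
  apply: eq_sum1 => x /andP[x0 xN]; apply: eq_sum1 => y /andP[y0 yN].
  rewrite mulr_sumr; apply: eq_sum1 => t /andP[t0 tN].
  under [in RHS]eq_bigr do rewrite -mulr_sumr -mulr_sumr.
  rewrite -mulr_sumr; congr (_ * _).
  have mE : (t * maxn x y <= N)%N = (t * x <= N)%N && (t * y <= N)%N.
    by rewrite maxnMr geq_max.
  rewrite mE; have [tx|tx] := boolP (t * x <= N)%N; last first.
    rewrite mul0r big1_seq// => a; rewrite mem_index_iota ltnS => /= /andP[_ aN].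
    case: eqP => [e|]; last by rewrite mul0r.
    by move: tx; rewrite -e aN.
  rewrite (@sum_bool_dirac R _ _ _ (t * x)%N (fun a => \sum_(1 <= b < N.+1) (b == t * y)%N%:R *
    K a b))//.
  - have [ty|ty] := boolP (t * y <= N)%N; last first.
      rewrite mul0r big1_seq// => b; rewrite mem_index_iota ltnS => /= /andP[_ bN].
      case: eqP => [e|]; last by rewrite mul0r.
      by move: ty; rewrite -e bN.
    rewrite mul1r (@sum_bool_dirac R _ _ _ (t * y)%N)//; first exact: iota_uniq.
    by rewrite mem_index_iota muln_gt0 t0 y0 ltnS.
  - exact: iota_uniq.
  - by rewrite mem_index_iota muln_gt0 t0 x0 ltnS.
rewrite e1.
have e2 : \sum_(1 <= x < N.+1) \sum_(1 <= y < N.+1) \sum_(1 <= t < N.+1)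
   \sum_(1 <= a < N.+1) \sum_(1 <= b < N.+1)
     (coprime x y)%:R * ((a == t * x)%N%:R * ((b == t * y)%N%:R * K a b)) =
   \sum_(1 <= a < N.+1) \sum_(1 <= b < N.+1) K a b *
    \sum_(1 <= x < N.+1) \sum_(1 <= y < N.+1) \sum_(1 <= t < N.+1)
     [&& coprime x y, a == t * x & b == t * y]%N%:R.
  under eq_bigr => x _ do under eq_bigr => y _ do rewrite exchange_sum2.
  under eq_bigr => x _ do rewrite exchange_sum2.
  rewrite exchange_sum2; apply: eq_bigr => a _; apply: eq_bigr => b _.
  do 3 (rewrite mulr_sumr; apply: eq_bigr => ? _).
  by rewrite -!mulnb !natrM; ring.
rewrite e2; apply: eq_sum1 => a /andP[a0 aN]; apply: eq_sum1 => b /andP[b0 bN].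
pose g := gcdn a b; have g0 : (0 < g)%N by rewrite gcdn_gt0 a0.
have ga : (g %| a)%N := dvdn_gcdl a b. have gb : (g %| b)%N := dvdn_gcdr a b.
have gle : (g <= a)%N by apply: dvdn_leq.
rewrite -[LHS]mulr1; congr (_ * _); symmetry.
have key x y t : (0 < x)%N -> (0 < y)%N -> (0 < t)%N ->
  [&& coprime x y, a == t * x & b == t * y]%N =
   [&& x == a %/ g, y == b %/ g & t == g]%N.
  move=> x0 y0 t0; apply/and3P/and3P => [[cxy /eqP ea /eqP eb]|[/eqP-> /eqP-> /eqP->]].
    have gE : g = t by rewrite /g ea eb -muln_gcdr (eqP cxy) muln1.
    by rewrite gE ea eb !mulKn.
  split; last by rewrite mulnC divnK.
    rewrite /coprime -(eqn_pmul2l g0) muln_gcdr muln1 ![(g * _)%N]mulnC !divnK//.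
  by rewrite mulnC divnK.
have -> : \sum_(1 <= x < N.+1) \sum_(1 <= y < N.+1) \sum_(1 <= t < N.+1)
     [&& coprime x y, a == t * x & b == t * y]%N%:R =
  \sum_(1 <= x < N.+1) (x == a %/ g)%N%:R * \sum_(1 <= y < N.+1)
    (y == b %/ g)%N%:R * \sum_(1 <= t < N.+1) (t == g)%:R :> R.
  apply: eq_sum1 => x /andP[x0 _]; rewrite mulr_sumr; apply: eq_sum1 => y /andP[y0 _].
  rewrite mulrA mulr_sumr; apply: eq_sum1 => t /andP[t0 _].
  by rewrite key// -!mulnb !natrM mulrA.
have inI (k : nat) : (0 < k <= N)%N -> k \in index_iota 1 N.+1 by rewrite mem_index_iota ltnS.
rewrite (@sum_bool_dirac R _ _ _ (a %/ g)%N (fun=> \sum_(1 <= y < N.+1)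
    (y == b %/ g)%N%:R * \sum_(1 <= t < N.+1) (t == g)%:R) (iota_uniq _ _))//; last first.
  by apply: inI; rewrite divn_gt0// gle (leq_trans (leq_div _ _)).
rewrite (@sum_bool_dirac R _ _ _ (b %/ g)%N (fun=> \sum_(1 <= t < N.+1) (t == g)%:R) (iota_uniq
  _ _))//; last first.
  by apply: inI; rewrite divn_gt0// dvdn_leq//= (leq_trans (leq_div _ _)).
rewrite (@sum_bool_dirac1 _ _ g (iota_uniq _ _))//.
by apply: inI; rewrite g0 (leq_trans gle).
Qed.

(** The condition ad = bc says that (a, b) and (c, d) lie on the same ray through a primitive
point, so that the diagonal is a sum of squares over these points. *)
Lemma sum4_diag_primitive N (f : nat -> nat -> R) :
  sum4 N (fun a b c d => ((a * d)%N == (b * c)%N)%:R * (f a b * f c d)) =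
  \sum_(1 <= x < N.+1) \sum_(1 <= y < N.+1) (coprime x y)%:R *
    (\sum_(1 <= t < N.+1) (t * maxn x y <= N)%:R * f (t * x)%N (t * y)%N) ^+ 2.
Proof.
rewrite /sum4 sum_primitive; apply: eq_sum1 => x /andP[x0 xN]; apply: eq_sum1 => y /andP[y0 yN].
have [cxy|_] := boolP (coprime x y); last by rewrite !mul0r.
rewrite !mul1r expr2 mulr_suml; apply: eq_sum1 => t /andP[t0 tN].
rewrite -mulrA; congr (_ * _).
have -> : \sum_(1 <= c < N.+1) \sum_(1 <= d < N.+1)
    ((t * x * d)%N == (t * y * c)%N)%:R * (f (t * x)%N (t * y)%N * f c d) =
    f (t * x)%N (t * y)%N * \sum_(1 <= c < N.+1) \sum_(1 <= d < N.+1)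
      ((x * d)%N == (y * c)%N)%:R * f c d.
  rewrite mulr_sumr; apply: eq_bigr => c _; rewrite mulr_sumr; apply: eq_bigr => d _.
  by rewrite -!mulnA eqn_pmul2l// mulrCA.
congr (_ * _); rewrite sum_primitive.
transitivity (\sum_(1 <= x' < N.+1) (x' == x)%:R * \sum_(1 <= y' < N.+1) (y' == y)%:R *
   \sum_(1 <= u < N.+1) (u * maxn x' y' <= N)%:R * f (u * x')%N (u * y')%N).
  apply: eq_sum1 => x' /andP[x'0 _]; rewrite mulr_sumr; apply: eq_sum1 => y' /andP[y'0 _].
  have [cxy'|cxy'] := boolP (coprime x' y'); last first.
    rewrite mul0r; have [ex|] := eqVneq x' x; last by rewrite mul0r.
    have [ey|] := eqVneq y' y; last by rewrite mul0r mulr0.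
    by move: cxy'; rewrite ex ey cxy.
  rewrite mul1r mulrA mulr_sumr; apply: eq_sum1 => u /andP[u0 _].
  rewrite [RHS]mulrCA; congr (_ * _); rewrite -natrM mulnb; congr (_%:R * _).
  congr nat_of_bool; rewrite !(mulnCA _ u) eqn_pmul2l//; apply/eqP/andP => [e|[/eqP-> /eqP->]].
    by have [-> ->] := eq_cross_coprime x0 y0 cxy cxy' e.
  by rewrite mulnC.
rewrite (@sum_bool_dirac R _ _ _ x (fun x' => \sum_(1 <= y' < N.+1) (y' == y)%:R *
   \sum_(1 <= u < N.+1) (u * maxn x' y' <= N)%:R * f (u * x')%N (u * y')%N) (iota_uniq _ _))//;
     last first.
  by rewrite mem_index_iota x0 ltnS.
rewrite (@sum_bool_dirac R _ _ _ y (fun y' =>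
   \sum_(1 <= u < N.+1) (u * maxn x y' <= N)%:R * f (u * x)%N (u * y')%N) (iota_uniq _ _))//.
by rewrite mem_index_iota y0 ltnS.
Qed.

(** Restricted to t divisible by r, because this is what the congruence condition on t amounts
to. *)
Definition sieved_sum (ps : seq nat) (Y r : nat) : R := \sum_(1 <= t < Y.+1)
   (r %| t)%:R * (\prod_(p <- ps) (1 - p%:R * (p %| t)%:R) / t%:R ^+ 2).

(** A prime p of ps multiplies the sum by 1 - p if all the t are divisible by p, and otherwise
by 1 - p/p^2. *)
Definition sieve_factor (ps : seq nat) (r : nat) : R :=
  \prod_(p <- ps) (if (p %| r)%N then 1 - p%:R else 1 - p%:R^-1).

Definition sieve_err (ps : seq nat) (r : nat) : R :=
  \prod_(p <- ps) (if (p %| r)%N then p%:R else 2).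

Lemma sieve_err_ge0 ps r : 0 <= sieve_err ps r.
Proof. by apply: prodr_ge0 => p _; case: ifP. Qed.

Lemma floor_bound Y p : (0 < p)%N -> ((Y %/ p).+1)%:R^-1 <= p%:R / (Y.+1)%:R :> R.
Proof.
move=> p0; rewrite ler_pdivlMr ?ltr0n// ler_pdivrMl ?ltr0n// -natrM ler_nat.
exact: ltn_ceil.
Qed.

(** Induction on the list of primes. If p divides r, the weight of p is the constant 1 - p.
Otherwise the multiples t = ps of p form the same sum with Y/p in place of Y, multiplied by
p/p^2. The error doubles at each such step, whence sieve_err. *)
Lemma sieved_sum_asymp ps Y r : uniq ps -> all prime ps -> (0 < r)%N ->
  `|sieved_sum ps Y r - zeta2 R / r%:R ^+ 2 * sieve_factor ps r| <= 8 / r%:R * sieve_err ps r /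
    Y.+1%:R.
Proof.
move=> + + r0; have r0R : (0 : R) < r%:R by rewrite ltr0n.
elim: ps Y => [|p ps IH] Y.
  move=> _ _; rewrite /sieved_sum /sieve_factor /sieve_err !big_nil !mulr1.
  under eq_bigr do rewrite big_nil.
  rewrite sum_multiples//.
  have -> : \sum_(1 <= k < (Y %/ r).+1) (1 / (r * k)%:R ^+ 2) = harm2 R (Y %/ r) / r%:R ^+ 2.
    rewrite /harm2 mulr_suml; apply: eq_bigr => k _.
    by rewrite natrM exprMn invfM mul1r mulrC.
  have [h1 h2] := harm2_zeta2 R (Y %/ r).
  rewrite -mulrBl normrM distrC [`|_ ^- 2|]ger0_norm ?invr_ge0 ?exprn_ge0// ger0_norm ?subr_ge0//.
  have h3 := le_trans h2 (ler_wpM2l (ler0n _ 8) (floor_bound Y r0)).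
  have -> : 8 / r%:R / Y.+1%:R = 8 * (r%:R / Y.+1%:R) / r%:R ^+ 2 :> R.
    have : (Y.+1%:R : R) != 0 by rewrite pnatr_eq0.
    move: (Y.+1%:R : R) => y1 y10; field; rewrite y10 gt_eqF//.
  by rewrite ler_wpM2r// invr_ge0 exprn_ge0.
move=> /andP[pps ups] /andP[pp aps].
have p0 := prime_gt0 pp; have p0R : (0 : R) < p%:R by rewrite ltr0n.
have p1R : (1 : R) <= p%:R by rewrite ler1n.
have [pr|pr] := boolP (p %| r)%N.
  have -> : sieved_sum (p :: ps) Y r = (1 - p%:R) * sieved_sum ps Y r.
    rewrite /sieved_sum mulr_sumr; apply: eq_bigr => t _; rewrite big_cons.
    have [rt|_] := boolP (r %| t)%N; last by rewrite !mul0r mulr0.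
    by rewrite (dvdn_trans pr rt) mulr1; ring.
  rewrite /sieve_factor /sieve_err !big_cons pr -/(sieve_factor ps r) -/(sieve_err ps r).
  have -> : (1 - p%:R) * sieved_sum ps Y r - zeta2 R / r%:R ^+ 2 * ((1 - p%:R) * sieve_factor
    ps r) =
     (1 - p%:R) * (sieved_sum ps Y r - zeta2 R / r%:R ^+ 2 * sieve_factor ps r) by ring.
  have -> : 8 / r%:R * (p%:R * sieve_err ps r) / Y.+1%:R = p%:R * (8 / r%:R * sieve_err ps r /
    Y.+1%:R) :> R by ring.
  rewrite normrM; apply: ler_pM => //; last exact: IH.
  by rewrite ler_norml; apply/andP; split; lra.
have cpr : coprime p r by rewrite prime_coprime.
have -> : sieved_sum (p :: ps) Y r = sieved_sum ps Y r - p%:R^-1 * sieved_sum ps (Y %/ p) r.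
  rewrite /sieved_sum.
  have -> : p%:R^-1 * (\sum_(1 <= t < (Y %/ p).+1) (r %| t)%:R *
      (\prod_(q <- ps) (1 - q%:R * (q %| t)%:R) / t%:R ^+ 2)) =
    \sum_(1 <= t < Y.+1) (p %| t)%:R * (p%:R * ((r %| t)%:R *
      (\prod_(q <- ps) (1 - q%:R * (q %| t)%:R) / t%:R ^+ 2))) :> R.
    rewrite [RHS](@sum_multiples R Y p _ p0) mulr_sumr; apply: eq_sum1 => t /andP[t0 _].
    rewrite Gauss_dvdr; last by rewrite coprime_sym.
    have -> : \prod_(q <- ps) (1 - q%:R * (q %| p * t)%:R) =
              \prod_(q <- ps) (1 - q%:R * (q %| t)%:R) :> R.
      rewrite big_seq [RHS]big_seq; apply: eq_bigr => q qps.
      rewrite Gauss_dvdr// prime_coprime ?(allP aps _ qps)// dvdn_prime2 ?(allP aps _ qps)//.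
      by apply/eqP => e; move: pps; rewrite -e qps.
    by rewrite natrM; field; rewrite !gt_eqF ?ltr0n.
  by rewrite -sumrB; apply: eq_bigr => t _; rewrite big_cons; ring.
rewrite /sieve_factor /sieve_err !big_cons (negPf pr) -/(sieve_factor ps r) -/(sieve_err ps r).
have -> : sieved_sum ps Y r - p%:R^-1 * sieved_sum ps (Y %/ p) r - zeta2 R / r%:R ^+ 2 * ((1 -
  p%:R^-1) * sieve_factor ps r) =
  (sieved_sum ps Y r - zeta2 R / r%:R ^+ 2 * sieve_factor ps r) -
  p%:R^-1 * (sieved_sum ps (Y %/ p) r - zeta2 R / r%:R ^+ 2 * sieve_factor ps r) by ring.
have h1 := IH Y ups aps; have h2 := IH (Y %/ p)%N ups aps.
apply: le_trans (ler_normB _ _) _; rewrite normrM ger0_norm ?invr_ge0//.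
set c := 8 / r%:R * sieve_err ps r in h1 h2 *.
have c0 : 0 <= c by rewrite mulr_ge0 ?sieve_err_ge0// divr_ge0.
have -> : 8 / r%:R * (2 * sieve_err ps r) / Y.+1%:R = c / Y.+1%:R + c / Y.+1%:R by rewrite /c; ring.
apply: lerD => //.
rewrite ler_pdivrMl//; apply: le_trans h2 _.
by rewrite mulrCA ler_wpM2l// floor_bound.
Qed.

End MainParam.

(** * The sum along one primitive direction *)

Section MainTerm.
Variable R : realType.

Lemma sum_cut_le N m (F : nat -> R) : (0 < m)%N ->
  \sum_(1 <= t < N.+1) (t * m <= N)%:R * F t = \sum_(1 <= t < (N %/ m).+1) F t.
Proof.
move=> m0; rewrite (@big_cat_nat _ _ _ (N %/ m).+1)//=; last by rewrite ltnS leq_div.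
rewrite [X in _ + X]big1_seq ?addr0; last first.
  move=> t; rewrite mem_index_iota => /= /andP[tm _].
  by rewrite -leq_divRL// leqNgt tm mul0r.
by apply: eq_sum1 => t /andP[_ tm]; rewrite -leq_divRL// tm mul1r.
Qed.

Lemma prodr_dvd_le n r : (0 < r)%N ->
  \prod_(p <- primes n) (if (p %| r)%N then p%:R else 1) <= r%:R :> R.
Proof.
move=> r0; rewrite -big_mkcond -big_filter -natr_prod ler_nat dvdn_leq//.
apply: prod_primes_dvd.
- by rewrite filter_uniq// primes_uniq.
- by apply/allP => p; rewrite mem_filter mem_primes => /andP[_ /and3P[]].
- by apply/allP => p; rewrite mem_filter => /andP[].
Qed.

Lemma normr_sieve_factor_le n r : (0 < r)%N -> `|sieve_factor R (primes n) r| <= r%:R.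
Proof.
move=> r0; apply: le_trans (prodr_dvd_le n r0); rewrite /sieve_factor normr_prod.
rewrite big_seq [leRHS]big_seq; apply: ler_prod => p.
rewrite mem_primes => /and3P[pp _ _]; rewrite normr_ge0 /=.
have p1 : (1 : R) <= p%:R by rewrite ler1n prime_gt0.
case: ifP => _; rewrite ler_norml; first by apply/andP; split; lra.
have : p%:R^-1 <= 1 :> R by rewrite invf_le1//; lra.
have : 0 <= p%:R^-1 :> R by rewrite invr_ge0.
by move: (p%:R^-1) => z z0 coprime_sq_sum; apply/andP; split; lra.
Qed.

Lemma sieve_err_le n r : (0 < r)%N -> (0 < n)%N ->
  sieve_err R (primes n) r <= r%:R * (size (divisors n))%:R.
Proof.
move=> r0 n0; apply: (@le_trans _ _ (r%:R * (2 ^ size (primes n))%:R)); last first.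
  by rewrite ler_wpM2l// ler_nat exp2_omega.
rewrite exp2_size.
apply: le_trans (ler_wpM2r _ (prodr_dvd_le n r0)); last by apply: prodr_ge0.
rewrite -big_split /=; apply: ler_prod => p _; case: ifP => _ /=.
  by rewrite ler0n ler_peMr// ler1n.
by rewrite mul1r ler0n lexx.
Qed.

Variables (n : nat) (T : R).
Hypotheses (no : odd n) (T1 : 1 <= T)
  (hT : forall u, (0 < u <= n * n)%N -> (size (divisors u))%:R <= T)
  (hH : harm R (n * n) <= T).

Let N := n./2.
Let n0 : (0 < n)%N. Proof. by case: n no. Qed.
Let T0 : 0 <= T. Proof. by apply: le_trans T1. Qed.
Let n0R : (0 : R) < n%:R. Proof. by rewrite ltr0n. Qed.
Let dT : (size (divisors n))%:R <= T. Proof. by apply: hT; rewrite n0 leq_pmulr. Qed.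

Definition hit_gcd (h x y : nat) : nat := gcdn n (absdiff (h * x) y).
(** The order of hx - y in the additive group modulo n: t(hx - y) = 0 modulo n if and only if
this number divides t. *)
Definition hit_period (h x y : nat) : nat := (n %/ hit_gcd h x y)%N.

Lemma hit_gcd_dvd h x y : (hit_gcd h x y %| n)%N. Proof. exact: dvdn_gcdl. Qed.
Lemma hit_gcd_gt0 h x y : (0 < hit_gcd h x y)%N. Proof. by rewrite gcdn_gt0 n0. Qed.
Lemma hit_period_gt0 h x y : (0 < hit_period h x y)%N.
Proof. by rewrite divn_gt0 ?hit_gcd_gt0// dvdn_leq// hit_gcd_dvd. Qed.
(** From n = qr with q = gcd(n, hx - y): n divides t(hx - y) if and only if r divides t. *)
Lemma dvd_hit_period h x y t : (h * (t * x) == t * y %[mod n]) = (hit_period h x y %| t)%N.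
Proof.
rewrite mulnCA absdiff_mod absdiffM /hit_period.
have q0 := hit_gcd_gt0 h x y; have qn := hit_gcd_dvd h x y; set q := hit_gcd h x y in q0 qn *.
rewrite -{1}(divnK qn).
have qd : (q %| absdiff (h * x) y)%N := dvdn_gcdr _ _.
rewrite -(divnK qd) mulnA dvdn_pmul2r// Gauss_dvdl//.
rewrite /coprime -(eqn_pmul2r q0) muln_gcdl mul1n !divnK//.
Qed.

(** The weight at tx may be read at t: if n divides t(hx - y), then gcd(tx, n) divides ty,
hence divides t, as x and y are coprime. *)
Lemma ray_sum h x y : coprime h n -> coprime x y -> (0 < x)%N -> (0 < y)%N ->
  \sum_(1 <= t < N.+1) (t * maxn x y <= N)%:R * main_coef R n h (t * x) (t * y) =
  (x%:R * y%:R)^-1 * sieved_sum R (primes n) (N %/ maxn x y) (hit_period h x y).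
Proof.
move=> hn cxy x0 y0; rewrite sum_cut_le; last by rewrite leq_max x0.
rewrite /sieved_sum mulr_sumr; apply: eq_sum1 => t /andP[t0 _].
rewrite /main_coef dvd_hit_period [RHS]mulrCA.
have [rt|_] := boolP (hit_period h x y %| t)%N; last by rewrite !mul0r.
have e : h * (t * x) == t * y %[mod n] by rewrite dvd_hit_period.
have -> : sieve_wt R n (t * x) = sieve_wt R n t.
  apply: sieve_wt_gcd; apply/eqP; rewrite eqn_dvd !dvdn_gcd !dvdn_gcdr !andbT.
  rewrite (dvdn_trans (dvdn_gcdl t n))/=; last exact: dvdn_mulr.
  have g1 := @signed_cong_gcd false n h _ _ hn e.
  have d1 : (gcdn (t * x) n %| t * x)%N := dvdn_gcdl _ _.
  have d2 : (gcdn (t * x) n %| t * y)%N by rewrite g1 dvdn_gcdl.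
  have : (gcdn (t * x) n %| gcdn (t * x) (t * y))%N by rewrite dvdn_gcd d1 d2.
  by rewrite -muln_gcdr (eqP cxy) muln1 andbT.
rewrite !mul1r /sieve_wt !natrM; field.
by rewrite !gt_eqF ?ltr0n.
Qed.

(** The limit of the inner sum as the truncation goes to infinity. *)
Definition ray_limit (h x y : nat) : R :=
  zeta2 R / (hit_period h x y)%:R ^+ 2 * sieve_factor R (primes n) (hit_period h x y).

Lemma zeta2_le3 : 0 <= zeta2 R <= 3.
Proof.
have := @pi_lt4 R; have := @pi_gt0 R; rewrite /zeta2 => p0 p4.
apply/andP; split; first by rewrite divr_ge0// exprn_ge0// ltW.
have : (pi : R) ^+ 2 <= 4 ^+ 2 by rewrite lerXn2r ?nnegrE// ltW.
by lra.
Qed.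

Lemma normr_ray_limit_le h x y : `|ray_limit h x y| <= 3 / (hit_period h x y)%:R.
Proof.
have r0 := hit_period_gt0 h x y; have r0R : (0 : R) < (hit_period h x y)%:R by rewrite ltr0n.
case/andP: zeta2_le3 => z0 z3.
rewrite /ray_limit normrM normrM ger0_norm// ger0_norm ?invr_ge0 ?exprn_ge0//.
have := normr_sieve_factor_le n r0; move: (hit_period h x y)%:R r0R => r r0R hF.
have -> : 3 / r = 3 / r ^+ 2 * r by field; rewrite gt_eqF.
apply: ler_pM => //; first by rewrite divr_ge0// exprn_ge0// ltW.
by rewrite ler_wpM2r// invr_ge0 exprn_ge0// ltW.
Qed.

Lemma sieved_sum_ray_limit Y h x y :
  `|sieved_sum R (primes n) Y (hit_period h x y) - ray_limit h x y| <= 8 * T / Y.+1%:R.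
Proof.
have r0 := hit_period_gt0 h x y; have r0R : (0 : R) < (hit_period h x y)%:R by rewrite ltr0n.
apply: le_trans (sieved_sum_asymp R Y (primes_uniq n) (all_prime_primes n) r0) _.
rewrite ler_wpM2r ?invr_ge0// -mulrA ler_wpM2l// ler_pdivrMl//.
apply: le_trans (sieve_err_le r0 n0) _.
by rewrite ler_wpM2l.
Qed.

(** When Y < r the sum is empty; otherwise the error 1/Y is at most 1/r. *)
Lemma sieved_sum_le Y h x y : `|sieved_sum R (primes n) Y (hit_period h x y)| <=
  11 * T / (hit_period h x y)%:R.
Proof.
have r0 := hit_period_gt0 h x y; have r0R : (0 : R) < (hit_period h x y)%:R by rewrite ltr0n.
have [Yr|rY] := ltnP Y (hit_period h x y).
  rewrite /sieved_sum big1_seq ?normr0; first by rewrite divr_ge0// mulr_ge0.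
  move=> t; rewrite mem_index_iota ltnS => /= /andP[t0 tY].
  by rewrite gtnNdvd ?mul0r// (leq_ltn_trans tY).
have h1 := sieved_sum_ray_limit Y h x y; have h2 := normr_ray_limit_le h x y.
have h3 : 8 * T / Y.+1%:R <= 8 * T / (hit_period h x y)%:R.
  rewrite ler_wpM2l ?mulr_ge0// lef_pV2 ?posrE ?ltr0n// ler_nat; exact: leq_trans rY _.
have h4 : 3 / (hit_period h x y)%:R <= 3 * T / (hit_period h x y)%:R.
  by rewrite ler_wpM2r ?invr_ge0// ler_peMr.
have -> : sieved_sum R (primes n) Y (hit_period h x y) = (sieved_sum R (primes n) Y (hit_period
  h x y) - ray_limit h x y) + ray_limit h x y by ring.
apply: le_trans (ler_normD _ _) _.
apply: le_trans (lerD (le_trans h1 h3) (le_trans h2 h4)) _.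
by rewrite le_eqVlt; apply/orP; left; apply/eqP; ring.
Qed.

Lemma sieved_sum_sq_close Y h x y :
  `|sieved_sum R (primes n) Y (hit_period h x y) ^+ 2 - ray_limit h x y ^+ 2| <= 112 * T ^+ 2 /
    Y.+1%:R / (hit_period h x y)%:R.
Proof.
have r0 := hit_period_gt0 h x y; have r0R : (0 : R) < (hit_period h x y)%:R by rewrite ltr0n.
rewrite subr_sqr normrM.
have -> : 112 * T ^+ 2 / Y.+1%:R / (hit_period h x y)%:R = (8 * T / Y.+1%:R) * (14 * T /
  (hit_period h x y)%:R) by ring.
apply: ler_pM => //; first exact: sieved_sum_ray_limit.
apply: le_trans (ler_normD _ _) _.
apply: le_trans (lerD (sieved_sum_le _ _ _ _) (normr_ray_limit_le _ _ _)) _.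
rewrite -mulrDl ler_wpM2r ?invr_ge0//.
suff aux (t : R) : 1 <= t -> 11 * t + 3 <= 14 * t by exact: aux.
move=> t1; lra.
Qed.

(** A solution forces x to be prime to g, because a common factor of g and x would divide y.
Hence all the solutions agree modulo g. *)
Lemma count_cong x y g : coprime x y -> (g %| n)%N ->
  \sum_(0 <= h < n) (g %| absdiff (h * x) y)%:R <= (n %/ g)%:R :> R.
Proof.
move=> cxy gn; have g0 := dvdn_gt0 n0 gn.
apply: count_residue_class_le => // h h' hh; rewrite -!absdiff_mod => /eqP e1 /eqP e2.
have cgx : coprime g x.
  rewrite /coprime; have d : (gcdn g x %| gcdn x y)%N.
    rewrite dvdn_gcd dvdn_gcdr /=.
    have dg := dvdn_gcdl g x; rewrite /dvdn -(modn_dvdm y dg) -e1 modn_dvdm//.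
    by rewrite -/(dvdn _ _) dvdn_mull// dvdn_gcdr.
  by move: d; rewrite (eqP cxy) dvdn1.
rewrite -(Gauss_dvdl _ cgx) mulnBl -eqn_mod_dvd ?leq_mul2r ?hh ?orbT//.
by rewrite e1 e2.
Qed.

(** 1/r = q/n with q = gcd(n, hx - y), and q is at most the sum of the common divisors g. Each
g occurs for at most n/g values of h. *)
Lemma sum_inv_hit_period x y : coprime x y ->
  \sum_(0 <= h < n) (coprime h n)%:R / (hit_period h x y)%:R <= T.
Proof.
move=> cxy.
apply: (@le_trans _ _ (n%:R^-1 * \sum_(0 <= h < n) (hit_gcd h x y)%:R)).
  rewrite mulr_sumr; apply: ler_sum => h _.
  have qn := hit_gcd_dvd h x y; have q0 := hit_gcd_gt0 h x y.
  have rE : n%:R = (hit_period h x y)%:R * (hit_gcd h x y)%:R :> R by rewrite -natrM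
    /hit_period divnK.
  have r0R : ((hit_period h x y)%:R : R) != 0 by rewrite pnatr_eq0 -lt0n hit_period_gt0.
  have q0R : ((hit_gcd h x y)%:R : R) != 0 by rewrite pnatr_eq0 -lt0n.
  rewrite rE invfM -mulrA mulVf// mulr1 ler_piMl ?invr_ge0//.
  by case: coprime.
rewrite ler_pdivrMl//.
apply: (@le_trans _ _ (\sum_(0 <= h < n) \sum_(g <- divisors n) (g %| absdiff (h * x) y)%:R *
  g%:R)).
  apply: ler_sum => h _.
  have qin : hit_gcd h x y \in divisors n by rewrite -dvdn_divisors// hit_gcd_dvd.
  rewrite (bigD1_seq _ qin (divisors_uniq n))/= dvdn_gcdr mul1r lerDl.
  by apply: sumr_ge0 => g _; rewrite mulr_ge0.
rewrite exchange_big /= [leRHS]mulrC.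
apply: (sum_divisors_le no hT (ler0n R n)) => g gn; rewrite -mulr_suml.
have := ler_wpM2r (ler0n R g) (count_cong cxy gn).
by rewrite -natrM divnK.
Qed.

(** The truncation at t <= N/max(x, y) costs T^2 max(x, y)/(N r). The sum over h of 1/r is at
most T, and (x + y)/(xy)^2 has a sum over x, y of size O(T). *)
Lemma diag_main_ray_limit :
  `|\sum_(0 <= h < n) (coprime h n)%:R * diag_main R n h -
    \sum_(1 <= x < N.+1) \sum_(1 <= y < N.+1) (coprime x y)%:R / (x%:R * y%:R) ^+ 2 *
      \sum_(0 <= h < n) (coprime h n)%:R * ray_limit h x y ^+ 2|
  <= 448 * T ^+ 4 / N.+1%:R.
Proof.
have -> : \sum_(0 <= h < n) (coprime h n)%:R * diag_main R n h =
   \sum_(1 <= x < N.+1) \sum_(1 <= y < N.+1) (coprime x y)%:R / (x%:R * y%:R) ^+ 2 *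
      \sum_(0 <= h < n) (coprime h n)%:R * sieved_sum R (primes n) (N %/ maxn x y) (hit_period
        h x y) ^+ 2.
  under eq_bigr do rewrite /diag_main sum4_diag_primitive mulr_sumr.
  rewrite exchange_big; apply: eq_sum1 => x /andP[x0 _].
  under eq_bigr do rewrite mulr_sumr.
  rewrite exchange_big; apply: eq_sum1 => y /andP[y0 _].
  rewrite mulr_sumr; apply: eq_bigr => h _.
  have [hn|_] := boolP (coprime h n); last by rewrite !mul0r mulr0.
  have [cxy|_] := boolP (coprime x y); last by rewrite !(mul0r, mulr0).
  by rewrite ray_sum// !mul1r exprMn exprVn.
rewrite -sumrB; apply: le_trans (ler_norm_sum _ _ _) _.
apply: (@le_trans _ _ (\sum_(1 <= x < N.+1) \sum_(1 <= y < N.+1)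
   (112 * T ^+ 3 / N.+1%:R) * ((x%:R + y%:R) / (x%:R * y%:R) ^+ 2))); last first.
  under eq_bigr do rewrite -mulr_sumr; rewrite -mulr_sumr.
  have -> : 448 * T ^+ 4 / N.+1%:R = 112 * T ^+ 3 / N.+1%:R * (4 * T) by ring.
  rewrite ler_wpM2l ?divr_ge0 ?mulr_ge0 ?exprn_ge0//.
  have Nn : (N <= n * n)%N by rewrite /N; nia.
  have HN : harm R N <= T := le_trans (harm_mono R Nn) hH.
  have -> : \sum_(1 <= x < N.+1) \sum_(1 <= y < N.+1) (x%:R + y%:R) / (x%:R * y%:R) ^+ 2 =
     harm R N * harm2 R N + harm2 R N * harm R N.
    rewrite /harm /harm2 !mulr_suml -big_split; apply: eq_sum1 => x /andP[x0 _] /=.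
    rewrite !mulr_sumr -big_split; apply: eq_sum1 => y /andP[y0 _] /=.
    by field; rewrite !gt_eqF ?ltr0n.
  have p1 : harm R N * harm2 R N <= T * 2 by apply: ler_pM; rewrite ?harm_ge0 ?harm2_ge0 ?harm2_le2.
  by move: p1; rewrite [harm2 R N * _]mulrC; move: (_ * harm2 R N) => z coprime_sq_sum; lra.
apply: ler_sum1 => x /andP[x0 _]; rewrite -sumrB.
apply: le_trans (ler_norm_sum _ _ _) _; apply: ler_sum1 => y /andP[y0 _].
have x0R : (0 : R) < x%:R by rewrite ltr0n.
have y0R : (0 : R) < y%:R by rewrite ltr0n.
have [cxy|_] := boolP (coprime x y); last first.
  have t1 : 0 <= 112 * T ^+ 3 / N.+1%:R by rewrite divr_ge0// mulr_ge0// exprn_ge0.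
  have t2 : 0 <= (x%:R + y%:R) / (x%:R * y%:R) ^+ 2 :> R.
    by rewrite divr_ge0// ?addr_ge0// exprn_ge0// mulr_ge0.
  by rewrite !mul0r subr0 normr0 mulr_ge0.
have m0 : (0 < maxn x y)%N by rewrite leq_max x0.
rewrite -mulrBr -sumrB normrM ger0_norm; last first.
  by rewrite divr_ge0// exprn_ge0// mulr_ge0.
rewrite mul1r mulrA mulrC ler_wpM2r ?invr_ge0 ?exprn_ge0 ?mulr_ge0//.
apply: le_trans (ler_norm_sum _ _ _) _.
apply: (@le_trans _ _ (112 * T ^+ 2 / (N %/ maxn x y).+1%:R *
   \sum_(0 <= h < n) (coprime h n)%:R / (hit_period h x y)%:R)).
  rewrite mulr_sumr; apply: ler_sum => h _; rewrite -mulrBr normrM ger0_norm// mulrCA.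
  by rewrite ler_wpM2l// sieved_sum_sq_close.
have c0 : 0 <= 112 * T ^+ 2 / (N %/ maxn x y).+1%:R.
  by rewrite divr_ge0// mulr_ge0// exprn_ge0.
apply: le_trans (ler_wpM2l c0 (sum_inv_hit_period cxy)) _.
have fb := @floor_bound R N (maxn x y) m0.
have mx : (maxn x y)%:R <= x%:R + y%:R :> R by rewrite -natrD ler_nat geq_max leq_addr leq_addl.
have -> : 112 * T ^+ 2 / (N %/ maxn x y).+1%:R * T = 112 * T ^+ 3 * (N %/ maxn x y).+1%:R^-1.
  by ring.
have -> : 112 * T ^+ 3 / N.+1%:R * (x%:R + y%:R) = 112 * T ^+ 3 * ((x%:R + y%:R) / N.+1%:R) by ring.
rewrite ler_wpM2l ?mulr_ge0 ?exprn_ge0//.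
by apply: le_trans fb _; rewrite ler_wpM2r// invr_ge0.
Qed.

End MainTerm.

(** * Sums over coprime pairs *)

Section Zagier.
Variable R : realType.

(** Zagier's function from his proof of zeta(2)^2 = (5/2) zeta(4); its value at (1, 1) is 5/2. *)
Definition zagier (x y : nat) : R :=
  (x%:R * y%:R ^+ 3)^-1 + (2 * x%:R ^+ 2 * y%:R ^+ 2)^-1 + (x%:R ^+ 3 * y%:R)^-1.

Lemma zagier_telescope x y : (0 < x)%N -> (0 < y)%N ->
  (x%:R ^+ 2 * y%:R ^+ 2)^-1 = zagier x y - zagier x (x + y) - zagier (x + y) y.
Proof.
move=> x0 y0; have x0R : (0 : R) < x%:R by rewrite ltr0n.
have y0R : (0 : R) < y%:R by rewrite ltr0n.
rewrite /zagier natrD; field.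
by rewrite !gt_eqF// addr_gt0.
Qed.

Lemma sum_shift_add N x (g : nat -> R) : (x <= N)%N ->
  \sum_(1 <= y < N.+1) (x + y <= N)%N%:R * g (x + y)%N =
  \sum_(1 <= z < N.+1) (x < z)%N%:R * g z.
Proof.
move=> xN.
rewrite [RHS](@big_cat_nat _ _ _ x.+1)//= [X in _ = X + _]big1_seq ?add0r; last first.
  by move=> z; rewrite mem_index_iota ltnS => /= /andP[_ zx]; rewrite ltnNge zx mul0r.
rewrite [LHS](@big_cat_nat _ _ _ (N - x).+1)//=; last by rewrite ltnS leq_subr.
rewrite [X in _ + X = _]big1_seq ?addr0; last first.
  move=> z; rewrite mem_index_iota => /= /andP[zx _].
  have -> : (x + z <= N)%N = false by apply/negbTE; rewrite -ltnNge; lia.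
  by rewrite mul0r.
rewrite -[x.+1 in RHS]add1n big_addn subSn//.
apply: eq_sum1 => y /andP[y0 yN].
have -> : (x + y <= N)%N by lia.
by rewrite addnC -[X in (X < _)%N]add0n ltn_add2r y0.
Qed.

Definition coprime_sq_sum (N : nat) : R :=
  \sum_(1 <= x < N.+1) \sum_(1 <= y < N.+1) (coprime x y)%:R / (x%:R * y%:R) ^+ 2.

(** The maps (x, y) -> (x, x+y) and (x, y) -> (x+y, y) cover all the coprime pairs except (1,
1) exactly once, so the sum of the telescoping identity over x + y <= N leaves 5/2 and the
pairs that cross the boundary. *)
Lemma zagier_identity N : (0 < N)%N ->
  \sum_(1 <= x < N.+1) \sum_(1 <= y < N.+1)
     (x + y <= N)%N%:R * ((coprime x y)%:R * (x%:R ^+ 2 * y%:R ^+ 2)^-1) =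
  5 / 2 - \sum_(1 <= x < N.+1) \sum_(1 <= y < N.+1)
     (N < x + y)%N%:R * ((coprime x y)%:R * zagier x y).
Proof.
move=> N0.
pose g x y : R := (coprime x y)%:R * zagier x y.
have e1 : \sum_(1 <= x < N.+1) \sum_(1 <= y < N.+1)
     (x + y <= N)%N%:R * ((coprime x y)%:R * (x%:R ^+ 2 * y%:R ^+ 2)^-1) =
  \sum_(1 <= x < N.+1) \sum_(1 <= y < N.+1) (x + y <= N)%N%:R * g x y -
  \sum_(1 <= x < N.+1) \sum_(1 <= y < N.+1) (x + y <= N)%N%:R * g x (x + y)%N -
  \sum_(1 <= x < N.+1) \sum_(1 <= y < N.+1) (x + y <= N)%N%:R * g (x + y)%N y.
  rewrite -!sumrB; apply: eq_sum1 => x /andP[x0 _]; rewrite -!sumrB.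
  apply: eq_sum1 => y /andP[y0 _]; rewrite zagier_telescope// /g.
  have -> : coprime x (x + y) = coprime x y by rewrite /coprime gcdnDl.
  have -> : coprime (x + y) y = coprime x y by rewrite /coprime gcdnC gcdnDr gcdnC.
  ring.
have e2 : \sum_(1 <= x < N.+1) \sum_(1 <= y < N.+1) (x + y <= N)%N%:R * g x (x + y)%N =
   \sum_(1 <= x < N.+1) \sum_(1 <= z < N.+1) (x < z)%N%:R * g x z.
  by apply: eq_sum1 => x /andP[_ xN]; rewrite sum_shift_add.
have e3 : \sum_(1 <= x < N.+1) \sum_(1 <= y < N.+1) (x + y <= N)%N%:R * g (x + y)%N y =
   \sum_(1 <= x < N.+1) \sum_(1 <= z < N.+1) (z < x)%N%:R * g x z.
  rewrite exchange_big [RHS]exchange_big; apply: eq_sum1 => y /andP[_ yN].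
  rewrite -(sum_shift_add (fun x => g x y) yN); apply: eq_bigr => x _.
  by rewrite addnC.
have e4 : \sum_(1 <= x < N.+1) \sum_(1 <= z < N.+1) (x == z)%N%:R * g x z = 5 / 2.
  rewrite (eq_sum1 (G := fun x => (x == 1)%N%:R * g 1%N 1%N)).
    rewrite (@sum_bool_dirac R _ _ _ 1%N (fun=> g 1%N 1%N) (iota_uniq _ _))//.
      by rewrite /g /zagier /coprime gcdnn /=; field.
    by rewrite mem_index_iota ltnS.
  move=> x /andP[x0 xN]; under eq_bigr do rewrite eq_sym.
  rewrite (@sum_bool_dirac R _ _ _ x _ (iota_uniq _ _))//; last first.
    by rewrite mem_index_iota x0 ltnS.
  rewrite /g /coprime gcdnn; case: eqP => [->|]; last by rewrite !mul0r.
  by rewrite gcdnn eqxx !mul1r.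
rewrite e1 e2 e3 -e4.
have -> : \sum_(1 <= x < N.+1) \sum_(1 <= y < N.+1) (N < x + y)%N%:R * ((coprime x y)%:R *
  zagier x y) =
  \sum_(1 <= x < N.+1) \sum_(1 <= z < N.+1) (x == z)%N%:R * g x z +
  \sum_(1 <= x < N.+1) \sum_(1 <= z < N.+1) (x < z)%N%:R * g x z +
  \sum_(1 <= x < N.+1) \sum_(1 <= z < N.+1) (z < x)%N%:R * g x z -
  \sum_(1 <= x < N.+1) \sum_(1 <= y < N.+1) (x + y <= N)%N%:R * g x y; last by ring.
rewrite -!big_split -sumrB; apply: eq_sum1 => x _; rewrite -!big_split -sumrB.
apply: eq_sum1 => y _ /=; rewrite -/(g x y) ltnNge.
by case: (ltngtP x y) => _; case: (_ <= _)%N => /=; ring.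
Qed.

(** All the discrepancies come from pairs with x, y <= N < x + y. There xy >= N, and each x has
x partners y, so the sum of 1/(x^3 y) is at most H_N/N. *)
Lemma coprime_sq_sum_asymp N : (0 < N)%N -> `|coprime_sq_sum N - 5 / 2| <= 4 * harm R N / N%:R.
Proof.
move=> N0.
pose E : R := \sum_(1 <= x < N.+1) \sum_(1 <= y < N.+1) (N < x + y)%N%:R / (x%:R ^+ 3 * y%:R).
have E' : E = \sum_(1 <= x < N.+1) \sum_(1 <= y < N.+1) (N < x + y)%N%:R / (x%:R * y%:R ^+ 3).
  rewrite /E exchange_big; apply: eq_bigr => x _; apply: eq_bigr => y _.
  by rewrite addnC [x%:R * _]mulrC.
have N0R : (0 : R) < N%:R by rewrite ltr0n.
have EH : E <= harm R N / N%:R.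
  rewrite /E /harm mulr_suml; apply: ler_sum1 => x /andP[x0 xN].
  have x0R : (0 : R) < x%:R by rewrite ltr0n.
  apply: (@le_trans _ _ (\sum_(1 <= y < N.+1) (N < x + y)%N%:R * (x%:R ^+ 2 * N%:R)^-1)).
    apply: ler_sum1 => y /andP[y0 yN]; have [h|_] := ltnP N (x + y); last by rewrite !mul0r.
    have y0R : (0 : R) < y%:R by rewrite ltr0n.
    rewrite ler_wpM2l// lef_pV2 ?posrE ?mulr_gt0 ?exprn_gt0//.
    have -> : x%:R ^+ 3 * y%:R = x%:R ^+ 2 * (x%:R * y%:R) :> R by ring.
    rewrite ler_wpM2l ?exprn_ge0// -natrM ler_nat.
    nia.
  rewrite -mulr_suml.
  have -> : \sum_(1 <= y < N.+1) (N < x + y)%N%:R = x%:R :> R.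
    rewrite (@big_cat_nat _ _ _ (N - x).+1)//=; last by rewrite ltnS leq_subr.
    rewrite big1_seq ?add0r; last first.
      move=> y; rewrite mem_index_iota => /= /andP[_ h].
      by have -> : (N < x + y)%N = false by lia.
    rewrite big_seq (eq_bigr (fun=> 1)); last first.
      move=> y; rewrite mem_index_iota => /andP[h _].
      by have -> : (N < x + y)%N by lia.
    rewrite -big_seq sumr_const_nat; congr (_%:R); lia.
  by rewrite le_eqVlt; apply/orP; left; apply/eqP; field; rewrite !gt_eqF.
pose D1 : R := \sum_(1 <= x < N.+1) \sum_(1 <= y < N.+1)
     (N < x + y)%N%:R * ((coprime x y)%:R * zagier x y).
pose D2 : R := \sum_(1 <= x < N.+1) \sum_(1 <= y < N.+1)
     (N < x + y)%N%:R * ((coprime x y)%:R * (x%:R ^+ 2 * y%:R ^+ 2)^-1).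
have zE : coprime_sq_sum N - 5 / 2 = D2 - D1.
  have -> : coprime_sq_sum N = D2 + (5 / 2 - D1); last by ring.
  rewrite /D1 -zagier_identity// /D2 /coprime_sq_sum -big_split; apply: eq_bigr => x _.
  rewrite -big_split; apply: eq_bigr => y _; rewrite /= exprMn ltnNge.
  by case: (x + y <= N)%N; rewrite /= ?mul1r ?mul0r ?add0r ?addr0.
have q x y : 0 <= (coprime x y)%:R * (x%:R ^+ 2 * y%:R ^+ 2)^-1 :> R.
  by rewrite mulr_ge0// invr_ge0 mulr_ge0// exprn_ge0.
have zf0 x y : 0 <= zagier x y.
  by rewrite !addr_ge0// invr_ge0 !mulr_ge0// exprn_ge0.
have D10 : 0 <= D1 by rewrite /D1; do 2 (apply: sumr_ge0 => ? _); rewrite !mulr_ge0.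
have D20 : 0 <= D2 by rewrite /D2; do 2 (apply: sumr_ge0 => ? _); rewrite mulr_ge0.
have E0 : 0 <= E.
  by rewrite /E; do 2 (apply: sumr_ge0 => ? _); rewrite mulr_ge0// invr_ge0 mulr_ge0// exprn_ge0.
have D12 : D1 + D2 <= 7 / 4 * (E + E).
  rewrite {2}E' /D1 /D2 /E -!big_split mulr_sumr; apply: ler_sum1 => x /andP[x0 _].
  rewrite -!big_split mulr_sumr; apply: ler_sum1 => y /andP[y0 _] /=.
  have x0R : (0 : R) < x%:R by rewrite ltr0n.
  have y0R : (0 : R) < y%:R by rewrite ltr0n.
  case: (_ < _)%N; last by rewrite !mul0r addr0 mulr0.
  rewrite !mul1r -mulrDr.
  apply: (@le_trans _ _ (zagier x y + (x%:R ^+ 2 * y%:R ^+ 2)^-1)).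
    have : 0 <= zagier x y + (x%:R ^+ 2 * y%:R ^+ 2)^-1.
      by rewrite addr_ge0// invr_ge0 mulr_ge0// exprn_ge0.
    by case: coprime; rewrite ?mul1r// mul0r.
  rewrite -subr_ge0 /zagier.
  (* The excess is a square: this is 2/(xy)^2 <= 1/(xy^3) + 1/(x^3y). *)
  have -> : 7 / 4 * ((x%:R ^+ 3 * y%:R)^-1 + (x%:R * y%:R ^+ 3)^-1) -
    ((x%:R * y%:R ^+ 3)^-1 + (2 * x%:R ^+ 2 * y%:R ^+ 2)^-1 + (x%:R ^+ 3 * y%:R)^-1 + (x%:R ^+
      2 * y%:R ^+ 2)^-1) =
    3 / 4 * ((x%:R - y%:R) ^+ 2 / (x%:R ^+ 3 * y%:R ^+ 3)) :> R.
    by field; rewrite !gt_eqF.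
  by rewrite mulr_ge0// divr_ge0// ?sqr_ge0// mulr_ge0// exprn_ge0.
rewrite zE; apply: (@le_trans _ _ (D1 + D2)).
  by rewrite ler_norml; apply/andP; split; lra.
apply: le_trans D12 _; rewrite -mulrA; lra.
Qed.

Definition sieved_term (ps : seq nat) (x y : nat) : R :=
  (coprime x y && all (fun p => ~~ (p %| x * y)%N) ps)%:R / (x%:R * y%:R) ^+ 2.

Definition sieved_sq_sum (ps : seq nat) (N : nat) : R :=
  \sum_(1 <= x < N.+1) \sum_(1 <= y < N.+1) sieved_term ps x y.

(** The local density of the pairs prime to p, weighted by 1/(xy)^2: (1 - p^-2)/(1 + p^-2). *)
Definition rho (p : nat) : R := (p%:R ^+ 2 - 1) / (p%:R ^+ 2 + 1).

Lemma sieved_term_ge0 ps x y : 0 <= sieved_term ps x y.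
Proof. by rewrite divr_ge0// exprn_ge0// mulr_ge0. Qed.

Lemma sieved_term_sym ps x y : sieved_term ps x y = sieved_term ps y x.
Proof. by rewrite /sieved_term coprime_sym [(y * x)%N]mulnC [y%:R * _]mulrC. Qed.

Lemma sieved_term_le ps x y : sieved_term ps x y <= (x%:R ^+ 2)^-1 * (y%:R ^+ 2)^-1.
Proof.
rewrite /sieved_term exprMn invfM ler_piMl ?mulr_ge0 ?invr_ge0 ?exprn_ge0//.
by case: (_ && _).
Qed.

Lemma rho_itv p : prime p -> 0 <= rho p <= 1.
Proof.
move=> pp; have p1 : (1 : R) <= p%:R ^+ 2.
  by rewrite -natrX ler1n expn_gt0 prime_gt0.
rewrite /rho; apply/andP; split; first by rewrite divr_ge0; lra.
rewrite ler_pdivrMr; lra.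
Qed.

(** Let P be the part of the sum with p | x, and Z' the part with p prime to xy; by symmetry
the whole sum is Z' + 2P. Dividing x by p maps the pairs of P onto the pairs with y prime to p,
which sum up to Z' + P. So P = p^-2 (Z' + P) up to the truncation t of this sum at x <= N/p,
and the claim follows by eliminating P. *)
Lemma sieved_sq_sum_step p ps N : prime p -> all prime ps -> p \notin ps ->
  `|sieved_sq_sum (p :: ps) N - rho p * sieved_sq_sum ps N| <= 4 / N.+1%:R.
Proof.
move=> pp aps pps; have p0 := prime_gt0 pp; have p2 := prime_gt1 pp.
have p0R : (2 : R) <= p%:R by rewrite ler_nat.
have notboth x y : coprime x y -> (p %| x)%N -> (p %| y)%N -> False.
  move=> cxy px py; have : (p %| gcdn x y)%N by rewrite dvdn_gcd px.
  by rewrite (eqP cxy) dvdn1 => /eqP p1; move: p2; rewrite p1.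
pose W X : R := \sum_(1 <= x < X.+1) \sum_(1 <= y < N.+1) (~~ (p %| y)%N)%:R * sieved_term ps x y.
pose P : R := \sum_(1 <= x < N.+1) \sum_(1 <= y < N.+1) (p %| x)%N%:R * sieved_term ps x y.
have P' : P = \sum_(1 <= x < N.+1) \sum_(1 <= y < N.+1) (p %| y)%N%:R * sieved_term ps x y.
  by rewrite /P exchange_big; apply: eq_bigr => x _; apply: eq_bigr => y _; rewrite sieved_term_sym.
have term_cons x y : sieved_term (p :: ps) x y = (~~ (p %| x)%N)%:R * (~~ (p %| y)%N)%:R *
  sieved_term ps x y.
  rewrite /sieved_term /= Euclid_dvdM// negb_or.
  by case: (p %| x)%N; case: (p %| y)%N; case: coprime; rewrite /= ?mul1r ?mul0r.
have g0 x y : (p %| x)%N -> (p %| y)%N -> sieved_term ps x y = 0.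
  move=> px py; rewrite /sieved_term; have [cxy|_] := boolP (coprime x y); last by rewrite mul0r.
  by have := notboth _ _ cxy px py.
have Zsplit : sieved_sq_sum ps N = sieved_sq_sum (p :: ps) N + 2 * P.
  rewrite mulr_natl mulr2n {2}P' /sieved_sq_sum /P -!big_split; apply: eq_bigr => x _.
  rewrite -!big_split; apply: eq_bigr => y _ /=; rewrite term_cons.
  have := g0 x y; case: (p %| x)%N; case: (p %| y)%N => /= h.
  - by rewrite h//; ring.
  - by ring.
  - by ring.
  - by ring.
have WN : W N = sieved_sq_sum (p :: ps) N + P.
  rewrite /W /sieved_sq_sum /P -!big_split; apply: eq_bigr => x _.
  rewrite -!big_split; apply: eq_bigr => y _ /=; rewrite term_cons.
  have := g0 x y; case: (p %| x)%N; case: (p %| y)%N => /= h.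
  - by rewrite h//; ring.
  - by ring.
  - by ring.
  - by ring.
have PW : P = (p%:R ^+ 2)^-1 * W (N %/ p)%N.
  rewrite /P; under eq_bigr do rewrite -mulr_sumr.
  rewrite sum_multiples// /W mulr_sumr; apply: eq_sum1 => x /andP[x0 _].
  rewrite mulr_sumr; apply: eq_sum1 => y /andP[y0 _].
  rewrite /sieved_term coprimeMl prime_coprime//.
  have -> : all (fun q => ~~ (q %| p * x * y)%N) ps = all (fun q => ~~ (q %| x * y)%N) ps.
    apply: eq_in_all => q qps; rewrite -mulnA Gauss_dvdr// prime_coprime ?(allP aps _ qps)//.
    rewrite dvdn_prime2 ?(allP aps _ qps)//; apply/eqP => e.
    by move: pps; rewrite -e qps.
  case: (p %| y)%N; rewrite /= ?mul0r ?mulr0// mul1r natrM -mulrA exprMn invfM mulrCA.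
  by [].
pose t := W N - W (N %/ p)%N.
have tE : t = \sum_((N %/ p).+1 <= x < N.+1) \sum_(1 <= y < N.+1) (~~ (p %| y)%N)%:R *
  sieved_term ps x y.
  rewrite /t /W (@big_cat_nat _ _ _ (N %/ p).+1 1 N.+1)//=; last by rewrite ltnS leq_div.
  by rewrite [X in X - _]addrC addrK.
have t0 : 0 <= t.
  by rewrite tE; do 2 (apply: sumr_ge0 => ? _); rewrite mulr_ge0// sieved_term_ge0.
have tail : \sum_((N %/ p).+1 <= x < N.+1) (x%:R ^+ 2)^-1 <= 2 * (p%:R / N.+1%:R) :> R.
  apply: le_trans (ler_wpM2l _ (@floor_bound R N p p0)) => //.
  have [->|Y0] := posnP (N %/ p)%N.
    by rewrite invr1 mulr1; exact: harm2_le2.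
  apply: le_trans (@tail_sq R _ N Y0 (leq_div _ _)) _.
  apply: (@le_trans _ _ ((N %/ p)%:R^-1)); first by rewrite gerBl invr_ge0.
  rewrite ler_pdivlMr ?ltr0n// ler_pdivrMl ?ltr0n// -natrM ler_nat; lia.
have tle : t <= 4 * (p%:R / N.+1%:R).
  have -> : 4 * (p%:R / N.+1%:R) = 2 * (p%:R / N.+1%:R) * 2 :> R by ring.
  apply: (@le_trans _ _ (\sum_((N %/ p).+1 <= x < N.+1) (x%:R ^+ 2)^-1 * harm2 R N)).
    rewrite tE; apply: ler_sum => x _; rewrite /harm2 mulr_sumr; apply: ler_sum => y _.
    apply: le_trans (sieved_term_le ps x y); rewrite ler_piMl ?sieved_term_ge0//.
    by case: (~~ _).
  rewrite -mulr_suml; apply: ler_pM; rewrite ?harm2_ge0 ?harm2_le2//.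
  by apply: sumr_ge0 => x _; rewrite invr_ge0 exprn_ge0.
have p2R : 0 < p%:R ^+ 2 :> R by rewrite exprn_gt0//; lra.
have Peq : p%:R ^+ 2 * P = sieved_sq_sum (p :: ps) N + P - t.
  rewrite {1}PW mulrA divff ?gt_eqF// mul1r /t -WN; ring.
have -> : sieved_sq_sum (p :: ps) N - rho p * sieved_sq_sum ps N = 2 * t / (p%:R ^+ 2 + 1).
  have Z'E : sieved_sq_sum (p :: ps) N = p%:R ^+ 2 * P - P + t by rewrite Peq; ring.
  rewrite Zsplit Z'E /rho; field; rewrite gt_eqF//; lra.
have d0 : 0 < p%:R ^+ 2 + 1 :> R by lra.
rewrite ger0_norm; last by rewrite divr_ge0 ?mulr_ge0// ltW.
rewrite ler_pdivrMr//.
apply: (@le_trans _ _ (2 * (4 * (p%:R / N.+1%:R)))); first by rewrite ler_wpM2l.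
have -> : 2 * (4 * (p%:R / N.+1%:R)) = 4 / N.+1%:R * (2 * p%:R) :> R by ring.
rewrite ler_wpM2l ?divr_ge0//; nra.
Qed.

Lemma sieved_sq_sum_asymp ps N : uniq ps -> all prime ps -> (0 < N)%N ->
  `|sieved_sq_sum ps N - 5 / 2 * \prod_(p <- ps) rho p| <=
     4 * harm R N / N%:R + (size ps)%:R * (4 / N.+1%:R).
Proof.
move=> + + N0; elim: ps => [|p ps IH] => [_ _|/=/andP[pps ups] /andP[pp aps]].
  rewrite big_nil mulr1 mul0r addr0.
  have -> : sieved_sq_sum [::] N = coprime_sq_sum N.
    by apply: eq_bigr => x _; apply: eq_bigr => y _; rewrite /sieved_term andbT.
  exact: coprime_sq_sum_asymp.
rewrite big_cons.
have -> : sieved_sq_sum (p :: ps) N - 5 / 2 * (rho p * \prod_(q <- ps) rho q) =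
  (sieved_sq_sum (p :: ps) N - rho p * sieved_sq_sum ps N) + rho p * (sieved_sq_sum ps N - 5 /
    2 * \prod_(q <- ps) rho q) by ring.
apply: le_trans (ler_normD _ _) _.
have h1 := sieved_sq_sum_step N pp aps pps; have h2 := IH ups aps.
case/andP: (rho_itv pp) => r0 r1.
rewrite normrM (ger0_norm r0).
have -> : (size (p :: ps))%:R * (4 / N.+1%:R) = (size ps)%:R * (4 / N.+1%:R) + 4 / N.+1%:R :> R.
  by rewrite /= -(natr1 (size ps)) mulrDl mul1r.
have h3 : rho p * `|sieved_sq_sum ps N - 5 / 2 * \prod_(q <- ps) rho q| <=
    `|sieved_sq_sum ps N - 5 / 2 * \prod_(q <- ps) rho q| by rewrite ler_piMl.
have h4 := le_trans h3 h2.
apply: le_trans (lerD h1 h4) _.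
by rewrite [leLHS]addrC addrA.
Qed.
End Zagier.

(** * Equidistribution of units and the local factors *)

(** Add to u a multiple of e by the product of the primes of n that do not divide u: a prime of
n then divides exactly one of the two terms. *)
Lemma lift_unit n u e : (0 < n)%N -> coprime u e ->
  exists2 u', coprime u' n & u' = u %[mod e].
Proof.
move=> n0 ue; pose m := (\prod_(p <- primes n | ~~ (p %| u)) p)%N.
exists (u + m * e)%N; last by rewrite addnC modnMDl.
rewrite coprime_all_primes//; apply/allP => p pn.
have pp : prime p by move: pn; rewrite mem_primes => /and3P[].
have [pu|pu] := boolP (p %| u)%N.
  rewrite dvdn_addr// Euclid_dvdM// negb_or; apply/andP; split.
    rewrite /m Euclid_dvd_prod// big_has_cond; apply/hasPn => q qn.
    rewrite negb_and negbK; case: (boolP (q %| u)%N) => //= qu.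
    have pq : prime q by move: qn; rewrite mem_primes => /and3P[].
    by rewrite dvdn_prime2//; apply/eqP => e'; move: qu; rewrite -e' pu.
  apply/negP => pe; have : (p %| gcdn u e)%N by rewrite dvdn_gcd pu.
  by rewrite (eqP ue) dvdn1 => /eqP p1; move: pp; rewrite p1.
have pm : (p %| m)%N.
  by rewrite /m big_mkcond (bigD1_seq p pn (primes_uniq n)) /= pu dvdn_mulr.
by rewrite dvdn_addl// dvdn_mulr.
Qed.

Section Local.
Variable R : realType.

Section CountUnits.
Variables (n e : nat).
Hypotheses (n0 : (0 < n)%N) (en : (e %| n)%N).

Let e0 : (0 < e)%N := dvdn_gt0 n0 en.

Definition class_count : R := \sum_(0 <= h < n) (coprime h n)%:R * (h == 1 %[mod e])%:R.

Lemma eqmod_dvd x y : x = y %[mod n] -> x = y %[mod e].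
Proof. by move=> xy; rewrite -(modn_dvdm x en) xy modn_dvdm. Qed.

(** Multiplying h by u turns the class of 1 into the class of u. *)
Lemma count_class u : coprime u n ->
  \sum_(0 <= h < n) (coprime h n)%:R * (h == u %[mod e])%:R = class_count.
Proof.
move=> un; rewrite -(sum_mul_unit n0 un); last first.
  by move=> x y xy; rewrite -(coprime_modl x) xy coprime_modl (eqmod_dvd xy).
apply: eq_bigr => h _; rewrite coprimeMl un -[X in _ == X %[mod _]]muln1 eqmod_mull//.
exact: coprime_dvdr en un.
Qed.

Lemma sum_units k : (0 < k)%N -> \sum_(0 <= h < k) (coprime h k)%:R = (totient k)%:R :> R.
Proof.
move=> k0; rewrite totient_count_coprime natr_sum; apply: eq_bigr => h _.
by rewrite coprime_sym.
Qed.

(** All the unit classes modulo e are hit equally often by the phi(n) units. *)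
Lemma class_countE : class_count = (totient n)%:R / (totient e)%:R.
Proof.
have te : (0 : R) < (totient e)%:R by rewrite ltr0n totient_gt0.
apply: (canRL (mulfK (lt0r_neq0 te))).
rewrite -(sum_units n0) -(sum_units e0) mulr_sumr.
transitivity (\sum_(0 <= j < e) \sum_(0 <= h < n) (coprime j e)%:R * ((coprime h n)%:R * (h ==
  j %[mod e])%:R) : R).
  apply: eq_bigr => j _; rewrite -mulr_sumr.
  have [je|_] := boolP (coprime j e); last by rewrite mul0r mulr0.
  have [u un uj] := lift_unit n0 je.
  rewrite mulr1 mul1r -(count_class un); apply: eq_bigr => h _.
  by rewrite uj.
rewrite exchange_big; apply: eq_bigr => h _ /=.
have [hn|_] := boolP (coprime h n); last first.
  by rewrite big1// => j _; rewrite mul0r mulr0.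
rewrite (eq_bigr (fun j => (j == h %[mod e])%:R * (coprime j e)%:R)); last first.
  by move=> j _; rewrite mul1r mulrC eq_sym.
rewrite sum_mod_dirac// coprime_modl.
by rewrite (coprime_dvdr en hn).
Qed.

(** If xy is prime to e, multiplying h by units that lift x and y reduces the congruence to h =
1. Otherwise a common prime of e and xy would have to divide both x and y. *)
Lemma count_units_cong x y : coprime x y ->
  \sum_(0 <= h < n) (coprime h n)%:R * (e %| absdiff (h * x) y)%:R =
  (coprime (x * y) e)%:R * ((totient n)%:R / (totient e)%:R) :> R.
Proof.
move=> cxy; rewrite -class_countE.
have [cxye|ncxye] := boolP (coprime (x * y) e); last first.
  rewrite mul0r big1_seq// => h _.
  have [hn|_] := boolP (coprime h n); last by rewrite mul0r.
  rewrite -absdiff_mod; case: eqP => [hxy|_]; last by rewrite mulr0.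
  case/negP: ncxye; have he : coprime h e := coprime_dvdr en hn.
  have key d : (d %| e)%N -> (d %| x)%N = (d %| y)%N.
    move=> de; have hd : coprime d h by rewrite coprime_sym (coprime_dvdr de).
    rewrite -(Gauss_dvdr x hd) /dvdn -(modn_dvdm (h * x) de) hxy modn_dvdm//.
  rewrite coprimeMl; apply/andP; split.
    rewrite /coprime -dvdn1 -(eqP cxy) dvdn_gcd dvdn_gcdl/= -key ?dvdn_gcdr//.
    exact: dvdn_gcdl.
  rewrite /coprime -dvdn1 -(eqP cxy) dvdn_gcd dvdn_gcdl/= key ?dvdn_gcdr//.
  by rewrite dvdn_gcdl.
rewrite mul1r; move: cxye; rewrite coprimeMl => /andP[xe ye].
have [x' xn xx'] := lift_unit n0 xe; have [y' yn yy'] := lift_unit n0 ye.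
rewrite -(count_class yn).
rewrite -(sum_mul_unit (F := fun h => (coprime h n)%:R * (h == y' %[mod e])%:R) n0 xn); last first.
  by move=> a b ab; rewrite -(coprime_modl a) ab coprime_modl (eqmod_dvd ab).
apply: eq_bigr => h _; rewrite coprimeMl xn -absdiff_mod yy'.
by rewrite -[in RHS]modnMml xx' modnMml [(x * h)%N]mulnC.
Qed.
End CountUnits.

(** The contribution of p to the square of ray_limit, if p^a is the exact power in n and p^i
the exact power in gcd(n, hx - y). *)
Definition local_sq (p a i : nat) : R :=
  if (a <= i)%N then (1 - p%:R^-1) ^+ 2 else (p%:R ^+ (4 * (a - i)))^-1 * (1 - p%:R) ^+ 2.

(** Increments of local_sq in i: local_sq becomes a combination of the conditions p^k | hx - y,
whose frequencies are known. *)
Definition local_step (p a k : nat) : R :=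
  if k is k'.+1 then local_sq p a k'.+1 - local_sq p a k' else local_sq p a 0.

Lemma local_step_sum p a m : \sum_(0 <= k < m.+1) local_step p a k = local_sq p a m.
Proof.
elim: m => [|m IH]; first by rewrite big_nat1.
by rewrite big_nat_recr//= IH addrC subrK.
Qed.

Lemma local_sq_nd p a i : prime p -> (i < a)%N -> local_sq p a i <= local_sq p a i.+1.
Proof.
move=> pp ia; have p1 : (1 : R) <= p%:R by rewrite ler1n prime_gt0.
have p0 : (0 : R) < p%:R by lra.
rewrite /local_sq (leqNgt a i) ia /=; case: leqP => ai.
  have -> : (a - i)%N = 1%N by lia.
  rewrite muln1; have -> : (1 - p%:R^-1) ^+ 2 = p%:R ^- 2 * (1 - p%:R) ^+ 2 :> R by field;
    rewrite gt_eqF.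
  rewrite ler_wpM2r ?sqr_ge0// lef_pV2 ?posrE ?exprn_gt0//.
  by rewrite ler_weXn2l.
rewrite ler_wpM2r ?sqr_ge0// lef_pV2 ?posrE ?exprn_gt0// ler_weXn2l//.
lia.
Qed.

Lemma local_step_ge0 p a k : prime p -> (k <= a)%N -> 0 <= local_step p a k.
Proof.
move=> pp; case: k => [_|k ka]; last by rewrite /local_step subr_ge0 local_sq_nd.
rewrite /local_step /local_sq; case: ifP => _; first exact: sqr_ge0.
by rewrite mulr_ge0 ?sqr_ge0// invr_ge0 exprn_ge0.
Qed.

(** The mean of the contribution of p over h and (x, y). The condition p^k | hx - y holds for a
proportion 1/phi(p^k) of the units, and for k > 0 only when p is prime to xy. *)
Definition local_factor (p a : nat) : R := \sum_(0 <= k < a.+1)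
   local_step p a k * ((if k is 0%N then 1 else rho R p) / (totient (p ^ k))%:R).

(** The factor that propagates the error term: local_factor without the densities rho. *)
Definition local_mass (p a : nat) : R :=
  \sum_(0 <= k < a.+1) local_step p a k / (totient (p ^ k))%:R.

(** The terms with 0 < k < a form a geometric progression of ratio p^3; k = 0 and k = a are
added by hand. *)
Lemma local_factorE p a : prime p -> (0 < a)%N ->
  local_factor p a = Cfactor R p a * (1 - p%:R^-1) ^+ 2 / p%:R ^+ a.
Proof.
move=> pp; case: a => // a _.
have p1 : (2 : R) <= p%:R by rewrite ler_nat prime_gt1.
have p0 : (p%:R : R) != 0 by rewrite gt_eqF//; lra.
have pm1 : (p%:R - 1 : R) != 0 by rewrite subr_eq0 gt_eqF//; lra.
have pp1 : (p%:R ^+ 2 + 1 : R) != 0 by rewrite gt_eqF//; have := sqr_ge0 (p%:R : R) => h; lra.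
have pq : (p%:R ^+ 2 + p%:R + 1 : R) != 0.
  by rewrite gt_eqF//; have := sqr_ge0 (p%:R : R) => h; lra.
have p3 : (p%:R ^+ 3 - 1 : R) != 0.
  have -> : p%:R ^+ 3 - 1 = (p%:R - 1) * (p%:R ^+ 2 + p%:R + 1) :> R by ring.
  by rewrite mulf_neq0.
have tot k : (totient (p ^ k.+1))%:R = (p%:R - 1) * p%:R ^+ k :> R.
  rewrite totient_pfactor// natrM natrX; congr (_ * _).
  by rewrite -subn1 natrB ?prime_gt0.
have part m : (m <= a)%N -> \sum_(0 <= k < m.+1)
   local_step p a.+1 k * ((if k is 0%N then 1 else rho R p) / (totient (p ^ k))%:R) =
   (p%:R - 1) ^+ 2 / p%:R ^+ (4 * a.+1) + rho R p * (p%:R - 1) * (p%:R ^+ 4 - 1) / p%:R ^+ (4 *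
     a.+1) *
     ((p%:R ^+ (3 * m) - 1) / (p%:R ^+ 3 - 1)).
  elim: m => [_|m IH ma].
    rewrite big_nat1 muln0 expr0 subrr mul0r mulr0 addr0 /local_step /local_sq /= expn0 (_ :
      totient 1 = 1%N)//.
    by rewrite subn0 divr1 mulr1; ring.
  rewrite big_nat_recr//= IH; last by lia.
  rewrite tot /local_sq.
  have -> : (a.+1 <= m.+1)%N = false by lia. have -> : (a.+1 <= m)%N = false by lia.
  set v : R := p%:R ^+ (4 * (a.+1 - m.+1)); set u : R := p%:R ^+ m.
  have -> : p%:R ^+ (4 * (a.+1 - m)) = v * p%:R ^+ 4 :> R.
    by rewrite /v -exprD; congr (_ ^+ _); lia.
  have -> : p%:R ^+ (4 * a.+1) = v * u ^+ 4 * p%:R ^+ 4 :> R.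
    by rewrite /v /u -exprM -!exprD; congr (_ ^+ _); lia.
  have -> : p%:R ^+ (3 * m.+1) = u ^+ 3 * p%:R ^+ 3 :> R.
    by rewrite /u -exprM -!exprD; congr (_ ^+ _); lia.
  have -> : p%:R ^+ (3 * m) = u ^+ 3 :> R.
    by rewrite /u -exprM; congr (_ ^+ _); lia.
  have v0 : v != 0 by rewrite /v expf_neq0.
  have u0 : u != 0 by rewrite /u expf_neq0.
  move: v u v0 u0 p0 pm1 p3; move: (rho R p) (p%:R : R) => w q v u v0 u0 p0 pm1 p3.
  by field; rewrite p0 u0 v0 p3 pm1.
rewrite /local_factor big_nat_recr//= part// tot /local_sq leqnn ltnn /Cfactor /=.
have -> : (a.+1 - a = 1)%N by lia.
set u : R := p%:R ^+ a.
have -> : p%:R ^+ (4 * a.+1) = u ^+ 4 * p%:R ^+ 4 :> R.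
  by rewrite /u -exprM -!exprD; congr (_ ^+ _); lia.
have -> : p%:R ^+ (3 * a) = u ^+ 3 :> R.
  by rewrite /u -exprM; congr (_ ^+ _); lia.
rewrite muln1 [p%:R ^+ a.+1]exprS -/u /rho.
have u0 : u != 0 by rewrite /u expf_neq0.
move: u u0 p0 pm1 pp1 pq p3; move: (p%:R : R) => q u u0 p0 pm1 pp1 pq p3.
by field; rewrite p0 pp1 pq p3 pm1 u0.
Qed.
End Local.

(** * Assembling the Euler product *)

(** The factorisation of r indexed by the primes of a multiple n of r, so that it can be
multiplied with products over the primes of n. *)
Lemma prod_primes_logn n r : (0 < n)%N -> (r %| n)%N ->
  r = (\prod_(p <- primes n) p ^ logn p r)%N.
Proof.
move=> n0 rn; have r0 := dvdn_gt0 n0 rn.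
rewrite {1}(prod_prime_decomp r0) prime_decompE big_map /=.
rewrite [RHS](bigID (fun p => p %| r)%N)/= [X in (_ * X)%N]big1_seq ?muln1; last first.
  move=> p /andP[pr pn]; have -> : logn p r = 0%N.
    by apply/eqP; rewrite -leqn0 leqNgt logn_gt0 mem_primes (negPf pr) !andbF.
  by rewrite expn0.
rewrite -[RHS]big_filter; apply: perm_big; apply: uniq_perm; rewrite ?filter_uniq ?primes_uniq//.
move=> p; rewrite mem_filter !mem_primes n0 r0 /=.
apply/andP/and3P => [[pp pr]|[pr pp _]] //; split=> //.
exact: dvdn_trans rn.
Qed.

Section Bsum.
Variable R : realType.

Lemma local_expand n q : (0 < n)%N -> (q %| n)%N ->
  ((n %/ q)%:R ^+ 2)^-1 ^+ 2 * sieve_factor R (primes n) (n %/ q) ^+ 2 =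
  \prod_(p <- primes n) local_sq R p (logn p n) (logn p q).
Proof.
move=> n0 qn; have q0 := dvdn_gt0 n0 qn; set r := (n %/ q)%N.
have rn : (r %| n)%N by apply/dvdnP; exists q; rewrite mulnC divnK.
have r0 := dvdn_gt0 n0 rn.
have -> : (r%:R ^+ 2)^-1 ^+ 2 = \prod_(p <- primes n) (p%:R ^+ (4 * logn p r))^-1 :> R.
  rewrite exprVn -exprM prodfV; congr (_^-1).
  rewrite [in LHS](prod_primes_logn n0 rn) natr_prod -prodrXl; apply: eq_bigr => p _.
  by rewrite natrX -exprM mulnC.
rewrite /sieve_factor -prodrXl -big_split /= big_seq [RHS]big_seq; apply: eq_bigr => p.
move=> pn; have pp : prime p by move: pn; rewrite mem_primes => /and3P[].
have lr : logn p r = (logn p n - logn p q)%N by rewrite /r logn_div.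
have le : (logn p q <= logn p n)%N by apply: dvdn_leq_log.
have pr : (p %| r)%N = (logn p q < logn p n)%N.
  have -> : (p %| r)%N = (0 < logn p r)%N by rewrite logn_gt0 mem_primes pp r0.
  by rewrite lr subn_gt0.
rewrite pr lr /local_sq; case: (leqP (logn p n) (logn p q)) => h //.
have -> : (logn p n - logn p q = 0)%N by lia.
by rewrite muln0 expr0 invr1 mul1r.
Qed.

(** The powers p^k that divide d are those that divide gcd(n, d), so the sum telescopes. *)
Lemma local_step_indicator n p d : (0 < n)%N -> prime p ->
  \sum_(0 <= k < (logn p n).+1) local_step R p (logn p n) k * (p ^ k %| d)%N%:R =
  local_sq R p (logn p n) (logn p (gcdn n d)).
Proof.
move=> n0 pp; set a := logn p n; set v := logn p (gcdn n d).
have g0 : (0 < gcdn n d)%N by rewrite gcdn_gt0 n0.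
have va : (v <= a)%N by apply: dvdn_leq_log; rewrite ?dvdn_gcdl.
have key k : (k <= a)%N -> (p ^ k %| d)%N = (k <= v)%N.
  move=> ka; have -> : (p ^ k %| d)%N = (p ^ k %| gcdn n d)%N.
    by rewrite dvdn_gcd (pfactor_dvdn _ pp n0) ka.
  by rewrite (pfactor_dvdn _ pp g0).
rewrite (@big_cat_nat _ _ _ v.+1)//= [X in _ + X]big1_seq ?addr0; last first.
  move=> k; rewrite mem_index_iota ltnS => /= /andP[vk ka].
  by rewrite key// leqNgt vk mulr0.
rewrite -local_step_sum big_seq [RHS]big_seq; apply: eq_bigr => k.
rewrite mem_index_iota ltnS => /andP[_ kv].
by rewrite key ?kv ?mulr1// (leq_trans kv).
Qed.

Lemma prod_p_logn n : (0 < n)%N ->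
  \prod_(p <- primes n) p%:R ^+ logn p n = n%:R :> R.
Proof.
move=> n0; rewrite [in RHS](prod_primes_logn n0 (dvdnn n)) natr_prod.
by apply: eq_bigr => p _; rewrite natrX.
Qed.

Lemma totient_prod n : (0 < n)%N ->
  (totient n)%:R = n%:R * \prod_(p <- primes n) (1 - p%:R^-1) :> R.
Proof.
move=> n0; rewrite totientE// natr_prod -[in RHS](prod_p_logn n0) -big_split /= big_seq
  [RHS]big_seq.
apply: eq_bigr => p pn.
have a0 : (0 < logn p n)%N by rewrite logn_gt0.
have pp : prime p by move: pn; rewrite mem_primes => /and3P[].
have pz : (p%:R : R) != 0 by rewrite pnatr_eq0 -lt0n prime_gt0.
rewrite natrM natrX -subn1 natrB ?prime_gt0//.
by case: (logn p n) a0 => // a _ /=; rewrite exprS; field.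
Qed.

Lemma Cfactor_le2 p a : prime p -> 1 <= Cfactor R p a <= 2.
Proof.
move=> pp; have p1 : (2 : R) <= p%:R by rewrite ler_nat prime_gt1.
rewrite /Cfactor; set q : R := p%:R in p1 *; set m := (3 * a.-1)%N.
have q1 : 1 <= q by lra.
have d1 : 0 < (q ^+ 2 + 1) * (q ^+ 2 + q + 1) by nra.
have d2 : 0 < q ^+ 2 + q + 1 by nra.
have m1 : 1 <= q ^+ m by rewrite exprn_ege1.
have m0 : 0 < q ^+ m by apply: lt_le_trans m1.
have t0 : 0 <= 1 / (q ^+ m * (q ^+ 2 + q + 1)).
  by rewrite divr_ge0// mulr_ge0// ltW.
have t1 : 1 / (q ^+ m * (q ^+ 2 + q + 1)) <= 1 / (q ^+ 2 + q + 1).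
  rewrite !div1r lef_pV2 ?posrE ?mulr_gt0//.
  by rewrite ler_peMl// ltW.
have t2 : 1 / (q ^+ 2 + q + 1) <= (2 * q ^+ 3 + q ^+ 2 - 1) / ((q ^+ 2 + 1) * (q ^+ 2 + q + 1)).
  rewrite ler_pdivrMr// -mulrAC ler_pdivlMr// mul1r.
  have : q ^+ 2 + 1 <= 2 * q ^+ 3 + q ^+ 2 - 1 by nra.
  by move=> h; rewrite ler_wpM2r// ltW.
have t3 : (2 * q ^+ 3 + q ^+ 2 - 1) / ((q ^+ 2 + 1) * (q ^+ 2 + q + 1)) <= 1.
  rewrite ler_pdivrMr// mul1r; nra.
by apply/andP; split; lra.
Qed.

(** Compared with local_factor through rho >= 3/5, as local_step is nonnegative. *)
Lemma local_mass_le p a : prime p -> (0 < a)%N -> 0 <= local_mass R p a <= 4 / p%:R ^+ a.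
Proof.
move=> pp a0; have p1 : (2 : R) <= p%:R by rewrite ler_nat prime_gt1.
have pa0 : (0 : R) < p%:R ^+ a by rewrite exprn_gt0//; lra.
have gk k : (k \in index_iota 0 a.+1) -> 0 <= local_step R p a k / (totient (p ^ k))%:R.
  by rewrite mem_index_iota ltnS => /andP[_ ka]; rewrite divr_ge0// local_step_ge0.
apply/andP; split; first by rewrite /local_mass big_seq; apply: sumr_ge0.
have r0 : 3 / 5 <= rho R p.
  rewrite /rho; have : 4 <= p%:R ^+ 2 :> R by nra.
  by move=> h; rewrite ler_pdivlMr; lra.
have r1 : rho R p <= 1 by case/andP: (rho_itv R pp).
have XY : 3 / 5 * local_mass R p a <= local_factor R p a.
  rewrite /local_mass /local_factor mulr_sumr big_seq [leRHS]big_seq; apply: ler_sum => k kI.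
  rewrite [leRHS]mulrCA; apply: ler_wpM2r; first exact: gk.
  by case: k {kI} => //; lra.
have [C1 C2] := andP (Cfactor_le2 a pp).
have X2 : local_factor R p a <= 2 / p%:R ^+ a.
  rewrite local_factorE// ler_wpM2r ?invr_ge0 ?(ltW pa0)//.
  have i0 : 0 <= p%:R^-1 :> R by rewrite invr_ge0.
  have i1 : p%:R^-1 <= 1 :> R by rewrite invf_le1; lra.
  apply: (@le_trans _ _ (Cfactor R p a * 1)); last by rewrite mulr1.
  rewrite ler_wpM2l//; first by lra.
  by move: (p%:R^-1) i0 i1 => i i0 i1; nra.
have : 2 / p%:R ^+ a <= 3 / 5 * (4 / p%:R ^+ a) :> R.
  by rewrite mulrA ler_wpM2r ?invr_ge0 ?(ltW pa0)//; lra.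
by move=> h; have := le_trans XY (le_trans X2 h); rewrite ler_pM2l//; lra.
Qed.

Variables (n : nat) (T : R).
Hypotheses (no : odd n) (n2 : (1 < n)%N) (T1 : 1 <= T)
  (hT : forall u, (0 < u <= n * n)%N -> (size (divisors u))%:R <= T)
  (hH : harm R (n * n) <= T).

Let N := n./2.
Let n0 : (0 < n)%N. Proof. by case: n no. Qed.
Let T0 : 0 <= T. Proof. by apply: le_trans T1. Qed.

(** The sum over h and (x, y) with the primes of ps still carrying their full weight, while for
the other primes one condition e | hx - y has been fixed. *)
Definition layer_sum (e : nat) (ps : seq nat) : R :=
  \sum_(1 <= x < N.+1) \sum_(1 <= y < N.+1) (coprime x y)%:R / (x%:R * y%:R) ^+ 2 *
   \sum_(0 <= h < n) (coprime h n)%:R * ((e %| absdiff (h * x) y)%:R *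
     \prod_(p <- ps) \sum_(0 <= k < (logn p n).+1)
        local_step R p (logn p n) k * (p ^ k %| absdiff (h * x) y)%N%:R).

(** A bound, valid for all the divisors of n, for the error in the sum of 1/(xy)^2 over coprime
pairs prime to a divisor. *)
Definition layer_err : R := 4 * harm R N / N%:R + T * (4 / N.+1%:R).

Lemma layer_err_ge0 : 0 <= layer_err.
Proof.
have h := harm_ge0 R N; rewrite /layer_err addr_ge0//.
  by rewrite divr_ge0// mulr_ge0.
by rewrite mulr_ge0// divr_ge0.
Qed.

Lemma layer_sum_nil e : (e %| n)%N ->
  `|layer_sum e [::] - (totient n)%:R / (totient e)%:R * (5 / 2 * \prod_(p <- primes e) rho R p)| <=
  (totient n)%:R / (totient e)%:R * layer_err.
Proof.
move=> en; have e0 := dvdn_gt0 n0 en.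
have -> : layer_sum e [::] = (totient n)%:R / (totient e)%:R * sieved_sq_sum R (primes e) N.
  rewrite /layer_sum /sieved_sq_sum mulr_sumr; apply: eq_bigr => x _; rewrite mulr_sumr; apply:
    eq_bigr => y _.
  under eq_bigr do rewrite big_nil mulr1.
  rewrite /sieved_term -coprime_all_primes//; have [cxy|_] := boolP (coprime x y); last first.
    by rewrite !mul0r mulr0.
  by rewrite count_units_cong//= mul1r; ring.
rewrite -mulrBr normrM ger0_norm ?divr_ge0// ler_wpM2l ?divr_ge0//.
have N0 : (0 < N)%N by rewrite /N; lia.
apply: le_trans (sieved_sq_sum_asymp R (primes_uniq e) (all_prime_primes e) N0) _.
rewrite /layer_err lerD2l ler_wpM2r ?divr_ge0//.
apply: le_trans (hT (u := e) _); last by rewrite e0 (leq_trans (dvdn_leq n0 en))// leq_pmulr.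
rewrite ler_nat; apply: leq_trans (exp2_omega e0).
by apply: ltnW; apply: ltn_expl.
Qed.

(** Expanding the weight of p over the powers p^k: the conditions for the coprime moduli e and
p^k combine into one for their product. *)
Lemma layer_sum_cons e p ps : (0 < e)%N -> prime p -> coprime e p ->
  layer_sum e (p :: ps) = \sum_(0 <= k < (logn p n).+1) local_step R p (logn p n) k * layer_sum
    (e * p ^ k)%N ps.
Proof.
move=> e0 pp cep; rewrite /layer_sum.
under [RHS]eq_bigr do rewrite mulr_sumr.
rewrite [RHS]exchange_big; apply: eq_bigr => x _ /=.
under [RHS]eq_bigr do rewrite mulr_sumr.
rewrite [RHS]exchange_big; apply: eq_bigr => y _ /=.
under [RHS]eq_bigr do rewrite mulrCA.
rewrite -mulr_sumr; congr (_ * _).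
under [RHS]eq_bigr do rewrite mulr_sumr.
rewrite [RHS]exchange_big; apply: eq_bigr => h _ /=.
under [RHS]eq_bigr do rewrite mulrCA.
rewrite -mulr_sumr; congr (_ * _).
rewrite big_cons mulr_suml mulr_sumr; apply: eq_bigr => k _.
rewrite Gauss_dvd; last by rewrite coprimeXr.
by rewrite -mulnb natrM; ring.
Qed.

(** By induction on ps, from the count of the units and the asymptotics of the sums over
coprime pairs. Since local_step is nonnegative, the error goes through the same recursion as
the main term. *)
Lemma layer_sum_asymp ps e : uniq ps -> all prime ps ->
  (e * \prod_(p <- ps) p ^ logn p n %| n)%N -> all (coprime e) ps ->
  `|layer_sum e ps - (totient n)%:R / (totient e)%:R * (5 / 2 * \prod_(p <- primes e) rho R p)
      * \prod_(p <- ps) local_factor R p (logn p n)| <=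
  (totient n)%:R / (totient e)%:R * layer_err * \prod_(p <- ps) local_mass R p (logn p n).
Proof.
elim: ps e => [|p ps IH] e.
  rewrite big_nil muln1 !big_nil !mulr1 => _ _ en _; exact: layer_sum_nil.
move=> /andP[pps ups] /andP[pp aps]; rewrite big_cons => en /andP[cep ce].
have e0 : (0 < e)%N.
  have := dvdn_gt0 n0 en; by rewrite muln_gt0 => /andP[].
have p0 := prime_gt0 pp.
have tp k : (0 : R) < (totient (p ^ k))%:R by rewrite ltr0n totient_gt0 expn_gt0 p0.
have te : (0 : R) < (totient e)%:R by rewrite ltr0n totient_gt0.
have pne : ~~ (p %| e)%N by rewrite -prime_coprime// coprime_sym.
rewrite layer_sum_cons// [\prod_(q <- p :: ps) local_factor _ _ _]big_cons [\prod_(q <- p ::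
  ps) local_mass _ _ _]big_cons {1}/local_factor {1}/local_mass.
set a := logn p n.
have distr (M P : R) (g : nat -> R) : M * ((\sum_(0 <= k < a.+1) g k) * P) =
    \sum_(0 <= k < a.+1) M * g k * P.
  by rewrite mulr_suml mulr_sumr; apply: eq_bigr => k _; rewrite mulrA.
rewrite !distr -sumrB.
apply: le_trans (ler_norm_sum _ _ _) _.
rewrite [leLHS]big_seq [leRHS]big_seq; apply: ler_sum => k; rewrite mem_index_iota ltnS =>
  /andP[_ ka].
have g0 := local_step_ge0 R pp ka.
have tE : (totient (e * p ^ k))%:R = (totient e)%:R * (totient (p ^ k))%:R :> R.
  by rewrite totient_coprime ?natrM// coprimeXr.
have enk : (e * p ^ k * \prod_(q <- ps) q ^ logn q n %| n)%N.
  by apply: dvdn_trans en; rewrite -mulnA dvdn_mul// dvdn_mul// dvdn_exp2l.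
have cek : all (coprime (e * p ^ k)) ps.
  apply/allP => q qps; rewrite coprimeMl (allP ce _ qps) coprimeXl// prime_coprime//.
  rewrite dvdn_prime2 ?(allP aps _ qps)//; apply/eqP => e'.
  by move: pps; rewrite e' qps.
have := ler_wpM2l g0 (IH (e * p ^ k)%N ups aps enk cek).
rewrite -{1}(ger0_norm g0) -normrM tE.
have -> : \prod_(q <- primes (e * p ^ k)) rho R q =
   (if k is 0%N then 1 else rho R p) * \prod_(q <- primes e) rho R q.
  case: k {g0 tE enk cek} ka => [_|k ka]; first by rewrite expn0 muln1 mul1r.
  by rewrite mulnC (perm_big _ (primesX_perm pp _ e0 pne)) //= big_cons.
set c := (if k is 0%N then _ else _).
set P1 := \prod_(q <- primes e) _; set P2 := \prod_(q <- ps) _; set P3 := \prod_(q <- ps) _.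
have te' := lt0r_neq0 te; have tp' := lt0r_neq0 (tp k).
have -> : local_step R p a k * (layer_sum (e * p ^ k) ps - (totient n)%:R / ((totient e)%:R *
  (totient (p ^ k))%:R) * (5 / 2 * (c * P1)) * P2) =
  local_step R p a k * layer_sum (e * p ^ k) ps - (totient n)%:R / (totient e)%:R * (5 / 2 *
    P1) * (local_step R p a k * (c / (totient (p ^ k))%:R)) * P2.
  by field; rewrite te' tp'.
move=> h; apply: le_trans h _; rewrite le_eqVlt; apply/orP; left; apply/eqP.
by field; rewrite te' tp'.
Qed.

Lemma prod_local_mass_le : 0 <= \prod_(p <- primes n) local_mass R p (logn p n) <= T ^+ 2 / n%:R.
Proof.
have pl p : p \in primes n -> prime p && (0 < logn p n)%N.
  by rewrite logn_gt0 => pn; rewrite pn andbT; move: pn; rewrite mem_primes => /and3P[].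
have Y0 p : p \in primes n -> 0 <= local_mass R p (logn p n) <= 4 / p%:R ^+ logn p n.
  by move=> /pl/andP[pp a0]; exact: local_mass_le.
apply/andP; split.
  by rewrite big_seq; apply: prodr_ge0 => p /Y0/andP[].
apply: (@le_trans _ _ (\prod_(p <- primes n) (4 / p%:R ^+ logn p n))).
  by rewrite big_seq [leRHS]big_seq; apply: ler_prod.
rewrite big_split /= prodfV (prod_p_logn n0) ler_wpM2r ?invr_ge0//.
have -> : \prod_(p <- primes n) 4 = (2 ^ size (primes n))%:R ^+ 2 :> R.
  by rewrite exp2_size -prodrXl; apply: eq_bigr => p _; rewrite -natrX.
have le : (2 ^ size (primes n))%:R <= T.
  apply: le_trans (hT (u := n) _); last by rewrite n0 leq_pmulr.
  by rewrite ler_nat exp2_omega.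
by rewrite lerXn2r ?nnegrE.
Qed.

Lemma prod_local_factor : \prod_(p <- primes n) local_factor R p (logn p n) =
  C R n * ((totient n)%:R / n%:R) ^+ 2 / n%:R.
Proof.
have nz : (n%:R : R) != 0 by rewrite pnatr_eq0 -lt0n.
have -> : (totient n)%:R / n%:R = \prod_(p <- primes n) (1 - p%:R^-1) :> R.
  by rewrite totient_prod//; field.
rewrite /C -[X in _ / X](prod_p_logn n0) -prodrXl -prodfV -!big_split /= big_seq [RHS]big_seq.
apply: eq_bigr => p pn; apply: local_factorE; last by rewrite logn_gt0.
by move: pn; rewrite mem_primes => /and3P[].
Qed.

Lemma ray_limit_sum_asymp :
  `|\sum_(1 <= x < N.+1) \sum_(1 <= y < N.+1) (coprime x y)%:R / (x%:R * y%:R) ^+ 2 *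
      \sum_(0 <= h < n) (coprime h n)%:R * ray_limit R n h x y ^+ 2 -
    zeta2 R ^+ 2 * (5 / 2) * (C R n * (totient n)%:R ^+ 3 / n%:R ^+ 3)| <=
  9 * T ^+ 2 * layer_err.
Proof.
have -> : \sum_(1 <= x < N.+1) \sum_(1 <= y < N.+1) (coprime x y)%:R / (x%:R * y%:R) ^+ 2 *
      \sum_(0 <= h < n) (coprime h n)%:R * ray_limit R n h x y ^+ 2 = zeta2 R ^+ 2 * layer_sum
        1 (primes n).
  rewrite /layer_sum mulr_sumr; apply: eq_bigr => x _; rewrite mulr_sumr; apply: eq_bigr => y _.
  rewrite [RHS]mulrCA; congr (_ * _); rewrite mulr_sumr; apply: eq_bigr => h _.
  rewrite [RHS]mulrCA; congr (_ * _); rewrite dvd1n mul1r.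
  rewrite /ray_limit /hit_period -mulrA; move: (zeta2 R) => z.
  rewrite exprMn exprMn local_expand ?hit_gcd_dvd//; congr (_ * _).
  rewrite big_seq [RHS]big_seq; apply: eq_bigr => p pn; rewrite local_step_indicator//.
  by move: pn; rewrite mem_primes => /and3P[].
have hn : (1 * \prod_(p <- primes n) p ^ logn p n %| n)%N.
  by rewrite mul1n -(prod_primes_logn n0 (dvdnn n)).
have hc : all (coprime 1) (primes n) by apply/allP => p _; rewrite coprime1n.
have := layer_sum_asymp (primes_uniq n) (all_prime_primes n) hn hc.
rewrite (_ : primes 1 = [::])// big_nil (_ : totient 1 = 1%N)// divr1 mulr1 prod_local_factor.
have nz : (n%:R : R) != 0 by rewrite pnatr_eq0 -lt0n.
have -> : (totient n)%:R * (5 / 2) * (C R n * ((totient n)%:R / n%:R) ^+ 2 / n%:R) =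
   5 / 2 * (C R n * (totient n)%:R ^+ 3 / n%:R ^+ 3) by field.
move=> h; rewrite -mulrA -mulrBr normrM.
have [z0 z3] := andP (zeta2_le3 R).
have zz : `|zeta2 R ^+ 2| <= 9.
  rewrite ger0_norm ?sqr_ge0//; have : zeta2 R ^+ 2 <= 3 ^+ 2 by rewrite lerXn2r ?nnegrE.
  by move=> h9; lra.
rewrite -[leRHS]mulrA; apply: ler_pM => //; apply: le_trans h _.
have [Y0 Y1] := andP prod_local_mass_le.
have b0 := layer_err_ge0.
have tn : (totient n)%:R <= n%:R :> R.
  rewrite -sum_units//; apply: (@le_trans _ _ (\sum_(0 <= h < n) 1)).
    by apply: ler_sum => h _; case: coprime.
  by rewrite sumr_const_nat subn0.
apply: (@le_trans _ _ (n%:R * layer_err * (T ^+ 2 / n%:R))).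
  by apply: ler_pM; rewrite ?mulr_ge0// ler_wpM2r.
by rewrite le_eqVlt; apply/orP; left; apply/eqP; field.
Qed.
End Bsum.

(** * From products of residues to Dedekind sums *)

Section Reduction.
Variable R : realType.

(** The residues of x and y add up to n unless both vanish. *)
Lemma sawtooth_opp n x y : (n %| x + y)%N -> sawtooth R n x = - sawtooth R n y.
Proof.
move=> nxy; rewrite /sawtooth.
have e : (n %| x)%N = (n %| y)%N.
  by apply/idP/idP => h; [rewrite -(dvdn_addr _ h)|rewrite -(dvdn_addl _ h)].
rewrite e; case: (boolP (n %| y)%N) => ny; first by rewrite oppr0.
have n0 : (0 < n)%N by case: n nxy ny {e} => //; rewrite !dvd0n addn_eq0 => /andP[_ ->].
suff : (x %% n + y %% n)%N = n.
  by move=> /(congr1 (fun k => k%:R : R)); rewrite natrD => h; lra.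
have : (n %| x %% n + y %% n)%N by rewrite /dvdn modnDm.
have := ltn_pmod x n0; have := ltn_pmod y n0.
have : (0 < y %% n)%N by rewrite lt0n.
move: (x %% n)%N (y %% n)%N => r s s0 sn rn /dvdnP[k kE]; rewrite kE.
by case: k kE => [|[|k]] kE; nia.
Qed.

Variable n : nat.
Hypothesis n1 : (1 < n)%N.

Let n0 : (0 < n)%N. Proof. exact: ltnW. Qed.

Lemma sum_range1 (F : nat -> R) :
  \sum_(1 <= a < n.+1) (coprime a n)%:R * F a = \sum_(0 <= a < n) (coprime a n)%:R * F a.
Proof.
rewrite big_nat_recr//= [RHS]big_ltn//.
have -> : coprime n n = false by rewrite /coprime gcdnn; lia.
have -> : coprime 0 n = false by rewrite /coprime gcd0n; lia.
by rewrite !mul0r addr0 add0r.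
Qed.

Definition unit_saw (a : nat) : R := (coprime a n)%:R * sawtooth R n a.

Lemma sawtooth_unit a : (a < n)%N -> coprime a n -> sawtooth R n a = a%:R - n%:R / 2.
Proof.
move=> an ca; rewrite /sawtooth; case: (boolP (n %| a)%N) => [na|_]; last by rewrite modn_small.
by move: ca; rewrite /coprime gcdnC (gcdn_idPl na); lia.
Qed.

(** The congruence ub = m has exactly one solution b, and it is a unit. *)
Lemma sum_unit_dirac u m : coprime u n -> coprime m n ->
  \sum_(0 <= b < n) (coprime b n)%:R * (u * b == m %[mod n])%:R = 1 :> R.
Proof.
move=> un mn.
have h := sum_mul_unit (F := fun b => (coprime b n)%:R * (b == m %[mod n])%:R : R) n0 un.
rewrite (eq_bigr (fun b => (coprime (u * b) n)%:R * (u * b == m %[mod n])%:R)); last first.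
  by move=> b _; rewrite coprimeMl un.
rewrite h; last by move=> x y xy; rewrite -(coprime_modl x) xy coprime_modl.
under eq_bigr do rewrite mulrC.
by rewrite sum_mod_dirac// coprime_modl mn.
Qed.

(** The terms of a and -a cancel. *)
Lemma sum_unit_saw : \sum_(0 <= a < n) unit_saw a = 0.
Proof.
have un : coprime n.-1 n by rewrite coprimePn.
have := sum_mul_unit (F := unit_saw) n0 un => /(_ _)/esym h.
suff e : \sum_(0 <= a < n) unit_saw a = - \sum_(0 <= a < n) unit_saw a.
  by move: e; move: (\sum_(0 <= a < n) unit_saw a) => s e; lra.
rewrite {1}h; last first.
  by move=> x y xy; rewrite /unit_saw -(coprime_modl x) xy coprime_modl (sawtooth_mod R xy).
rewrite -sumrN; apply: eq_bigr => a _; rewrite /unit_saw coprimeMl un /= -mulrN; congr (_ * _).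
by apply: sawtooth_opp; rewrite -mulSnr prednK// dvdn_mulr.
Qed.

Lemma sum_unit_id : \sum_(0 <= a < n) (coprime a n)%:R * a%:R = n%:R * (totient n)%:R / 2 :> R.
Proof.
have := sum_unit_saw.
have -> : \sum_(0 <= a < n) unit_saw a = \sum_(0 <= a < n) (coprime a n)%:R * a%:R -
   n%:R / 2 * \sum_(0 <= a < n) (coprime a n)%:R.
  rewrite mulr_sumr -sumrB big_seq [RHS]big_seq; apply: eq_bigr => a.
  rewrite mem_index_iota => /andP[_ an]; rewrite /unit_saw.
  have [ca|_] := boolP (coprime a n); last by rewrite !mul0r mulr0 subr0.
  by rewrite sawtooth_unit//; ring.
by rewrite sum_units// => /eqP; rewrite subr_eq0 => /eqP ->; ring.
Qed.

Definition unit_conv (m : nat) : R := \sum_(0 <= a < n) \sum_(0 <= b < n)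
   unit_saw a * unit_saw b * (a * b == m %[mod n])%:R.

(** Expanding the product of a - n/2 and b - n/2, the linear terms are sums over all the units,
because a determines b and conversely. *)
Lemma S2_unit_conv m : coprime m n ->
  (S2 n m)%:R - 1 / 4 * n%:R ^+ 2 * (totient n)%:R = unit_conv m.
Proof.
move=> mn.
pose I a b : R := (coprime a n)%:R * ((coprime b n)%:R * (a * b == m %[mod n])%:R).
have S2E : (S2 n m)%:R = \sum_(0 <= a < n) \sum_(0 <= b < n) I a b * (a%:R * b%:R).
  rewrite /S2 natr_sum big_mkcond.
  rewrite (eq_bigr (fun a => (coprime a n)%:R *
     \sum_(0 <= b < n) (coprime b n)%:R * ((a * b == m %[mod n])%:R * (a%:R * b%:R)))); last first.
    move=> a _; case: (coprime a n); last by rewrite mul0r.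
    rewrite mul1r -sum_range1 natr_sum big_mkcond; apply: eq_bigr => b _.
    by case: (coprime b n); rewrite /= ?mul0r// mul1r; case: eqP => _; rewrite ?mul0r// mul1r natrM.
  rewrite sum_range1; apply: eq_bigr => a _; rewrite mulr_sumr; apply: eq_bigr => b _.
  by rewrite /I; ring.
have TE : unit_conv m = \sum_(0 <= a < n) \sum_(0 <= b < n) I a b * ((a%:R - n%:R / 2) * (b%:R
  - n%:R / 2)).
  rewrite /unit_conv big_seq [RHS]big_seq; apply: eq_bigr => a; rewrite mem_index_iota =>
    /andP[_ an].
  rewrite big_seq [RHS]big_seq; apply: eq_bigr => b; rewrite mem_index_iota => /andP[_ bn].
  rewrite /unit_saw /I; have [ca|_] := boolP (coprime a n); last by rewrite !mul0r.
  have [cb|_] := boolP (coprime b n); last by rewrite !(mul0r, mulr0).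
  by rewrite !sawtooth_unit//; ring.
have inner a : coprime a n -> \sum_(0 <= b < n) (coprime b n)%:R * (a * b == m %[mod n])%:R =
  1 :> R.
  by move=> ca; apply: sum_unit_dirac.
have I1 : \sum_(0 <= a < n) \sum_(0 <= b < n) I a b * a%:R = n%:R * (totient n)%:R / 2.
  rewrite -sum_unit_id; apply: eq_bigr => a _; rewrite /I.
  have [ca|_] := boolP (coprime a n); last first.
    by rewrite mul0r big1// => b _; rewrite !mul0r.
  by rewrite -mulr_suml -mulr_sumr inner// mulr1.
have I2 : \sum_(0 <= a < n) \sum_(0 <= b < n) I a b * b%:R = n%:R * (totient n)%:R / 2.
  rewrite -I1 exchange_big; apply: eq_bigr => a _; apply: eq_bigr => b _.
  by rewrite /I [(b * a)%N]mulnC [X in X * _]mulrCA.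
have I0 : \sum_(0 <= a < n) \sum_(0 <= b < n) I a b = (totient n)%:R.
  rewrite -sum_units//; apply: eq_bigr => a _; rewrite /I -mulr_sumr.
  by have [ca|_] := boolP (coprime a n); rewrite ?mul0r// inner// mulr1.
rewrite TE S2E.
have -> : \sum_(0 <= a < n) \sum_(0 <= b < n) I a b * ((a%:R - n%:R / 2) * (b%:R - n%:R / 2)) =
   \sum_(0 <= a < n) \sum_(0 <= b < n) I a b * (a%:R * b%:R) -
   n%:R / 2 * \sum_(0 <= a < n) \sum_(0 <= b < n) I a b * a%:R -
   n%:R / 2 * \sum_(0 <= a < n) \sum_(0 <= b < n) I a b * b%:R +
   n%:R ^+ 2 / 4 * \sum_(0 <= a < n) \sum_(0 <= b < n) I a b.
  rewrite !mulr_sumr -!sumrB -big_split; apply: eq_bigr => a _ /=.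
  rewrite !mulr_sumr -!sumrB -big_split; apply: eq_bigr => b _ /=.
  by field.
by rewrite I1 I2 I0; field.
Qed.

Lemma sq_double (f : nat -> nat -> R) :
  (\sum_(0 <= a < n) \sum_(0 <= b < n) f a b) ^+ 2 =
  \sum_(0 <= a < n) \sum_(0 <= b < n) \sum_(0 <= c < n) \sum_(0 <= d < n) f a b * f c d.
Proof.
rewrite expr2 mulr_suml; apply: eq_bigr => a _; rewrite mulr_suml; apply: eq_bigr => b _.
by rewrite mulr_sumr; apply: eq_bigr => c _; rewrite mulr_sumr.
Qed.

Lemma unit_conv_second_moment : \sum_(0 <= m < n) (coprime m n)%:R * unit_conv m ^+ 2 =
  \sum_(0 <= a < n) \sum_(0 <= b < n) \sum_(0 <= c < n) \sum_(0 <= d < n)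
    unit_saw a * unit_saw b * (unit_saw c * unit_saw d) * (a * b == c * d %[mod n])%:R.
Proof.
under eq_bigr do rewrite /unit_conv sq_double mulr_sumr.
under eq_bigr do under eq_bigr do rewrite mulr_sumr.
under eq_bigr do under eq_bigr do under eq_bigr do rewrite mulr_sumr.
under eq_bigr do under eq_bigr do under eq_bigr do under eq_bigr do rewrite mulr_sumr.
rewrite exchange_sum4; apply: eq_bigr => a _; apply: eq_bigr => b _; apply: eq_bigr => c _.
apply: eq_bigr => d _.
have [ca|ca] := boolP (coprime a n); last first.
  by rewrite /unit_saw (negPf ca) !mul0r big1// => h _; rewrite !(mul0r, mulr0).
have [cb|cb] := boolP (coprime b n); last first.
  by rewrite /unit_saw (negPf cb) !(mul0r, mulr0) big1// => h _; rewrite !(mul0r, mulr0).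
rewrite (eq_bigr (fun m => (m == a * b %[mod n])%:R * ((coprime m n)%:R * (unit_saw a *
  unit_saw b * (unit_saw c * unit_saw d)) * (c * d == m %[mod n])%:R))); last first.
  by move=> m _; rewrite [(m %% n)%N == _]eq_sym; ring.
rewrite sum_mod_dirac// coprime_modl coprimeMl ca cb /= mul1r modn_mod.
by rewrite [(c * d %% n)%N == _]eq_sym.
Qed.

Lemma unit_dedekindE h : coprime h n -> unit_dedekind R n h =
  \sum_(0 <= a < n) \sum_(0 <= d < n) unit_saw a * unit_saw d * (h * d == a %[mod n])%:R.
Proof.
move=> hn; rewrite exchange_big; apply: eq_bigr => d _ /=.
rewrite (eq_bigr (fun a => (a == h * d %[mod n])%:R * (unit_saw a * unit_saw d))); last first.
  by move=> a _; rewrite [(a %% n)%N == _]eq_sym; ring.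
rewrite sum_mod_dirac// /unit_saw coprime_modl coprimeMl hn /= (sawtooth_mod R (modn_mod _ _)).
by case: coprime; rewrite ?mul0r// !mul1r mulrC.
Qed.

(** If hd = a, then hb = c is equivalent to ab = cd; and hd = a has one solution h. *)
Lemma unit_dedekind_sq_sum : \sum_(0 <= h < n) (coprime h n)%:R * unit_dedekind R n h ^+ 2 =
  \sum_(0 <= a < n) \sum_(0 <= b < n) \sum_(0 <= c < n) \sum_(0 <= d < n)
    unit_saw a * unit_saw b * (unit_saw c * unit_saw d) * (a * b == c * d %[mod n])%:R.
Proof.
have e h : (coprime h n)%:R * unit_dedekind R n h ^+ 2 = (coprime h n)%:R *
   (\sum_(0 <= a < n) \sum_(0 <= d < n) unit_saw a * unit_saw d * (h * d == a %[mod n])%:R) ^+ 2.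
  by have [hn|_] := boolP (coprime h n); rewrite ?mul0r// (unit_dedekindE hn).
under eq_bigr do rewrite e sq_double mulr_sumr.
under eq_bigr do under eq_bigr do rewrite mulr_sumr.
under eq_bigr do under eq_bigr do under eq_bigr do rewrite mulr_sumr.
under eq_bigr do under eq_bigr do under eq_bigr do under eq_bigr do rewrite mulr_sumr.
rewrite exchange_sum4; apply: eq_bigr => a _.
transitivity (\sum_(0 <= d < n) \sum_(0 <= c < n) \sum_(0 <= b < n)
   unit_saw a * unit_saw b * (unit_saw c * unit_saw d) * (a * b == c * d %[mod n])%:R).
  apply: eq_bigr => d _; apply: eq_bigr => c _; apply: eq_bigr => b _.
  have [ca|ca] := boolP (coprime a n); last first.
    by rewrite /unit_saw (negPf ca) !mul0r big1// => h _; rewrite !(mul0r, mulr0).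
  have [cd|cd] := boolP (coprime d n); last first.
    by rewrite /unit_saw (negPf cd) !(mul0r, mulr0) big1// => h _; rewrite !(mul0r, mulr0).
  rewrite (eq_bigr (fun h => unit_saw a * unit_saw b * (unit_saw c * unit_saw d) * (a * b == c
    * d %[mod n])%:R *
     ((coprime h n)%:R * (d * h == a %[mod n])%:R))); last first.
    move=> h _; have [hn|_] := boolP (coprime h n); last by rewrite !(mul0r, mulr0).
    rewrite [(d * h)%N]mulnC; case: (eqVneq (h * d %% n)%N (a %% n)%N) => [eh|_]; last by
      rewrite !(mul0r, mulr0).
    have -> : (h * b == c %[mod n]) = (a * b == c * d %[mod n]).
      rewrite -(eqmod_mull (h * b) c cd) -(modnMml a) -eh modnMml.
      by rewrite mulnCA mulnA [(d * c)%N]mulnC.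
    by ring.
  by rewrite -mulr_sumr sum_unit_dirac// mulr1.
transitivity (\sum_(0 <= d < n) \sum_(0 <= b < n) \sum_(0 <= c < n)
   unit_saw a * unit_saw b * (unit_saw c * unit_saw d) * (a * b == c * d %[mod n])%:R).
  by apply: eq_bigr => d _; rewrite exchange_big.
by rewrite exchange_big; apply: eq_bigr => b _; rewrite exchange_big.
Qed.

Lemma deviation_second_moment :
  \sum_(1 <= m < n.+1 | coprime m n) deviation R n m ^+ 2 =
  \sum_(0 <= h < n) (coprime h n)%:R * unit_dedekind R n h ^+ 2.
Proof.
rewrite unit_dedekind_sq_sum -unit_conv_second_moment -sum_range1 big_mkcond; apply: eq_bigr => m _.
have [mn|_] := boolP (coprime m n); last by rewrite mul0r.
by rewrite mul1r -S2_unit_conv// /deviation real_normK// num_real.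
Qed.
End Reduction.

Section Final.
Variable R : realType.

(** The main term is (n^2/2)(n/pi)^4 (pi^2/6)^2 (5/2) times the product of the local factors,
and the powers of pi cancel. *)
Lemma second_moment_bound (n : nat) (T : R) : odd n -> (1 < n)%N -> 1 <= T ->
  (forall u, (0 < u <= n * n)%N -> (size (divisors u))%:R <= T) -> harm R (n * n) <= T ->
  `| \sum_(1 <= m < n.+1 | coprime m n) deviation R n m ^+ 2
          - 5 * C R n / 144 * (n%:R * (totient n)%:R) ^+ 3 | <= 562 * n%:R ^+ 5 * T ^+ 6.
Proof.
move=> no n1 T1 hT hH; have n0 : (0 < n)%N by lia.
have n0R : (0 : R) < n%:R by rewrite ltr0n.
have T0 : 0 <= T by lra.
pose N := n./2.
have [N0 nN nN1 Nn] : [/\ 0 < N, n <= 3 * N, n <= 2 * N.+1 & N <= n * n]%N.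
  by rewrite /N; split; clear -no n1; nia.
have N0R : (0 : R) < N%:R by rewrite ltr0n.
have iN : N%:R^-1 <= 3 / n%:R :> R.
  by rewrite ler_pdivlMr// ler_pdivrMl// -natrM ler_nat mulnC.
have iN1 : N.+1%:R^-1 <= 2 / n%:R :> R.
  by rewrite ler_pdivlMr// ler_pdivrMl ?ltr0n// -natrM ler_nat mulnC.
have HN : harm R N <= T := le_trans (harm_mono R Nn) hH.
rewrite deviation_second_moment//.
have b1 := unit_dedekind_second_moment no T1 hT hH.
have b2 := diag_main_ray_limit no T1 hT hH.
have b3 := ray_limit_sum_asymp no n1 T1 hT hH.
set SD := \sum_(0 <= h < n) _ in b1 *.
set SM := \sum_(0 <= h < n) (coprime h n)%:R * diag_main R n h in b1 b2.
set SV := \sum_(1 <= x < n./2.+1) _ in b2 b3.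
set ph : R := (totient n)%:R in b3 *.
set c := C R n in b3 *.
pose k := kappa R n.
have k0 : 0 < k by apply: kappa_gt0.
have kn : k <= n%:R by apply: kappa_le.
rewrite -/k in b1.
have pi0 : (pi : R) != 0 by rewrite gt_eqF// pi_gt0.
have mainE : n%:R ^+ 2 / 2 * k ^+ 4 * (zeta2 R ^+ 2 * (5 / 2) * (c * ph ^+ 3 / n%:R ^+ 3)) =
   5 * c / 144 * (n%:R * ph) ^+ 3.
  rewrite /k /kappa /zeta2; move: (pi : R) pi0 => q q0.
  by field; rewrite q0 gt_eqF.
rewrite -mainE; set M0 := zeta2 R ^+ 2 * _ * _ in b3 *.
have be : layer_err n T <= 20 * T / n%:R.
  have h1 : 4 * harm R N / N%:R <= 4 * T * (3 / n%:R).
    by apply: ler_pM; rewrite ?mulr_ge0 ?invr_ge0 ?harm_ge0// ler_wpM2l.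
  have h2 : T * (4 / N.+1%:R) <= T * (4 * (2 / n%:R)) by rewrite ler_wpM2l// ler_wpM2l.
  rewrite /layer_err -/N; apply: le_trans (lerD h1 h2) _.
  by rewrite le_eqVlt; apply/orP; left; apply/eqP; ring.
have tri : SD - n%:R ^+ 2 / 2 * k ^+ 4 * M0 = (SD - n%:R ^+ 2 / 2 * k ^+ 4 * SM) +
   n%:R ^+ 2 / 2 * k ^+ 4 * ((SM - SV) + (SV - M0)) by ring.
rewrite tri; apply: le_trans (ler_normD _ _) _.
have coef0 : 0 <= n%:R ^+ 2 / 2 * k ^+ 4.
  by apply: mulr_ge0; [by rewrite divr_ge0 ?exprn_ge0|rewrite exprn_ge0// ltW].
have coefle : n%:R ^+ 2 / 2 * k ^+ 4 <= n%:R ^+ 6 / 2.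
  have -> : n%:R ^+ 6 / 2 = n%:R ^+ 2 / 2 * n%:R ^+ 4 :> R by field.
  rewrite ler_wpM2l ?divr_ge0 ?exprn_ge0// lerXn2r ?nnegrE// ltW//.
have T3 : T ^+ 3 <= T ^+ 6 by rewrite ler_weXn2l.
have T4 : T ^+ 4 <= T ^+ 6 by rewrite ler_weXn2l.
have e2 : `|SM - SV + (SV - M0)| <= 1112 * T ^+ 6 / n%:R.
  apply: le_trans (ler_normD _ _) _; apply: le_trans (lerD b2 b3) _.
  have h1 : 448 * T ^+ 4 / (n./2).+1%:R <= 896 * T ^+ 6 / n%:R.
    have -> : 896 * T ^+ 6 / n%:R = 448 * T ^+ 6 * (2 / n%:R) by ring.
    by apply: ler_pM; rewrite ?mulr_ge0 ?invr_ge0 ?exprn_ge0// ler_wpM2l.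
  have h2 : 9 * T ^+ 2 * layer_err n T <= 216 * T ^+ 6 / n%:R.
    apply: (@le_trans _ _ (9 * T ^+ 2 * (20 * T / n%:R))).
      by rewrite ler_wpM2l// mulr_ge0// exprn_ge0.
    have -> : 9 * T ^+ 2 * (20 * T / n%:R) = 180 * T ^+ 3 / n%:R by ring.
    rewrite ler_wpM2r ?invr_ge0//.
    apply: (@le_trans _ _ (180 * T ^+ 6)); first by rewrite ler_wpM2l.
    by rewrite ler_wpM2r ?exprn_ge0// ler_nat.
  apply: le_trans (lerD h1 h2) _.
  by rewrite le_eqVlt; apply/orP; left; apply/eqP; ring.
rewrite normrM (ger0_norm coef0).
have e3 := ler_pM coef0 (normr_ge0 _) coefle e2.
apply: le_trans (lerD b1 e3) _.
by rewrite le_eqVlt; apply/orP; left; apply/eqP; field; rewrite gt_eqF.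
Qed.

(** The number of divisors and the harmonic sum are both small powers at n^2. *)
Lemma subpolynomial_bound (e : R) : 0 < e -> exists2 K : R, 1 <= K & forall n : nat, (0 < n)%N ->
  let T := K * n%:R `^ (2 * e) in [/\ 1 <= T,
  (forall u, (0 < u <= n * n)%N -> (size (divisors u))%:R <= T) & harm R (n * n) <= T].
Proof.
move=> e0; have [K1 K11 h1] := divisor_bound e0; have [K2 K21 h2] := harm_le_powR e0.
exists (K1 + K2); first lra.
move=> n n0 T.
have nn : (n * n)%:R `^ e = n%:R `^ (2 * e).
  by rewrite mulnn natrX -powR_mulrn ?ler0n// -powRrM.
have p0 : 0 <= n%:R `^ (2 * e) := powR_ge0 _ _.
have t1 : K1 * n%:R `^ (2 * e) <= T by rewrite /T ler_wpM2r//; lra.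
have t2 : K2 * n%:R `^ (2 * e) <= T by rewrite /T ler_wpM2r//; lra.
split.
- apply: le_trans t1; rewrite -[leLHS]mul1r; apply: ler_pM => //.
  by apply: powR_ge1; rewrite ?ler1n// mulr_ge0// ltW.
- move=> u /andP[u0 un]; apply: le_trans t1; apply: le_trans (h1 u u0) _.
  rewrite ler_wpM2l; [|lra|] => //.
  by rewrite -nn; apply: ge0_ler_powR; rewrite ?nnegrE ?ler0n ?ler_nat ?ltW.
- by apply: le_trans t2; rewrite -nn; apply: h2; rewrite muln_gt0 n0.
Qed.

Lemma second_moment_asymp (eps : R) : 0 < eps ->
     exists K : R, forall n : nat, odd n -> (3 <= n)%N ->
       `| \sum_(1 <= m < n.+1 | coprime m n) deviation R n m ^+ 2
          - 5 * C R n / 144 * (n%:R * (totient n)%:R) ^+ 3 |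
       <= K * n%:R `^ (5 + eps).
Proof.
(* T is taken at n^2 and enters to the power 6, so its exponent is 12 times e. *)
move=> eps0; have e0 : 0 < eps / 12 by lra.
have [K K1 hK] := subpolynomial_bound e0; exists (562 * K ^+ 6) => n no n3.
have n0 : (0 < n)%N by lia.
have [T1 hT hH] := hK n n0.
apply: le_trans (second_moment_bound no _ T1 hT hH) _; first by lia.
rewrite le_eqVlt; apply/orP; left; apply/eqP.
have nz : (n%:R : R) != 0 by rewrite pnatr_eq0 -lt0n.
have n0R : (0 : R) <= n%:R by [].
have e6 : (n%:R `^ (2 * (eps / 12))) ^+ 6 = n%:R `^ eps.
  rewrite -powR_mulrn ?powR_ge0// -powRrM; congr (_ `^ _); by field.
rewrite exprMn e6 powRD; last by rewrite nz implybT.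
by rewrite powR_mulrn//; ring.
Qed.

Lemma C_ge1 n : 1 <= C R n.
Proof.
rewrite /C big_seq; elim/big_ind: _ => //.
  by move=> x y x1 y1; rewrite -[leLHS]mul1r; apply: ler_pM.
move=> p; rewrite mem_primes => /and3P[pp _ _].
by case/andP: (Cfactor_le2 R (logn p n) pp).
Qed.

(** n/phi(n) is the product of 1/(1 - 1/p), and every factor is at most 2. *)
Lemma totient_lower n : (0 < n)%N ->
   n%:R <= (totient n)%:R * (size (divisors n))%:R :> R.
Proof.
move=> n0; apply: (@le_trans _ _ ((totient n)%:R * (2 ^ size (primes n))%:R)); last first.
  by rewrite ler_wpM2l// ler_nat exp2_omega.
rewrite totient_prod//.
rewrite exp2_size.
rewrite -mulrA -big_split /= ler_peMr// big_seq; elim/big_ind: _ => //.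
  by move=> x y x1 y1; rewrite -[leLHS]mul1r; apply: ler_pM.
move=> p; rewrite mem_primes => /and3P[pp _ _].
have : p%:R^-1 <= 2^-1 :> R by rewrite lef_pV2 ?posrE ?ltr0n ?prime_gt0// ler_nat prime_gt1.
by move=> h; lra.
Qed.

(** If all the deviations were below n^(3/2) phi(n)/10, the second moment would be at most (n
phi(n))^3/100, while its main term is at least 5/144 of (n phi(n))^3. *)
Lemma large_deviation : exists2 c : R, 0 < c &
     exists N : nat, forall n : nat, odd n -> (N <= n)%N ->
       exists m : nat,
         [/\ (1 <= m <= n)%N, coprime m n &
             c * n%:R `^ (3 / 2) * (totient n)%:R <= deviation R n m].
Proof.
have e0 : (0 : R) < 1 / 10 by lra.
have [K hK] := second_moment_asymp e0.
have [K' K'1 hK'] := divisor_bound e0.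
exists (1 / 10); first lra.
(* 50 comes from 5/144 - 1/100 >= 1/50; the exponents are 6 - 3/10 for the main term and 5 +
1/10 for the error. *)
pose L : R := 50 * `|K| * K' ^+ 3.
exists (maxn 3 (Num.bound (L `^ 2))) => n no; rewrite geq_max => /andP[n3 nL].
have n0 : (0 < n)%N by lia.
have n0R : (0 : R) < n%:R by rewrite ltr0n.
have n1R : (1 : R) <= n%:R by rewrite ler1n.
have nz : (n%:R : R) != 0 by rewrite gt_eqF.
have K3 : 0 < K' ^+ 3 by rewrite exprn_gt0//; lra.
have L0 : 0 <= L by apply: mulr_ge0; [exact: mulr_ge0|exact: ltW].
have Ln : L <= n%:R `^ (6 / 10).
  have h : L `^ 2 <= n%:R.
    apply: le_trans (ltW (archi_boundP (powR_ge0 _ _))) _; by rewrite ler_nat.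
  apply: (@le_trans _ _ (n%:R `^ (1 / 2))); last by rewrite ler_powR//; lra.
  have -> : L = (L `^ 2) `^ (1 / 2).
    rewrite -powRrM; have -> : 2 * (1 / 2) = 1 :> R by lra.
    by rewrite powRr1.
  by apply: ge0_ler_powR; rewrite ?nnegrE ?powR_ge0//; lra.
set ph : R := (totient n)%:R.
have ph0 : 0 <= ph by [].
have phn : n%:R <= ph * (K' * n%:R `^ (1 / 10)).
  by apply: le_trans (totient_lower n0) _; rewrite ler_wpM2l// hK'.
have cube : 50 * (`|K| * n%:R `^ (5 + 1 / 10)) <= (n%:R * ph) ^+ 3.
  have x0 : (0 : R) < n%:R `^ (3 / 10) by rewrite powR_gt0.
  have y0 : (0 : R) < n%:R `^ (6 / 10) by rewrite powR_gt0.
  have h3 : n%:R ^+ 3 <= ph ^+ 3 * (K' ^+ 3 * n%:R `^ (3 / 10)).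
    have : n%:R ^+ 3 <= (ph * (K' * n%:R `^ (1 / 10))) ^+ 3.
      by rewrite lerXn2r ?nnegrE ?mulr_ge0 ?powR_ge0//; lra.
    have e3 : (n%:R `^ (1 / 10)) ^+ 3 = n%:R `^ (3 / 10) :> R.
      by rewrite -powR_mulrn ?powR_ge0// -powRrM; congr (_ `^ _); lra.
    by rewrite !exprMn e3.
  rewrite -(ler_pM2r (mulr_gt0 K3 x0)).
  have -> : (n%:R * ph) ^+ 3 * (K' ^+ 3 * n%:R `^ (3 / 10)) =
     n%:R ^+ 3 * (ph ^+ 3 * (K' ^+ 3 * n%:R `^ (3 / 10))) by ring.
  apply: (@le_trans _ _ (n%:R ^+ 3 * n%:R ^+ 3)); last first.
    by rewrite ler_wpM2l// exprn_ge0// ltW.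
  have -> : n%:R ^+ 3 * n%:R ^+ 3 = n%:R `^ (6 / 10) * (n%:R `^ (5 + 1 / 10) * n%:R `^ (3 /
    10)) :> R.
    rewrite -!powRD ?nz ?implybT//.
    have -> : 6 / 10 + (5 + 1 / 10 + 3 / 10) = 6%:R :> R by lra.
    by rewrite powR_mulrn ?ltW//; ring.
  have -> : 50 * (`|K| * n%:R `^ (5 + 1 / 10)) * (K' ^+ 3 * n%:R `^ (3 / 10)) =
    L * (n%:R `^ (5 + 1 / 10) * n%:R `^ (3 / 10)) by rewrite /L; ring.
  by rewrite ler_wpM2r// mulr_ge0// powR_ge0.
pose S := \sum_(1 <= m < n.+1 | coprime m n) deviation R n m ^+ 2.
have lowS : 1 / 100 * (n%:R * ph) ^+ 3 < S.
  have := hK n no n3; rewrite -/S -/ph ler_norml => /andP[h _].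
  have c1 := C_ge1 n.
  have np : 0 < (n%:R * ph) ^+ 3 by rewrite exprn_gt0// mulr_gt0// ltr0n totient_gt0.
  have h2 : (n%:R * ph) ^+ 3 <= C R n * (n%:R * ph) ^+ 3 by rewrite ler_peMl// ltW.
  have h4 : K * n%:R `^ (5 + 1 / 10) <= `|K| * n%:R `^ (5 + 1 / 10).
    by rewrite ler_wpM2r ?powR_ge0// ler_norm.
  have e5 : 5 * C R n / 144 * (n%:R * ph) ^+ 3 = 5 / 144 * (C R n * (n%:R * ph) ^+ 3) by ring.
  rewrite e5 in h.
  have gen (Z A B X Y : R) : - X <= Z - 5 / 144 * A -> B <= A -> X <= Y ->
      50 * Y <= B -> 0 < B -> 1 / 100 * B < Z by move=> *; lra.
  exact: gen h h2 h4 cube np.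
have [hs|hs] := boolP (has (fun m => coprime m n && (1 / 10 * n%:R `^ (3 / 2) * ph <= deviation
  R n m)) (index_iota 1 n.+1)).
  case/hasP: hs => m; rewrite mem_index_iota ltnS => mn /andP[cm hm].
  by exists m; split.
have upS : S <= 1 / 100 * (n%:R * ph) ^+ 3.
  have b m : m \in index_iota 1 n.+1 -> coprime m n ->
      deviation R n m ^+ 2 <= 1 / 100 * n%:R ^+ 3 * ph ^+ 2.
    move=> mi cm; move/hasPn: hs => /(_ m mi); rewrite cm /= -ltNge => lt.
    have -> : 1 / 100 * n%:R ^+ 3 * ph ^+ 2 = (1 / 10 * n%:R `^ (3 / 2) * ph) ^+ 2.
      have e2 : (n%:R `^ (3 / 2)) ^+ 2 = n%:R ^+ 3 :> R.
        rewrite -powR_mulrn ?powR_ge0// -powRrM -powR_mulrn ?(ltW n0R)//.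
        by congr (_ `^ _); lra.
      by rewrite !exprMn e2; field.
    have d0 : 0 <= deviation R n m by apply: normr_ge0.
    by rewrite ler_pXn2r ?nnegrE ?d0 ?(le_trans d0 (ltW lt)) ?(ltW lt).
  apply: (@le_trans _ _ (\sum_(1 <= m < n.+1) (coprime m n)%:R * (1 / 100 * n%:R ^+ 3 * ph ^+ 2))).
    rewrite /S big_mkcond big_seq [leRHS]big_seq; apply: ler_sum => m mi.
    have [cm|_] := boolP (coprime m n); last by rewrite mul0r.
    by rewrite [leRHS]mul1r b.
  have n1 : (1 < n)%N by apply: leq_trans n3.
  rewrite (@sum_range1 R n n1 (fun=> 1 / 100 * n%:R ^+ 3 * ph ^+ 2)).
  rewrite -mulr_suml sum_units// -/ph le_eqVlt; apply/orP; left; apply/eqP; ring.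
by move: (lt_le_trans lowS upS); rewrite ltxx.
Qed.

End Final.

Theorem theorem4 (R : realType) :
  (forall eps : R, 0 < eps ->
     exists K : R, forall n : nat, odd n -> (3 <= n)%N ->
       `| \sum_(1 <= m < n.+1 | coprime m n) deviation R n m ^+ 2
          - 5 * C R n / 144 * (n%:R * (totient n)%:R) ^+ 3 |
       <= K * n%:R `^ (5 + eps))
  /\
  (exists2 c : R, 0 < c &
     exists N : nat, forall n : nat, odd n -> (N <= n)%N ->
       exists m : nat,
         [/\ (1 <= m <= n)%N, coprime m n &
             c * n%:R `^ (3 / 2) * (totient n)%:R <= deviation R n m]).
Proof. by split; [exact: second_moment_asymp|exact: large_deviation]. Qed.
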